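(* Let $G=\mathbb{Z}_2\times\mathbb{Z}_2=\{0,a,b,c\}$, so $d=2+\sqrt5$. The solutions of the polynomial equations (P1)–(P9) for $G$ are the following: $\eta_g=1$, $\epsilon_h(g)=\chi(h,g)$, and, with functions on $G\times G$ written as matrices with rows (first variable) and columns (second variable) in the order $0,a,b,c$, $$A_0=\frac1{d-1}\begin{pmatrix}d-2&-1&-1&-1\\-1&-1&z&\overline z\\-1&\overline z&-1&z\\-1&z&\overline z&-1\end{pmatrix},$$ $$A_a=\frac1{d-1}\begin{pmatrix}d-2&-1&-1&-1\\-1&1&\chi(a,b)z&\chi(a,c)\overline z\\-1&\chi(a,b)\overline z&-\chi(b,a)&-z\\-1&\chi(a,c)z&-\overline z&-\chi(c,a)\end{pmatrix},$$ $$A_b=\frac1{d-1}\begin{pmatrix}d-2&-1&-1&-1\\-1&-\chi(a,b)&\chi(b,a)z&-\overline z\\-1&\chi(b,a)\overline z&1&\chi(b,c)z\\-1&-z&\chi(b,c)\overline z&-\chi(c,b)\end{pmatrix},$$ $$A_c=\frac1{d-1}\begin{pmatrix}d-2&-1&-1&-1\\-1&-\chi(a,c)&-z&\chi(c,a)\overline z\\-1&-\overline z&-\chi(b,c)&\chi(c,b)z\\-1&\chi(c,a)z&\chi(c,b)\overline z&1\end{pmatrix},\qquad \chi=\begin{pmatrix}1&1&1&1\\1&-1&s&-s\\1&-s&-1&s\\1&s&-s&-1\end{pmatrix},$$ where $s\in\{1,-1\}$ and $z\in\{\sqrt d,-\sqrt d,i\sqrt d,-i\sqrt d\}$. By gauge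 transformations and group automorphisms, the solutions with $z\in\mathbb{R}$ (respectively $z\in i\mathbb{R}$) are transformed to each other. Up to gauge transformations, group automorphisms, and the $H^2(G,\mathbb{T})$-action, there is only one equivalence class of solutions. Let $\mathcal{C}$ be the generalized Haagerup category generated by $\rho$ (associated with such a solution). Then $\operatorname{Out}(\mathcal{C})$ is isomorphic to the alternating group $\mathfrak{A}_4=(\mathbb{Z}_2\times\mathbb{Z}_2)\rtimes\mathbb{Z}_3$.
   Context: Let $G$ be a finite abelian group, written additively, $n=|G|$, $d=\frac{n+\sqrt{n^2+4}}2$, $\mathbb T=\{z\in\mathbb C:|z|=1\}$. Polynomial equations. $\epsilon_h(g)\in\{1,-1\}$, $\eta_g\in\mathbb T$, $A_g(h,k)\in\mathbb C$ satisfy, for all elements of $G$: (P1) $\epsilon_{h+k}(g)=\epsilon_h(g)\epsilon_k(g+2h)$, $\epsilon_h(0)=1$; (P2) $\eta_{g+2h}=\eta_g$, $\eta_g^3=1$; (P3) $\sum_{h}A_g(h,0)=-\overline{\eta_g}/d$; (P4) $\sum_{h}A_g(h-g,k)\overline{A_{g'}(h-g',k)}=\delta_{g,g'}-\frac{\overline{\eta_g}\eta_{g'}}{d}\delta_{k,0}$; (P5) $A_{g+2h}(p,q)=\epsilon_h(g)\epsilon_h(g+p)\epsilon_h(g+q)\epsilon_h(g+p+q)A_g(p,q)$; (P6) $A_g(k,h)=\overline{A_g(h,k)}$; (P7) $A_g(h,k)=A_g(-k,h-k)\,\eta_g\,\epsilon_{-k}(g+h)\epsilon_{-k}(g+k)\epsilon_{-k}(g+h+k)=A_g(k-h,-h)\,\overline{\eta_g}\,\epsilon_{-h}(g+h)\epsilon_{-h}(g+k)\epsilon_{-h}(g+h+k)$;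 (P8) $A_g(h,k)=A_{g+h}(h,k)\eta_g\eta_{g+k}\overline{\eta_{g+h}\eta_{g+h+k}}\epsilon_h(g)\epsilon_h(g+k)=A_{g+k}(h,k)\overline{\eta_g\eta_{g+h}}\eta_{g+k}\eta_{g+h+k}\epsilon_k(g)\epsilon_k(g+h)$; (P9) $\sum_{l}A_g(x+y,l)A_{g-p+x}(-x,l+p)A_{g-q+x+y}(-y,l+q)=A_g(p+x,q+x+y)A_{g-p}(q+y,p+x+y)\,\eta_g\eta_{g+q+x}\eta_{g+p+q+y}\overline{\eta_{g+p}\eta_{g+x+y}\eta_{g+q+x+y}}\,\epsilon_p(g-p+x)\epsilon_{p+x}(g-p+q+y)\epsilon_q(g-q+x+y)\epsilon_{q+y}(g-q+x)-\frac{\delta_{x,0}\delta_{y,0}}{d}\eta_g\eta_{g+p}\eta_{g+q}$. Gauge transformation by $\delta_g\in\{1,-1\}$: $\epsilon'_h(g)=\delta_g\delta_{g+2h}\epsilon_h(g)$, $\eta'=\eta$, $A'_g(h,k)=\delta_g\delta_{g+h}\delta_{g+k}\delta_{g+h+k}A_g(h,k)$. $\theta\in\operatorname{Aut}(G)$ acts by $\epsilon'_{\theta(h)}(\theta(g))=\epsilon_h(g)$, $\eta'_{\theta(g)}=\eta_g$, $A'_{\theta(g)}(\theta(h),\theta(k))=A_g(h,k)$. $H^2(G,\mathbb T)$-action on gauge equivalence classes: every class has a representative $\omega$ with $\omega(g,0)=\omega(0,g)=\omega(g,-g)=1$ and $\omega(g,h)\omega(h,g)=\omega(g,h)\overline{\omega(-g,-h)}=1$;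 choose $\mu:G\to\{1,-1\}$ with $\mu(2g)=\omega(g,g)$; then $[\omega]$ acts by $\epsilon'_h(g)=\epsilon_h(g)\mu(g)\mu(g+2h)\overline{\omega(h,g)\omega(g+h,h)}$, $\eta'=\eta$, $A'_g(h,k)=A_g(h,k)\mu(g+k)\mu(g)\mu(g+h+k)\mu(g+h)\overline{\omega(g+k,h)\omega(h,g)}$. Associated category. A solution is realized on a type III factor $M$ by an outer action $\alpha$ of $G$, an irreducible $\rho\in\operatorname{End}(M)$ with $\alpha_g\rho=\rho\alpha_{-g}$, and isometries $S\in(\mathrm{id},\rho^2)$, $T_g\in(\alpha_g\rho,\rho^2)$ (where $(\sigma,\sigma')=\{T\in M:T\sigma(x)=\sigma'(x)T\ \forall x\}$) with $SS^*+\sum_gT_gT_g^*=1$, $\alpha_h(S)=S$, $\alpha_h(T_g)=\epsilon_h(g)T_{g+2h}$, $\rho(S)=\frac1dS+\frac1{\sqrt d}\sum_gT_gT_g$, $\alpha_g\rho(T_g)=\eta_gT_gSS^*+\frac{\overline{\eta_g}}{\sqrt d}ST_g^*+\sum_{h,k}A_g(h,k)T_{g+h}T_{g+h+k}T_{g+k}^*$. The category generated by $\rho$ is a C$^*$-fusion category with simple objects $\alpha_g,\alpha_g\rho$ and $[\rho]^2=[\mathrm{id}]+\sum_g[\alpha_g\rho]$. $\operatorname{Out}(\mathcal C)$ is the group of $*$-preserving monoidal auto-equivalences up to monoidal natural isomorphism, modulo conjugations by invertible objects. *)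

(* Defs.v *)
From HB Require Import structures.
From Stdlib Require Import Relation_Operators.
From mathcomp Require Import all_boot all_order all_algebra all_fingroup all_solvable.
From mathcomp Require Import complex.
From mathcomp Require Import boolp classical_sets functions reals topology normedtype.

Set Implicit Arguments.
Unset Strict Implicit.
Unset Printing Implicit Defensive.

Import Order.TTheory GRing.Theory Num.Theory.
Import numFieldNormedType.Exports.

Local Open Scope ring_scope.

Definition gh_dim (R : realType) (G : finZmodType) : R :=
  (#|G|%:R + Num.sqrt (#|G|%:R ^+ 2 + 4)) / 2.

(* Arguments: [eps h g] is epsilon_h(g), [amp g h k] is A_g(h,k). *)
Record gh_data (R : realType) (G : finZmodType) := GHData {
  eps : G -> G -> R[i];
  eta : G -> R[i];
  amp : G -> G -> G -> R[i] }.

Definition is_sign (R : realType) (c : R[i]) : Prop := c = 1 \/ c = -1.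

Definition kron (R : realType) (G : finZmodType) (g h : G) : R[i] := (g == h)%:R.

Record gh_solution (R : realType) (G : finZmodType) (x : gh_data R G) : Prop := {
  gh_eps_sign : forall h g, is_sign (eps x h g);
  gh_eta_circle : forall g, `|eta x g| = 1;
  gh_P1 : forall h k g,
    eps x (h + k) g = eps x h g * eps x k (g + h *+ 2);
  gh_P1_0 : forall h, eps x h 0 = 1;
  gh_P2 : forall g h, eta x (g + h *+ 2) = eta x g;
  gh_P2_3 : forall g, eta x g ^+ 3 = 1;
  gh_P3 : forall g,
    \sum_(h : G) amp x g h 0 = - ((eta x g)^* / (gh_dim R G)%:C%C);
  gh_P4 : forall g g' k,
    \sum_(h : G) amp x g (h - g) k * (amp x g' (h - g') k)^* =
    kron R g g' - (eta x g)^* * eta x g' / (gh_dim R G)%:C%C * kron R k 0;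
  gh_P5 : forall g h p q,
    amp x (g + h *+ 2) p q =
    eps x h g * eps x h (g + p) * eps x h (g + q) * eps x h (g + p + q) *
    amp x g p q;
  gh_P6 : forall g h k, amp x g k h = (amp x g h k)^*;
  gh_P7l : forall g h k,
    amp x g h k =
    amp x g (- k) (h - k) * eta x g *
    eps x (- k) (g + h) * eps x (- k) (g + k) * eps x (- k) (g + h + k);
  gh_P7r : forall g h k,
    amp x g h k =
    amp x g (k - h) (- h) * (eta x g)^* *
    eps x (- h) (g + h) * eps x (- h) (g + k) * eps x (- h) (g + h + k);
  gh_P8l : forall g h k,
    amp x g h k =
    amp x (g + h) h k * eta x g * eta x (g + k) *
    (eta x (g + h) * eta x (g + h + k))^* * eps x h g * eps x h (g + k);
  gh_P8r : forall g h k,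
    amp x g h k =
    amp x (g + k) h k * (eta x g * eta x (g + h))^* *
    eta x (g + k) * eta x (g + h + k) * eps x k g * eps x k (g + h);
  gh_P9 : forall g p q s t,
    \sum_(l : G) amp x g (s + t) l * amp x (g - p + s) (- s) (l + p) *
                 amp x (g - q + s + t) (- t) (l + q) =
    amp x g (p + s) (q + s + t) * amp x (g - p) (q + t) (p + s + t) *
      eta x g * eta x (g + q + s) * eta x (g + p + q + t) *
      (eta x (g + p) * eta x (g + s + t) * eta x (g + q + s + t))^* *
      eps x p (g - p + s) * eps x (p + s) (g - p + q + t) *
      eps x q (g - q + s + t) * eps x (q + t) (g - q + s)
    - kron R s 0 * kron R t 0 / (gh_dim R G)%:C%C *
      eta x g * eta x (g + p) * eta x (g + q) }.

Definition gauge_step (R : realType) (G : finZmodType) (x y : gh_data R G) : Prop :=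
  exists2 delta : G -> R[i], (forall g, is_sign (delta g)) &
    y = GHData
      (fun h g => delta g * delta (g + h *+ 2) * eps x h g)
      (eta x)
      (fun g h k => delta g * delta (g + h) * delta (g + k) * delta (g + h + k) *
                    amp x g h k).

Definition aut_step (R : realType) (G : finZmodType) (x y : gh_data R G) : Prop :=
  exists theta : {additive G -> G},
    [/\ bijective theta,
        forall h g, eps y (theta h) (theta g) = eps x h g,
        forall g, eta y (theta g) = eta x g &
        forall g h k, amp y (theta g) (theta h) (theta k) = amp x g h k].

(* The representatives of classes in H^2(G,T) through which the group acts. *)
Record adapted_cocycle (R : realType) (G : finZmodType) (om : G -> G -> R[i]) : Prop := {
  ac_circle : forall g h, `|om g h| = 1;
  ac_cocycle : forall g h k, om g h * om (g + h) k = om h k * om g (h + k);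
  ac_r0 : forall g, om g 0 = 1;
  ac_l0 : forall g, om 0 g = 1;
  ac_N : forall g, om g (- g) = 1;
  ac_anti : forall g h, om g h * om h g = 1;
  ac_NN : forall g h, om g h * (om (- g) (- h))^* = 1 }.

Definition H2_step (R : realType) (G : finZmodType) (x y : gh_data R G) : Prop :=
  exists (om : G -> G -> R[i]) (mu : G -> R[i]),
    [/\ adapted_cocycle om, forall g, is_sign (mu g),
        forall g, mu (g *+ 2) = om g g &
        y = GHData
          (fun h g => eps x h g * mu g * mu (g + h *+ 2) *
                      (om h g * om (g + h) h)^*)
          (eta x)
          (fun g h k => amp x g h k * mu (g + k) * mu g * mu (g + h + k) *
                        mu (g + h) * (om (g + k) h * om h g)^*)].

Definition gauge_aut_equiv (R : realType) (G : finZmodType) :=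
  clos_refl_sym_trans (gh_data R G)
    (fun x y => gauge_step x y \/ aut_step x y).

Definition gauge_aut_H2_equiv (R : realType) (G : finZmodType) :=
  clos_refl_sym_trans (gh_data R G)
    (fun x y => [\/ gauge_step x y, aut_step x y | H2_step x y]).

HB.instance Definition _ (U V : finZmodType) := GRing.Zmodule.on (U * V)%type.

Definition V4 : finZmodType := ('Z_2 * 'Z_2)%type.
Definition Va : V4 := (1 : 'Z_2, 0 : 'Z_2).
Definition Vb : V4 := (0 : 'Z_2, 1 : 'Z_2).
Definition Vc : V4 := (1 : 'Z_2, 1 : 'Z_2).

(* The function on V4 x V4 with a given table of values; rows and columns are
   in the order 0, a, b, c. *)
Definition table (R : realType) (t : seq (seq R[i])) (g h : V4) : R[i] :=
  nth 0 (nth [::] t (index g [:: 0; Va; Vb; Vc])) (index h [:: 0; Va; Vb; Vc]).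

Definition chi (R : realType) (s : R[i]) : V4 -> V4 -> R[i] :=
  table [:: [:: 1;   1;   1;   1];
            [:: 1; - 1;   s; - s];
            [:: 1; - s; - 1;   s];
            [:: 1;   s; - s; - 1]].

Definition V4_amp (R : realType) (s z : R[i]) (g : V4) : V4 -> V4 -> R[i] :=
  let d := (gh_dim R V4)%:C%C in
  let X := chi s in
  let A0 := table
    [:: [:: d - 2; - 1;  - 1;  - 1 ];
        [:: - 1;   - 1;    z;   z^*];
        [:: - 1;    z^*; - 1;   z  ];
        [:: - 1;    z;    z^*; - 1 ]] in
  let Aa := table
    [:: [:: d - 2; - 1;  - 1;  - 1 ];
        [:: - 1;     1;            X Va Vb * z; X Va Vc * z^*];
        [:: - 1;   X Va Vb * z^*;  - X Vb Va;   - z          ];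
        [:: - 1;   X Va Vc * z;    - z^*;       - X Vc Va    ]] in
  let Ab := table
    [:: [:: d - 2; - 1;  - 1;  - 1 ];
        [:: - 1;   - X Va Vb;      X Vb Va * z;    - z^*      ];
        [:: - 1;   X Vb Va * z^*;  1;              X Vb Vc * z];
        [:: - 1;   - z;            X Vb Vc * z^*;  - X Vc Vb  ]] in
  let Ac := table
    [:: [:: d - 2; - 1;  - 1;  - 1 ];
        [:: - 1;   - X Va Vc;    - z;            X Vc Va * z^*];
        [:: - 1;   - z^*;        - X Vb Vc;      X Vc Vb * z  ];
        [:: - 1;   X Vc Va * z;  X Vc Vb * z^*;  1            ]] in
  fun h k => (d - 1)^-1 * nth A0 [:: A0; Aa; Ab; Ac] (index g [:: 0; Va; Vb; Vc]) h k.

Definition V4_data (R : realType) (s z : R[i]) : gh_data R V4 :=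
  GHData (chi s) (fun=> 1) (V4_amp s z).

Definition V4_parameters (R : realType) (s z : R[i]) : Prop :=
  let r := (Num.sqrt (gh_dim R V4))%:C%C in
  (s \in [:: 1; - 1]) /\ (z \in [:: r; - r; 'i * r; - ('i * r)]).

Record hilbert_dot (R : realType) (H : completeNormedModType R[i])
    (dot : H -> H -> R[i]) : Prop := {
  dot_linearl : forall a u v w, dot (a *: u + v) w = a * dot u w + dot v w;
  dot_conj : forall u v, dot v u = (dot u v)^*;
  dot_norm : forall u, `|u| ^+ 2 = dot u u }.

Definition bounded_operator (R : realType) (H : completeNormedModType R[i])
    (f : H -> H) : Prop :=
  linear f /\ continuous f.

Definition commutant (R : realType) (H : completeNormedModType R[i])
    (A : set (H -> H)) : set (H -> H) :=
  [set f | bounded_operator f /\ forall f', A f' -> f \o f' =1 f' \o f].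

Record faithful_representation (R : realType) (M : algType R[i]) (star : M -> M)
    (H : completeNormedModType R[i]) (dot : H -> H -> R[i])
    (pi : M -> H -> H) : Prop := {
  rep_bounded : forall x, bounded_operator (pi x);
  rep_linear : forall a x y u, pi (a *: x + y) u = a *: pi x u + pi y u;
  rep_mul : forall x y u, pi (x * y) u = pi x (pi y u);
  rep_1 : forall u, pi 1 u = u;
  rep_star : forall x u v, dot (pi x u) v = dot u (pi (star x) v);
  rep_inj : injective pi }.

(* [M] with the involution [star] is a *-algebra isomorphic to a unital
   *-algebra of bounded operators equal to its double commutant. *)
Definition von_neumann_algebra (R : realType) (M : algType R[i]) (star : M -> M) : Prop :=
  exists (H : completeNormedModType R[i]) (dot : H -> H -> R[i]) (pi : M -> H -> H),
    [/\ hilbert_dot dot, faithful_representation star dot pi &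
        commutant (commutant (range pi)) = range pi].

Definition is_factor (R : realType) (M : algType R[i]) : Prop :=
  forall x : M, (forall y, x * y = y * x) -> exists c : R[i], x = c *: 1.

Definition projection (R : realType) (M : algType R[i]) (star : M -> M) (p : M) : Prop :=
  p * p = p /\ star p = p.

(* [p] is equivalent to a proper subprojection of itself. *)
Definition infinite_projection (R : realType) (M : algType R[i]) (star : M -> M)
    (p : M) : Prop :=
  exists v : M, [/\ star v * v = p, p * (v * star v) = v * star v & v * star v <> p].

Definition type_III_factor (R : realType) (M : algType R[i]) (star : M -> M) : Prop :=
  [/\ von_neumann_algebra star, is_factor M &
      forall p, projection star p -> p <> 0 -> infinite_projection star p].

Record star_endo (R : realType) (M : algType R[i]) (star : M -> M)
    (sigma : M -> M) : Prop := {
  endo_linear : linear sigma;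
  endo_1 : sigma 1 = 1;
  endo_mul : forall x y, sigma (x * y) = sigma x * sigma y;
  endo_star : forall x, sigma (star x) = star (sigma x) }.

Definition intertwiner (R : realType) (M : algType R[i]) (sigma tau : M -> M)
    : set M :=
  [set T | forall x, T * sigma x = tau x * T].

Definition isometry (R : realType) (M : algType R[i]) (star : M -> M) (V : M) : Prop :=
  star V * V = 1.

Definition unitary (R : realType) (M : algType R[i]) (star : M -> M) (U : M) : Prop :=
  star U * U = 1 /\ U * star U = 1.

Record outer_action (R : realType) (M : algType R[i]) (star : M -> M)
    (G : finZmodType) (alpha : G -> M -> M) : Prop := {
  act_endo : forall g, star_endo star (alpha g);
  act_0 : forall x, alpha 0 x = x;
  act_D : forall g h x, alpha (g + h) x = alpha g (alpha h x);
  act_outer : forall g, g != 0 ->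
    ~ exists2 U, unitary star U & forall x, alpha g x = U * x * star U }.

Record realization (R : realType) (G : finZmodType) (x : gh_data R G)
    (M : algType R[i]) (star : M -> M) (alpha : G -> M -> M) (rho : M -> M)
    (S : M) (T : G -> M) : Prop := {
  rz_action : outer_action star alpha;
  rz_endo : star_endo star rho;
  rz_irreducible : forall V, intertwiner rho rho V -> exists c : R[i], V = c *: 1;
  rz_commutation : forall g y, alpha g (rho y) = rho (alpha (- g) y);
  rz_S_isometry : isometry star S;
  rz_S : intertwiner id (rho \o rho) S;
  rz_T_isometry : forall g, isometry star (T g);
  rz_T : forall g, intertwiner (alpha g \o rho) (rho \o rho) (T g);
  rz_sum : S * star S + \sum_(g : G) T g * star (T g) = 1;
  rz_alpha_S : forall h, alpha h S = S;
  rz_alpha_T : forall h g, alpha h (T g) = eps x h g *: T (g + h *+ 2);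
  rz_rho_S :
    rho S = (gh_dim R G)^-1%:C%C *: S +
            (Num.sqrt (gh_dim R G))^-1%:C%C *: \sum_(g : G) T g * T g;
  rz_rho_T : forall g,
    alpha g (rho (T g)) =
      eta x g *: (T g * S * star S) +
      ((eta x g)^* * (Num.sqrt (gh_dim R G))^-1%:C%C) *: (S * star (T g)) +
      \sum_(h : G) \sum_(k : G)
        amp x g h k *: (T (g + h) * T (g + h + k) * star (T (g + k))) }.

(* Objects are unital *-endomorphisms of [M], morphisms are intertwiners, and
   the strict tensor product is composition on objects and
   S (x) T = S sigma(T) on morphisms S in (sigma, sigma'), T in (tau, tau').
   The objects of the category generated by [rho] are obtained from [rho] by
   composition, subobjects and finite direct sums. *)

Inductive generated_object (R : realType) (M : algType R[i]) (star : M -> M) (rho : M -> M)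
    : (M -> M) -> Prop :=
| gen_id : generated_object star rho id
| gen_rho : generated_object star rho rho
| gen_comp sigma tau :
    generated_object star rho sigma -> generated_object star rho tau ->
    generated_object star rho (sigma \o tau)
| gen_sub sigma tau V :
    generated_object star rho sigma -> star_endo star tau ->
    isometry star V -> intertwiner tau sigma V -> generated_object star rho tau
| gen_sum sigma1 sigma2 tau V1 V2 :
    generated_object star rho sigma1 -> generated_object star rho sigma2 -> star_endo star tau ->
    isometry star V1 -> intertwiner sigma1 tau V1 ->
    isometry star V2 -> intertwiner sigma2 tau V2 ->
    V1 * star V1 + V2 * star V2 = 1 -> generated_object star rho tau.

(* A full subcategory of the category of endomorphisms is given by the
   predicate [C] selecting its objects.  Functors are total functions whose
   values matter only on objects of [C] and on intertwiners between them;
   [fhom F sigma tau] is the map on the morphisms from [sigma] to [tau]. *)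

Record functor_data (M : Type) := FunctorData {
  fobj :> (M -> M) -> (M -> M);
  fhom : (M -> M) -> (M -> M) -> M -> M }.

Record is_functor (R : realType) (M : algType R[i]) (C : (M -> M) -> Prop)
    (F : functor_data M) : Prop := {
  fun_obj : forall sigma, C sigma -> C (F sigma);
  fun_hom : forall sigma tau T, C sigma -> C tau -> intertwiner sigma tau T ->
    intertwiner (F sigma) (F tau) (fhom F sigma tau T);
  fun_id : forall sigma, C sigma -> fhom F sigma sigma 1 = 1;
  fun_comp : forall sigma tau kappa S T, C sigma -> C tau -> C kappa ->
    intertwiner tau kappa S -> intertwiner sigma tau T ->
    fhom F sigma kappa (S * T) = fhom F tau kappa S * fhom F sigma tau T }.

Definition id_functor (M : Type) : functor_data M :=
  FunctorData id (fun _ _ => id).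

Definition comp_functor (M : Type) (F F' : functor_data M) : functor_data M :=
  FunctorData (fun sigma => F (F' sigma))
    (fun sigma tau T => fhom F (F' sigma) (F' tau) (fhom F' sigma tau T)).

Record natural_iso (R : realType) (M : algType R[i]) (C : (M -> M) -> Prop)
    (F F' : functor_data M) (u : (M -> M) -> M) : Prop := {
  nat_hom : forall sigma, C sigma -> intertwiner (F sigma) (F' sigma) (u sigma);
  nat_inv : forall sigma, C sigma ->
    exists v, v * u sigma = 1 /\ u sigma * v = 1;
  nat_natural : forall sigma tau T, C sigma -> C tau -> intertwiner sigma tau T ->
    fhom F' sigma tau T * u sigma = u tau * fhom F sigma tau T }.

Definition is_equivalence (R : realType) (M : algType R[i]) (C : (M -> M) -> Prop)
    (F : functor_data M) : Prop :=
  is_functor C F /\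
  exists F' : functor_data M,
    [/\ is_functor C F',
        exists u, natural_iso C (comp_functor F' F) (id_functor M) u &
        exists u, natural_iso C (comp_functor F F') (id_functor M) u].

(* [mten F sigma tau : F sigma F tau -> F (sigma tau)] and [munit F : 1 -> F 1]. *)
Record monoidal_data (M : Type) := MonoidalData {
  mfun :> functor_data M;
  mten : (M -> M) -> (M -> M) -> M;
  munit : M }.

(* As usual for *-preserving monoidal functors between C*-categories, the
   functor is linear and its structure isomorphisms are unitary. *)
Record star_monoidal_functor (R : realType) (M : algType R[i]) (star : M -> M)
    (C : (M -> M) -> Prop) (F : monoidal_data M) : Prop := {
  mon_functor : is_functor C F;
  mon_linear : forall sigma tau a S T, C sigma -> C tau ->
    intertwiner sigma tau S -> intertwiner sigma tau T ->
    fhom F sigma tau (a *: S + T) = a *: fhom F sigma tau S + fhom F sigma tau T;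
  mon_star : forall sigma tau T, C sigma -> C tau -> intertwiner sigma tau T ->
    fhom F tau sigma (star T) = star (fhom F sigma tau T);
  mon_ten_unitary : forall sigma tau, C sigma -> C tau -> unitary star (mten F sigma tau);
  mon_ten_hom : forall sigma tau, C sigma -> C tau ->
    intertwiner (F sigma \o F tau) (F (sigma \o tau)) (mten F sigma tau);
  mon_ten_natural : forall sigma sigma' tau tau' S T,
    C sigma -> C sigma' -> C tau -> C tau' ->
    intertwiner sigma sigma' S -> intertwiner tau tau' T ->
    fhom F (sigma \o tau) (sigma' \o tau') (S * sigma T) * mten F sigma tau =
    mten F sigma' tau' * (fhom F sigma sigma' S * F sigma (fhom F tau tau' T));
  mon_assoc : forall sigma tau kappa, C sigma -> C tau -> C kappa ->
    mten F (sigma \o tau) kappa * mten F sigma tau =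
    mten F sigma (tau \o kappa) * F sigma (mten F tau kappa);
  mon_unit_unitary : unitary star (munit F);
  mon_unit_hom : intertwiner id (F id) (munit F);
  mon_unit_l : forall sigma, C sigma -> mten F id sigma * munit F = 1;
  mon_unit_r : forall sigma, C sigma -> mten F sigma id * F sigma (munit F) = 1 }.

Definition star_monoidal_autoequivalence (R : realType) (M : algType R[i])
    (star : M -> M) (C : (M -> M) -> Prop) (F : monoidal_data M) : Prop :=
  star_monoidal_functor star C F /\ is_equivalence C F.

Definition comp_monoidal (R : realType) (M : algType R[i]) (F F' : monoidal_data M)
    : monoidal_data M :=
  MonoidalData (comp_functor F F')
    (fun sigma tau =>
       fhom F (F' sigma \o F' tau) (F' (sigma \o tau)) (mten F' sigma tau) *
       mten F (F' sigma) (F' tau))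
    (fhom F id (F' id) (munit F') * munit F).

Definition monoidally_isomorphic (R : realType) (M : algType R[i])
    (C : (M -> M) -> Prop) (F F' : monoidal_data M) : Prop :=
  exists u : (M -> M) -> M,
    [/\ natural_iso C F F' u,
        forall sigma tau, C sigma -> C tau ->
          mten F' sigma tau * (u sigma * F sigma (u tau)) =
          u (sigma \o tau) * mten F sigma tau &
        u id * munit F = munit F'].

(* [X] is an invertible object with inverse [Y], evaluation [ev : Y X -> 1] and
   coevaluation [cv : 1 -> X Y] satisfying the zigzag identities. *)
Record invertible_object (R : realType) (M : algType R[i]) (star : M -> M)
    (C : (M -> M) -> Prop) (X Y : M -> M) (ev cv : M) : Prop := {
  iv_obj : C X;
  iv_inv : C Y;
  iv_ev_unitary : unitary star ev;
  iv_ev_hom : intertwiner (Y \o X) id ev;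
  iv_cv_unitary : unitary star cv;
  iv_cv_hom : intertwiner id (X \o Y) cv;
  iv_zigzag_l : X ev * cv = 1;
  iv_zigzag_r : ev * Y cv = 1 }.

(* The functor sigma |-> X sigma Y. *)
Definition conjugation (R : realType) (M : algType R[i]) (X Y : M -> M) (ev cv : M)
    : monoidal_data M :=
  MonoidalData (FunctorData (fun sigma => X \o sigma \o Y) (fun _ _ T => X T))
    (fun sigma _ => X (sigma ev)) cv.

(* Equality of the classes of [F] and [F'] in Out. *)
Definition out_equiv (R : realType) (M : algType R[i]) (star : M -> M)
    (C : (M -> M) -> Prop) (F F' : monoidal_data M) : Prop :=
  exists (X Y : M -> M) (ev cv : M),
    invertible_object star C X Y ev cv /\
    monoidally_isomorphic C (comp_monoidal (conjugation X Y ev cv) F) F'.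

(* An isomorphism of Out(C) onto the group [K]: a map on *-preserving monoidal
   auto-equivalences which induces a bijection from their classes onto [K] and
   turns composition into multiplication. *)
Definition Out_isomorphic_to (R : realType) (M : algType R[i]) (star : M -> M)
    (C : (M -> M) -> Prop) (gT : finGroupType) (K : {group gT}) : Prop :=
  let Aut := star_monoidal_autoequivalence star C in
  exists f : monoidal_data M -> gT,
    [/\ forall F, Aut F -> f F \in K,
        forall F F', Aut F -> Aut F' -> (f F = f F' <-> out_equiv star C F F'),
        forall a, a \in K -> exists2 F, Aut F & f F = a &
        forall F F', Aut F -> Aut F' ->
          f (comp_monoidal F F') = (f F * f F')%g].

(* Main.v *)
From HB Require Import structures.
Require Import Defs.
From Stdlib Require Import BinInt Relation_Operators.
From mathcomp Require Import all_boot all_order all_algebra all_fingroup all_solvable.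
From mathcomp Require Import complex reals.
From mathcomp Require Import ring lra ssrZ.
From mathcomp Require Import boolp classical_sets functions topology normedtype.

Set Implicit Arguments.
Unset Strict Implicit.
Unset Printing Implicit Defensive.

Import Order.TTheory GRing.Theory Num.Theory.
Import numFieldNormedType.Exports.
Local Open Scope ring_scope.

(** * Arithmetic of the Klein four-group and of the dimension *)

(** Solutions. Put p = 2/(d-1), the inverse golden ratio, so that p^2 = 1 - p and d = 3 + 2p. The
    doubled amplitudes of the listed matrices lie in Z[p, z], so (P1)-(P9) for them become finitely
    many integer identities ([check_all]). Conversely, for any solution the numbers A_g(h,0) η_g,
    reindexed by g and g+h, form a real symmetric matrix; (P3), (P4) and (P9) prescribe its row
    sums, its square and a cubic relation, which leaves only δ_{g,h} - p/2 ([sol_M_values]). Then η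
    = 1, no amplitude vanishes, (P5) makes ε a bicharacter, and (P7), (P8) express all amplitudes by
    ε and w = A_0(a,b). Further cases of (P4) force ε_k(k) = -1 for k ≠ 0 and w^2 real
    ([sol_eps_diag], [sol_w_sqr]), which leaves a sign s and four values of z.

    Equivalences. A gauge sign at 0 maps z to -z, the exchange of a and b maps (s, z) to (-s, conj
    z), and the Pauli cocycle maps (s, z) to (-s, iz).

    Outer automorphisms. The category is multiplicity free, so an auto-equivalence is recorded by a
    permutation of the simple objects and scalars c on the fusion channels that intertwine the
    associator ([skeleton_exists], [skeleton_symmetry]). Conversely, such data with |c| = 1 define
    an auto-equivalence ([symmetry_functor_autoequivalence]), and data over the same permutation
    that differ by a coboundary give isomorphic functors ([skeleton_isomorphic]). Compatibility with
    fusion reduces the permutation to one of the four objects α_gρ, that is, to a permutation p of G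
    ([gh_lift_exists]).

    The translations and the rotation a, b, c are realized and generate the even permutations
    ([even_gh_realized]); the transposition of b and c is not realized
    ([transposition_not_symmetric]), hence no odd permutation is. Over p = 1 the scalars are, up to
    coboundary, a character of G on the T channels ([gh_symmetric1]), and conjugation by a suitable
    α_h produces every such character; so p determines the outer class ([induces_out_equiv]). Every
    invertible object is isomorphic to some α_h, conjugation by which fixes all simple objects, so p
    depends only on the outer class ([out_equiv_induces]). *)

Section KleinFour.

Lemma V4_ind (P : V4 -> Prop) : P 0 -> P Va -> P Vb -> P Vc -> forall g, P g.
Proof.
move=> P0 Pa Pb Pc [[[|[|//]] i1] [[|[|//]] i2]].
- by have -> : (Ordinal i1, Ordinal i2) = 0 :> V4 by apply/eqP.
- by have -> : (Ordinal i1, Ordinal i2) = Vb :> V4 by apply/eqP.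
- by have -> : (Ordinal i1, Ordinal i2) = Va :> V4 by apply/eqP.
- by have -> : (Ordinal i1, Ordinal i2) = Vc :> V4 by apply/eqP.
Qed.

Lemma V4_addE : ((((Va + Va)%R = 0) * ((Vb + Vb)%R = 0) * ((Vc + Vc)%R = 0)) *
  (((Va + Vb)%R = Vc) * ((Vb + Va)%R = Vc) * ((Va + Vc)%R = Vb) * ((Vc + Va)%R = Vb) *
   ((Vb + Vc)%R = Va) * ((Vc + Vb)%R = Va)))%type.
Proof. by do !split; apply/eqP. Qed.

Lemma V4_addxx (g : V4) : g + g = 0.
Proof. by elim/V4_ind: g; rewrite ?V4_addE ?addr0. Qed.

Lemma V4_mul2 (g : V4) : g *+ 2 = 0.
Proof. by rewrite mulr2n V4_addxx. Qed.

Lemma V4_opp (g : V4) : - g = g.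
Proof. by apply/eqP; rewrite eq_sym -addr_eq0 V4_addxx. Qed.

Lemma V4_addK (g : V4) : involutive (fun h : V4 => h + g).
Proof. by move=> h; rewrite -addrA V4_addxx addr0. Qed.

Lemma V4_addKr (g : V4) : involutive (fun h : V4 => g + h).
Proof. by move=> h; rewrite addrA V4_addxx add0r. Qed.

Lemma V4_eqE : (((0 == Va :> V4) = false) * ((0 == Vb :> V4) = false) * ((0 == Vc :> V4) = false) *
  (((Va == 0 :> V4) = false) * ((Vb == 0 :> V4) = false) * ((Vc == 0 :> V4) = false)) *
  (((Va == Vb) = false) * ((Va == Vc) = false) * ((Vb == Vc) = false)) *
  (((Vb == Va) = false) * ((Vc == Va) = false) * ((Vc == Vb) = false)))%type.
Proof. by []. Qed.

Lemma V4_sum (Z : nmodType) (F : V4 -> Z) :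
  \sum_g F g = F 0 + F Va + F Vb + F Vc.
Proof.
rewrite (bigD1 0) //= (bigD1 Va) //= (bigD1 Vb) //= (bigD1 Vc) //= big1 ?addr0 ?addrA //.
by elim/V4_ind.
Qed.

Lemma V4_sum2 (Z : nmodType) (F : V4 -> Z) k l : k != 0 -> l != 0 -> k != l ->
  \sum_g F g = F 0 + F k + F l + F (k + l).
Proof.
move=> k0 l0 kl.
have klP : (k + l != 0) && (k + l != k) && (k + l != l).
  by move: k0 l0 kl; elim/V4_ind: k; elim/V4_ind: l.
rewrite (bigD1 0) //= (bigD1 k) //= (bigD1 l) /=; last by rewrite l0 eq_sym kl.
rewrite (bigD1 (k + l)) //= big1 ?addr0 ?addrA // => g.
by move: k0 l0 kl {klP}; elim/V4_ind: k; elim/V4_ind: l; elim/V4_ind: g.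
Qed.

Lemma V4_eq_add (a b : V4) : (a == b) = (a + b == 0).
Proof. by rewrite addr_eq0 V4_opp. Qed.

(** This and [V4_shift2] match the labels on both sides of the associator when all channels are of
    type T. *)
Lemma V4_shift (i j l m q : V4) : (q + j + l == m + i + q) = (m == i + j + l).
Proof.
have e : q + j + l + (m + i + q) = m + (i + j + l).
  rewrite (addrC (q + j + l)) -(addrA q) (addrA (m + i + q)) V4_addK.
  by rewrite !addrA.
by rewrite [LHS]V4_eq_add e -V4_eq_add.
Qed.
Lemma V4_shift2 (k i j q l m : V4) : m + (k + (i + j)) + l = k + (q + j + l) + (m + i + q).
Proof.
rewrite (addrC (k + (q + j + l))) -(addrA q) (addrA k q) (addrC k q) -(addrA q k).
by rewrite (addrA (m + i + q) q) V4_addK !addrA (addrAC m k i).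
Qed.

End KleinFour.

(** * The dimension d and the inverse golden ratio p *)

Section Dimension.
Variable R : realType.

Lemma card_V4 : #|V4| = 4%N.
Proof. by rewrite card_prod !card_ord. Qed.

Lemma gh_dim_V4 : gh_dim R V4 = 2 + Num.sqrt 5.
Proof.
rewrite /gh_dim card_V4.
have -> : (4%:R ^+ 2 + 4 : R) = 2 ^+ 2 * 5 by ring.
rewrite sqrtrM ?sqr_ge0 // sqrtr_sqr ger0_norm ?ler0n //.
by field.
Qed.

Lemma sqr_gh_dim_V4 : gh_dim R V4 ^+ 2 = 1 + 4 * gh_dim R V4.
Proof.
have h5 : Num.sqrt 5 ^+ 2 = 5 :> R by rewrite sqr_sqrtr ?ler0n.
by rewrite gh_dim_V4; ring: h5.
Qed.

Lemma gh_dim_V4_gt4 : 4 < gh_dim R V4.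
Proof.
have : 2 < Num.sqrt 5 :> R.
  by rewrite -[ltLHS]ger0_norm ?ler0n // -sqrtr_sqr ltr_sqrt ?ltr0n //; lra.
by rewrite gh_dim_V4; lra.
Qed.

Definition dimC : R[i] := (gh_dim R V4)%:C%C.

Lemma sqr_dimC : dimC ^+ 2 = 1 + 4 * dimC.
Proof.
by rewrite /dimC -rmorphXn sqr_gh_dim_V4 rmorphD rmorphM rmorph1 rmorph_nat.
Qed.

Lemma realCE (x : R) : (x%:C%C)^* = x%:C%C.
Proof. exact: conjc_real. Qed.

Lemma conj_dimC : dimC^* = dimC.
Proof. exact: realCE. Qed.

Lemma dimC_neq0 : dimC != 0.
Proof.
have := gh_dim_V4_gt4; rewrite /dimC fmorph_eq0; case: eqP => // ->; lra.
Qed.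

Lemma dimC_sub1_neq0 : dimC - 1 != 0.
Proof.
rewrite /dimC -(rmorph1 (real_complex R)) -rmorphB fmorph_eq0.
have := gh_dim_V4_gt4; case: eqP => // h; lra.
Qed.

(* [2 / (d - 1)] is the inverse of the golden ratio. *)
Definition invgold : R[i] := 2 / (dimC - 1).

Lemma invgoldE : invgold = (dimC - 3) / 2.
Proof.
have h := dimC_sub1_neq0; have h2 := sqr_dimC.
apply: (mulIf h); rewrite /invgold divfK //.
by apply: (mulIf (_ : 2 != 0 :> R[i])); [rewrite pnatr_eq0|field: h2].
Qed.

Lemma sqr_invgold : invgold ^+ 2 = 1 - invgold.
Proof. by have h2 := sqr_dimC; rewrite invgoldE; field: h2. Qed.

Lemma dimC_invgold : dimC = 3 + 2 * invgold.
Proof. by rewrite invgoldE; field. Qed.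

Lemma inv_dimC : dimC^-1 = 2 * invgold - 1.
Proof.
have h := sqr_invgold; apply: (mulIf dimC_neq0).
by rewrite mulVf ?dimC_neq0 // [in RHS]dimC_invgold; ring: h.
Qed.

Lemma conj_invgold : invgold^* = invgold.
Proof.
by rewrite invgoldE rmorphM rmorphB fmorphV /= conj_dimC !rmorph_nat.
Qed.

End Dimension.

Arguments dimC {R}.
Arguments invgold {R}.

(** * The listed matrices solve the equations *)

(* [V4] as [bool * bool], and the ring [Z[p, z]] with [p ^ 2 = 1 - p] and
   [z ^ 2 = e (3 + 2 p)], [e = 1 or -1]: the polynomial equations become decidable. *)
Section Codes.

Definition vcode : Type := (bool * bool)%type.
Definition vdec (b : vcode) : V4 :=
  match b with (false, false) => 0 | (true, false) => Va | (false, true) => Vb | _ => Vc end.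
Definition vadd (a b : vcode) : vcode := (a.1 (+) b.1, a.2 (+) b.2).
Definition vcodes : seq vcode := [:: (false, false); (true, false); (false, true); (true, true)].

Lemma vdec_ind (P : V4 -> Prop) : (forall b, P (vdec b)) -> forall g, P g.
Proof.
move=> H; apply: V4_ind;
  [exact: (H (false, false))|exact: (H (true, false))|exact: (H (false, true))|exact: (H (true, true))].
Qed.

Lemma vdecD a b : vdec a + vdec b = vdec (vadd a b).
Proof. by case: a b => [[] []] [[] []]; rewrite /= ?V4_addE ?addr0 ?add0r. Qed.

Lemma vdec_eq0 b : (vdec b == 0) = (b == (false, false)).
Proof. by case: b => [[] []]. Qed.

Lemma vdec_eq a b : (vdec a == vdec b) = (a == b).
Proof. by case: a b => [[] []] [[] []]. Qed.

Lemma all_vcodes (P : vcode -> bool) : all P vcodes -> forall b, P b.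
Proof. by move=> /and5P[p0 p1 p2 p3 _] [[] []]. Qed.

Record code := Code { code0 : Z; code1 : Z; code2 : Z; code3 : Z }.

Definition code_eqb (x y : code) : bool :=
  [&& Z.eqb (code0 x) (code0 y), Z.eqb (code1 x) (code1 y),
      Z.eqb (code2 x) (code2 y) & Z.eqb (code3 x) (code3 y)].

Lemma code_eqbP x y : code_eqb x y -> x = y.
Proof.
case: x y => [a b c d] [a' b' c' d'] /and4P[/= /Z.eqb_spec-> /Z.eqb_spec->].
by move=> /Z.eqb_spec-> /Z.eqb_spec->.
Qed.

Definition code_of (a : Z) := Code a 0 0 0.
Definition code_add (x y : code) := Code (code0 x + code0 y)
  (code1 x + code1 y) (code2 x + code2 y) (code3 x + code3 y).
Definition code_opp (x : code) := Code (- code0 x) (- code1 x) (- code2 x) (- code3 x).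
Definition sgn (e : bool) : Z := if e then (-1) else 1.
Definition code_conj (e : bool) (x : code) :=
  Code (code0 x) (code1 x) (sgn e * code2 x) (sgn e * code3 x).
(** [m] + [n] p is the product of the two coefficients of z, reduced by p^2 = 1 - p. Multiplied by
    z^2 = ±(3 + 2p) it becomes ±((3m + 2n) + (2m + n) p). *)
Definition code_mul (e : bool) (x y : code) :=
  let: Code a b c d := x in let: Code a' b' c' d' := y in
  let m := (c * c' + d * d') in let n := (c * d' + d * c' - d * d') in
  Code (a * a' + b * b' + sgn e * (m + m + m + n + n))
       (a * b' + b * a' - b * b' + sgn e * (m + m + n))
       (a * c' + b * d' + c * a' + d * b')
       (a * d' + b * c' - b * d' + c * b' + d * a' - d * b').

Variables (R : realType) (e : bool) (z : R[i]).
Definition zr (a : Z) : R[i] := (int_of_Z a)%:~R.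
Local Notation p := (@invgold R).

Lemma zrD a b : zr (a + b) = zr a + zr b. Proof. by rewrite /zr !rmorphD. Qed.
Lemma zrM a b : zr (a * b) = zr a * zr b. Proof. by rewrite /zr !rmorphM. Qed.
Lemma zrN a : zr (- a) = - zr a. Proof. by rewrite /zr !rmorphN. Qed.
Lemma zr_nat n : zr (n%:R) = n%:R. Proof. by rewrite /zr !rmorph_nat. Qed.
Lemma zr0 : zr 0 = 0. Proof. by rewrite /zr !rmorph0. Qed.
Lemma zr1 : zr 1 = 1. Proof. by rewrite /zr !rmorph1. Qed.
Local Definition zrE := (zrD, zrM, zrN, zr_nat, zr0, zr1).
Hypothesis z2 : z ^+ 2 = zr (sgn e) * (3 + 2 * p).
Hypothesis zc : z^* = zr (sgn e) * z.

Definition cval (x : code) : R[i] :=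
  zr (code0 x) + zr (code1 x) * p + (zr (code2 x) + zr (code3 x) * p) * z.

Lemma cval_of a : cval (code_of a) = zr a.
Proof.
by transitivity (zr a + zr 0 * p + (zr 0 + zr 0 * p) * z); rewrite // zr0 !mul0r !addr0 mul0r addr0.
Qed.

Lemma cvalD x y : cval (code_add x y) = cval x + cval y.
Proof. by rewrite /cval /= !zrE; ring. Qed.

Lemma cvalN x : cval (code_opp x) = - cval x.
Proof. by rewrite /cval /= !zrE; ring. Qed.

Lemma cvalM x y : cval (code_mul e x y) = cval x * cval y.
Proof.
have p2 := @sqr_invgold R; case: x y => [a b c d] [a' b' c' d'].
rewrite /cval /code_mul /= !zrE.
have z2p : z ^+2 * p = zr (sgn e) * (2+p) by rewrite z2; ring: p2.
have z2pp : z ^+2 * p^+2 = zr (sgn e) * (1+p) by rewrite z2; ring: p2.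
ring: p2 z2 z2p z2pp.
Qed.

Lemma cvalJ x : cval (code_conj e x) = (cval x)^*.
Proof.
have zJ a : (zr a)^* = zr a by rewrite /zr rmorph_int.
rewrite /cval; move: (@conj_invgold R); generalize p => q qJ.
rewrite !(rmorphD, rmorphM) /= zc !zJ qJ !zrE.
by ring.
Qed.

End Codes.

Section Existence.

Definition chi_code (s : bool) (h g : vcode) : Z :=
  match h, g with
  | (false, false), _ | _, (false, false) => 1
  | (true, false), (false, true) | (false, true), (true, true) | (true, true), (true, false) => sgn s
  | (false, true), (true, false) | (true, true), (false, true) | (true, false), (true, true) => - sgn s
  | _, _ => -1
  end.

(* [2 A_g(h, k)]: [2 (d - 2) / (d - 1) = 2 - p], [-2 / (d - 1) = - p], [2 z / (d - 1) = p z];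
   off the diagonal [A_g] is obtained from [A_0] by P7 and P8. *)
Definition amp_code (s e : bool) (g h k : vcode) : code :=
  let zero := (false, false) in
  (* For s = 1 and distinct nonzero arguments, the value 1 of χ singles out the cyclic order a, b,
     c; there A_0 has z, and conj z in the opposite order. *)
  let cyc x y := chi_code false x y == 1 in
  if (h == zero) && (k == zero) then Code 2 (-1) 0 0
  else if (h == zero) || (k == zero) then Code 0 (-1) 0 0
  else if h == k then Code 0 (- chi_code s h g) 0 0
  else
    let sg := if g == zero then 1 else if g == h then chi_code s g k
              else if g == k then chi_code s g h else -1 in
    if cyc h k then Code 0 0 0 sg else Code 0 0 0 (sg * sgn e).

Variables (R : realType) (s e : bool) (z : R[i]).
Local Notation zr := (@zr R).
Local Notation p := (@invgold R).
Local Notation cval := (@cval R z).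
Hypothesis z2 : z ^+ 2 = zr (sgn e) * (3 + 2 * p).
Hypothesis zc : z^* = zr (sgn e) * z.

Let x : gh_data R V4 := V4_data (zr (sgn s)) z.

Lemma zr_sgn b : zr (sgn b) = (-1) ^+ b.
Proof. by case: b; rewrite /zr. Qed.

Lemma eps_code h g : eps x (vdec h) (vdec g) = zr (chi_code s h g).
Proof.
have zp : zr (BinNums.Zpos 1%AC) = 1 by exact: zr1.
have zm : zr (BinNums.Zneg 1%AC) = -1 by rewrite -zp -zrN.
case: h g => [[] []] [[] []]; rewrite /x /= /chi /table /= ?zp ?zm //; case: s => /=; rewrite ?zp ?zm ?opprK //.
Qed.

Lemma amp_codeE g h k : amp x (vdec g) (vdec h) (vdec k) = cval (amp_code s e g h k) / 2.
Proof.
have h1 : (dimC - 1)^-1 = p / 2 :> R[i] by rewrite /invgold mulrAC divff ?mul1r ?pnatr_eq0.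
have h2 : (dimC - 2) = 1 + 2 * p :> R[i] by rewrite dimC_invgold; ring.
have h3 : p * (1 + 2 * p) = 2 - p by have h4 := @sqr_invgold R; ring: h4.
have zp : zr (BinNums.Zpos 1%AC) = 1 by exact: zr1.
have zm : zr (BinNums.Zneg 1%AC) = -1 by rewrite -zp -zrN.
have zq : zr (BinNums.Zpos 2%AC) = 2 by exact: (@zr_nat R 2).
have z0 : zr BinNums.Z0 = 0 by exact: (@zr0 R).
rewrite /x /= /V4_amp -/(@dimC R) h1 h2 zc zr_sgn /chi /cval.
case: s; case: e; case: g h k => [[] []] [[] []] [[] []].
all: rewrite /table /= ?zp ?zm ?zq ?z0.
all: try ring.
all: by rewrite mulrAC h3; ring.
Qed.

End Existence.

(** * The polynomial equations as integer identities *)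

Section CodeIdentities.
Variables (s e : bool).
Let a := amp_code s e.
Local Notation "x ** y" := (code_mul e x y) (at level 40, left associativity).
Local Notation "x ++ y" := (code_add x y).
Definition eps_cd (h g : vcode) := code_of (chi_code s h g).
Local Notation c := eps_cd.
Definition kron_cd (b : vcode) := code_of (if b == (false, false) then 1 else 0).
Local Notation delta := kron_cd.
Definition sum_cd (F : vcode -> code) :=
  F (false, false) ++ F (true, false) ++ F (false, true) ++ F (true, true).
Local Notation sum := sum_cd.
Definition inv_d_cd := Code (-1) 2 0 0.
Definition two_cd := code_of 2.
Local Notation "x '+v' y" := (vadd x y) (at level 30).

Definition all1 (P : vcode -> bool) := all P vcodes.
Lemma all1P P : all1 P -> forall b, P b. Proof. exact: all_vcodes. Qed.

(** In these checks -g = g, 2h = 0 and η = 1 are already used. Amplitudes are stored doubled, so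
    each equation is multiplied by 2 to the degree of its left side in A: by 2 in (P3), 4 in (P4), 8
    in (P9). *)
Definition check_sign := all1 (fun h => all1 (fun g =>
  (chi_code s h g == 1) || (chi_code s h g == -1))).
Definition check_P1 := all1 (fun h => all1 (fun k => all1 (fun g =>
  code_eqb (c (h +v k) g) (c h g ** c k g)))).
Definition check_P3 := all1 (fun g => code_eqb (sum (fun h => a g h (false, false)))
   (two_cd ** code_opp inv_d_cd)).
Definition check_P4 := all1 (fun g => all1 (fun g' => all1 (fun k =>
  code_eqb (sum (fun h => a g (h +v g) k ** code_conj e (a g' (h +v g') k)))
    (two_cd ** two_cd ** (delta (g +v g') ++ code_opp (inv_d_cd ** delta k)))))).
Definition check_P5 := all1 (fun h => all1 (fun g => all1 (fun p => all1 (fun q =>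
  code_eqb (c h g ** c h (g +v p) ** c h (g +v q) ** c h (g +v p +v q)) (code_of 1))))).
Definition check_P6 := all1 (fun g => all1 (fun h => all1 (fun k =>
  code_eqb (a g k h) (code_conj e (a g h k))))).
Definition check_P7l := all1 (fun g => all1 (fun h => all1 (fun k =>
  code_eqb (a g h k)
   (a g k (h +v k) ** c k (g +v h) ** c k (g +v k) ** c k (g +v h +v k))))).
Definition check_P7r := all1 (fun g => all1 (fun h => all1 (fun k =>
  code_eqb (a g h k)
   (a g (k +v h) h ** c h (g +v h) ** c h (g +v k) ** c h (g +v h +v k))))).
Definition check_P8l := all1 (fun g => all1 (fun h => all1 (fun k =>
  code_eqb (a g h k) (a (g +v h) h k ** c h g ** c h (g +v k))))).
Definition check_P8r := all1 (fun g => all1 (fun h => all1 (fun k =>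
  code_eqb (a g h k) (a (g +v k) h k ** c k g ** c k (g +v h))))).
Definition check_P9 := all1 (fun g => all1 (fun p => all1 (fun q => all1 (fun s => all1 (fun t =>
  code_eqb
    (sum (fun l => a g (s +v t) l ** a (g +v p +v s) s (l +v p) **
                   a (g +v q +v s +v t) t (l +v q)))
    (two_cd ** (a g (p +v s) (q +v s +v t) ** a (g +v p) (q +v t) (p +v s +v t) **
      c p (g +v p +v s) ** c (p +v s) (g +v p +v q +v t) **
      c q (g +v q +v s +v t) ** c (q +v t) (g +v q +v s)) ++
     two_cd ** two_cd ** two_cd ** code_opp (delta s ** delta t ** inv_d_cd))))))).
End CodeIdentities.

(** Only the two signs are left as parameters, so every equation is a finite list of identities in
    Z^4, settled by evaluation. *)
Lemma check_all s e : [&& check_sign s, check_P1 s e, check_P3 s e, check_P4 s e, check_P5 s e,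
  check_P6 s e, check_P7l s e, check_P7r s e, check_P8l s e, check_P8r s e & check_P9 s e].
Proof. by case: s; case: e; vm_compute. Qed.

(** * From integer identities back to the equations *)

Section Existence.
Variables (R : realType) (s e : bool) (z : R[i]).
Local Notation zr := (@zr R).
Local Notation p := (@invgold R).
Local Notation cval := (@cval R z).
Hypothesis z2 : z ^+ 2 = zr (sgn e) * (3 + 2 * p).
Hypothesis zc : z^* = zr (sgn e) * z.

Let x : gh_data R V4 := V4_data (zr (sgn s)) z.
Lemma cval_sum F : cval (sum_cd F) = \sum_(l <- vcodes) cval (F l).
Proof. by rewrite /sum_cd !(cvalD z) !big_cons big_nil addr0 !addrA. Qed.

Lemma vdec_sum (F : V4 -> R[i]) : \sum_g F g = \sum_(l <- vcodes) F (vdec l).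
Proof. by rewrite V4_sum !big_cons big_nil /= addr0 !addrA. Qed.

Lemma eps_val h g : eps x (vdec h) (vdec g) = cval (eps_cd s h g).
Proof. by rewrite eps_code cval_of. Qed.

Lemma amp_val g h k : amp x (vdec g) (vdec h) (vdec k) = cval (amp_code s e g h k) / 2.
Proof. exact: amp_codeE. Qed.

Lemma kron_val g h : kron R (vdec g) (vdec h) = cval (kron_cd (vadd g h)).
Proof.
rewrite cval_of /kron vdec_eq; case: g h => [[] []] [[] []] /=;
  by rewrite ?(@zr1 R) ?(@zr0 R).
Qed.

Lemma inv_d_val : (dimC : R[i])^-1 = cval inv_d_cd.
Proof.
have zm : zr (BinNums.Zneg 1%AC) = -1 by rewrite -[X in -X](@zr1 R) -zrN.
have zq : zr (BinNums.Zpos 2%AC) = 2 by exact: (@zr_nat R 2).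
have z0 : zr BinNums.Z0 = 0 by exact: (@zr0 R).
by rewrite inv_dimC /cval /= zm zq z0; ring.
Qed.

Lemma two_val : cval two_cd = 2.
Proof. by rewrite cval_of (@zr_nat R 2). Qed.

Lemma V4_data_solution : gh_solution x.
Proof.
have cM := cvalM z2; have cJ := cvalJ zc; have cD := cvalD z; have cN := cvalN z.
have halfJ y : (cval y / 2)^* = cval (code_conj e y) / 2.
  by rewrite rmorphM fmorphV rmorph_nat cJ.
have eta1 g : eta x g = 1 by [].
have v0 : (0 : V4) = vdec (false, false) by [].
have /and5P[k1 k2 k3 k4 /and5P[k5 k6 k7 k8 /and3P[k9 k10 k11]]] := check_all s e.
split.
- elim/vdec_ind=> h; elim/vdec_ind=> g; rewrite eps_code.
  case/orP: (all1P (all1P k1 h) g) => /eqP->; [left|right].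
    exact: zr1.
  by rewrite zrN zr1.
- by move=> g; rewrite eta1 normr1.
- elim/vdec_ind=> h; elim/vdec_ind=> k; elim/vdec_ind=> g.
  rewrite V4_mul2 addr0 vdecD !eps_val -cM; congr cval; apply: code_eqbP.
  exact: all1P (all1P (all1P k2 h) k) g.
- elim/vdec_ind=> h; rewrite v0 eps_val cval_of.
  by case: h => [[] []]; exact: zr1.
- by [].
- by move=> g; rewrite eta1 expr1n.
- elim/vdec_ind=> g; rewrite eta1 vdec_sum rmorph1 mul1r -/(@dimC R) inv_d_val.
  rewrite (eq_bigr _ (fun h _ => amp_val g h (false, false))) -mulr_suml -cval_sum.
  by rewrite (code_eqbP (all1P k3 g)) cM two_val cN mulrAC divff ?mul1r ?pnatr_eq0.
- elim/vdec_ind=> g; elim/vdec_ind=> g'; elim/vdec_ind=> k.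
  rewrite vdec_sum !eta1 rmorph1 !mul1r -/(@dimC R) inv_d_val v0 !kron_val.
  under eq_bigr => h _.
    rewrite !V4_opp !vdecD !amp_val halfJ mulrACA -cM; over.
  rewrite -mulr_suml -cval_sum.
  rewrite (code_eqbP (all1P (all1P (all1P k4 g) g') k)) !cM cD cN !two_val cM.
  have -> : vadd k (false, false) = k by case: (k) => [[] []].
  by field.
- elim/vdec_ind=> g; elim/vdec_ind=> h; elim/vdec_ind=> p; elim/vdec_ind=> q.
  rewrite V4_mul2 addr0 !vdecD !eps_val -!cM.
  rewrite (code_eqbP (all1P (all1P (all1P (all1P k5 h) g) p) q)).
  by rewrite cval_of zr1 mul1r.
- elim/vdec_ind=> g; elim/vdec_ind=> h; elim/vdec_ind=> k.
  rewrite !amp_val (code_eqbP (all1P (all1P (all1P k6 g) h) k)).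
  by rewrite halfJ.
- elim/vdec_ind=> g; elim/vdec_ind=> h; elim/vdec_ind=> k.
  rewrite !V4_opp !vdecD !eps_val !amp_val (code_eqbP (all1P (all1P (all1P k7 g) h) k)) !cM eta1.
  by ring.
- elim/vdec_ind=> g; elim/vdec_ind=> h; elim/vdec_ind=> k.
  rewrite !V4_opp !vdecD !eps_val !amp_val (code_eqbP (all1P (all1P (all1P k8 g) h) k)) !cM eta1.
  by rewrite rmorph1; ring.
- elim/vdec_ind=> g; elim/vdec_ind=> h; elim/vdec_ind=> k.
  rewrite !vdecD !eps_val !amp_val (code_eqbP (all1P (all1P (all1P k9 g) h) k)) !cM !eta1.
  by rewrite !mul1r rmorph1; ring.
- elim/vdec_ind=> g; elim/vdec_ind=> h; elim/vdec_ind=> k.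
  rewrite !vdecD !eps_val !amp_val (code_eqbP (all1P (all1P (all1P k10 g) h) k)) !cM !eta1.
  by rewrite !mul1r rmorph1; ring.
- elim/vdec_ind=> g; elim/vdec_ind=> p; elim/vdec_ind=> q; elim/vdec_ind=> u; elim/vdec_ind=> t.
  have e3 (a1 a2 a3 : R[i]) : a1 / 2 * (a2 / 2) * (a3 / 2) = a1 * a2 * a3 / (2 * 2 * 2) by field.
  rewrite vdec_sum !eta1 !mul1r rmorph1 !mulr1 -/(@dimC R) inv_d_val v0 !V4_opp !vdecD !kron_val !eps_val.
  under eq_bigr => l _.
    rewrite !vdecD !amp_val e3 -!cM; over.
  rewrite -mulr_suml -cval_sum.
  rewrite (code_eqbP (all1P (all1P (all1P (all1P (all1P k11 g) p) q) u) t)).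
  rewrite !amp_val !(cM, cN, cD, two_val).
  have vz k : vadd k (false, false) = k by case: (k) => [[] []].
  by rewrite !vz; field.
Qed.

End Existence.

(** * Uniqueness of the solutions *)

Section Uniqueness.
Variables (R : realType) (x : gh_data R V4).
Hypothesis Hx : gh_solution x.
Local Notation C := R[i].
Local Notation p := (@invgold R).
Local Notation A := (amp x).

Lemma sign_cases (c : C) : is_sign c -> (c == 1) || (c == -1).
Proof. by case=> ->; rewrite eqxx ?orbT. Qed.

Lemma sign_sqr (c : C) : is_sign c -> c * c = 1.
Proof. by case=> ->; rewrite ?mulr1 ?mulrNN ?mulr1. Qed.

Lemma sign_conj (c : C) : is_sign c -> c^* = c.
Proof. by case=> ->; rewrite ?rmorphN ?rmorph1. Qed.

Lemma sol_eps2 h g : eps x h g * eps x h g = 1.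
Proof. exact: sign_sqr (gh_eps_sign Hx h g). Qed.

Lemma sol_epsJ h g : (eps x h g)^* = eps x h g.
Proof. exact: sign_conj (gh_eps_sign Hx h g). Qed.

Lemma sol_eps0 g : eps x 0 g = 1.
Proof.
have := gh_P1 Hx 0 0 g; rewrite mul0rn !addr0 => h.
by rewrite h sol_eps2.
Qed.

Lemma sol_etaV g : eta x g * (eta x g)^* = 1.
Proof. by rewrite -normCK (gh_eta_circle Hx) expr1n. Qed.

Lemma sol_eta2 g : (eta x g)^* = eta x g ^+ 2.
Proof.
have h3 := gh_P2_3 Hx g; have h := sol_etaV g.
by rewrite -[LHS]mul1r -h3; ring: h.
Qed.

(** The phase makes this column real: at k = 0, (P7) and (P6) give A_g(h,0) = η_g conj A_g(h,0), and
    η_g^3 = 1. *)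
Let r g h := A g h 0 * eta x g.

Lemma sol_A0r g h : A g h 0 = r g h * (eta x g)^*.
Proof. by rewrite /r -mulrA sol_etaV mulr1. Qed.

Lemma sol_rJ g h : (r g h)^* = r g h.
Proof.
have := gh_P7l Hx g h 0; rewrite oppr0 !addr0 !sol_eps0 !mulr1 [A g 0 h](gh_P6 Hx) => e.
have h3 := gh_P2_3 Hx g.
rewrite /r rmorphM /= [in RHS]e [(eta x g)^*]sol_eta2.
by rewrite -mulrA expr2.
Qed.

Lemma sol_A0l g h : A g 0 h = r g h * eta x g.
Proof. by rewrite [LHS](gh_P6 Hx) sol_A0r rmorphM /= sol_rJ conjCK. Qed.

Lemma sol_r_sym g h : r g h = r (g + h) h.
Proof.
have e := gh_P8l Hx g h 0; rewrite !addr0 in e.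
rewrite /r {}e rmorphM /= sol_eta2; have h2 := sol_eps2 h g.
have h3 := gh_P2_3 Hx g; have h4 := gh_P2_3 Hx (g + h).
set t := A _ _ _; set u := eta x g; set v := eta x (g + h); set q := eps _ _ _.
transitivity (t * (u ^+ 3) * (v ^+ 3) * v * (q * q)); first by ring.
by rewrite h2 h3 h4 !mulr1.
Qed.

(** With this indexing (P8) at k = 0 is the symmetry of [M], and (P3), (P4), (P9) become statements
    about one real symmetric matrix of size four. *)
Let M g h := r g (g + h).

Lemma sol_MC g h : M g h = M h g.
Proof. by rewrite /M sol_r_sym addrA V4_addxx add0r addrC. Qed.

Lemma sol_rM g h : r g h = M g (g + h).
Proof. by rewrite /M addrA V4_addxx add0r. Qed.

Lemma sol_M_sum g : \sum_h M g h = - (dimC^-1).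
Proof.
have e := gh_P3 Hx g.
rewrite -[LHS]mul1r -(sol_etaV g) -mulrA [(_)^* * _]mulr_sumr.
have -> : \sum_i (eta x g)^* * M g i = \sum_h A g h 0.
  rewrite [RHS](reindex_inj (addrI g)) /=.
  by apply: eq_bigr => h _; rewrite mulrC -sol_A0r.
by rewrite e mulrN mulrA sol_etaV mul1r.
Qed.

Lemma sol_M_orth g h : \sum_m M g m * M h m = (g == h)%:R - dimC^-1.
Proof.
have e := gh_P4 Hx g h 0; rewrite /kron eqxx mulr1 -/(@dimC R) in e.
have -> : \sum_m M g m * M h m = eta x g * (eta x h)^* * (\sum_m A g (m - g) 0 * (A h (m - h) 0)^*).
  rewrite mulr_sumr; apply: eq_bigr => m _.
  rewrite !V4_opp ![m + _]addrC !sol_A0r rmorphM /= sol_rJ conjCK.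
  transitivity ((eta x g * (eta x g)^*) * (eta x h * (eta x h)^*) * (M g m * M h m)).
    by rewrite !sol_etaV !mul1r.
  by rewrite /M; ring.
rewrite e mulrBr; congr (_ - _); last first.
  transitivity ((eta x g * (eta x g)^*) * (eta x h * (eta x h)^*) / dimC); first by ring.
  by rewrite !sol_etaV !mul1r.
by case: (eqVneq g h) => [->|_]; rewrite ?sol_etaV ?mulr1 ?mulr0.
Qed.

(** This is (P9) with both differences and q equal to 0 and p = g + h. All phases cancel because η^3
    = 1. *)
Lemma sol_M_cubic g h : \sum_m M g m ^+ 2 * M h m = M g h ^+ 2 - dimC^-1.
Proof.
have e := gh_P9 Hx g (g + h) 0 0 0.
rewrite /kron !eqxx !V4_opp !(addr0, add0r) addrA V4_addxx add0r !sol_eps0 !mulr1 in e.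
rewrite [A h 0 (g + h)]sol_A0l [A g (g + h) 0]sol_A0r !sol_rM in e.
rewrite [h + _]addrC !addrA V4_addxx add0r -addrA V4_addxx addr0 [M h g]sol_MC -/(@dimC R) in e.
have -> : \sum_m M g m ^+ 2 * M h m =
    (eta x g * eta x g * eta x h)^* * (\sum_l A g 0 l * A h 0 (l + (g + h)) * A g 0 (l + 0)).
  rewrite mulr_sumr [LHS](reindex_inj (addrI g)) /=; apply: eq_bigr => l _.
  rewrite addr0 !sol_A0l !sol_rM !rmorphM /=.
  have -> : h + (l + (g + h)) = g + l.
    by rewrite addrC -!addrA V4_addxx addr0 addrC.
  transitivity ((eta x g * (eta x g)^*) * (eta x g * (eta x g)^*) * (eta x h * (eta x h)^*) * (M g (g + l) ^+ 2 * M h (g + l))).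
    by rewrite !sol_etaV !mul1r.
  by ring.
rewrite {}e !rmorphM /=.
have e2 := sol_eps2 (g + h) h.
set u := eta x g; set v := eta x h; set q := eps _ _ _.
have hu : u * u^* = 1 by exact: sol_etaV.
have hv : v * v^* = 1 by exact: sol_etaV.
transitivity ((u * u^*) ^+ 2 * (v * v^*) ^+ 2 * (q * q) * M g h ^+ 2 - (u * u^*) ^+ 2 * (v * v^*) / dimC).
  have h3 : (u ^*) ^+ 3 = 1 by rewrite -rmorphXn /= [u ^+ 3](gh_P2_3 Hx g) rmorph1.
  transitivity (u ^* ^+ 3 * ((u * u^*) ^+ 2 * (v * v^*) ^+ 2 * (q * q) * M g h ^+ 2) - (u * u^*) ^+ 2 * (v * v^*) / dimC).
    by rewrite mulr1n; ring.
  by rewrite h3 mul1r.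
by rewrite hu hv e2 !expr1n !mul1r.
Qed.

Let n g h k := A g h k * (A g h k)^*.

Lemma sol_nC g h k : n g h k = n g k h.
Proof. by rewrite /n [A g k h](gh_P6 Hx) conjCK mulrC. Qed.

(** (P7) up to phases. The move (h,k) to (k,h+k) has order three and, with the symmetry of [n],
    makes the moduli at distinct nonzero arguments agree. *)
Lemma sol_n7 g h k : n g h k = n g k (h + k).
Proof.
rewrite /n [in LHS](gh_P7l Hx g h k) !V4_opp !rmorphM /= !sol_epsJ.
set e1 := eps _ _ _; set e2 := eps _ _ _; set e3 := eps _ _ _.
set u := eta x g; set a := A g k (h + k).
transitivity ((u * u^*) * (e1 * e1) * (e2 * e2) * (e3 * e3) * (a * a^*)); first by ring.
by rewrite sol_etaV !sol_eps2 !mul1r.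
Qed.

Lemma sol_n0 g k : n g 0 k = M g (g + k) ^+ 2.
Proof.
rewrite /n sol_A0l rmorphM /= sol_rJ sol_rM.
transitivity ((eta x g * (eta x g)^*) * M g (g + k) ^+ 2); first by ring.
by rewrite sol_etaV mul1r.
Qed.

(** (P4) with g = g' and k nonzero says that the squared moduli in column k sum to 1; the symmetries
    of [n] group the four terms into two equal pairs. *)
Lemma sol_M_sqr g k l : k != 0 -> l != 0 -> k != l ->
  M g (g + k) ^+ 2 * 2 + n g k l * 2 = 1.
Proof.
move=> k0 l0 kl.
have e := gh_P4 Hx g g k; rewrite /kron eqxx (negPf k0) mulr0 subr0 in e.
have e' : \sum_h n g h k = 1.
  rewrite -[RHS]e [RHS](reindex_inj (addrI g)) /=; apply: eq_bigr => h _.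
  by rewrite addrAC subrr add0r.
rewrite (V4_sum2 _ k0 l0 kl) in e'.
have n1 : n g k k = n g 0 k by rewrite [RHS]sol_n7 add0r.
have n2 : n g (k + l) k = n g k l by rewrite sol_nC [k + l]addrC -sol_n7 sol_nC.
rewrite n1 n2 [n g l k]sol_nC sol_n0 in e'.
by rewrite -[RHS]e'; ring.
Qed.

Lemma sol_M_offdiag g h k : g != h -> g != k -> M g h ^+ 2 = M g k ^+ 2.
Proof.
move=> gh gk; case: (eqVneq h k) => [->//|hk].
have n0 u v : u != v :> V4 -> u + v != 0.
  by apply: contraNneq => /eqP; rewrite addr_eq0 V4_opp.
have e1 := sol_M_sqr g (n0 _ _ gh) (n0 _ _ gk).
have e2 := sol_M_sqr g (n0 _ _ gk) (n0 _ _ gh).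
have hk' : g + h != g + k by rewrite (inj_eq (addrI g)).
have H := etrans (e1 hk') (esym (e2 _)); rewrite eq_sym hk' in H; have {}H := H isT.
rewrite [n g (g + k) _]sol_nC !addrA !V4_addxx !add0r in H.
by apply: (mulIf (_ : 2 != 0 :> C)); [rewrite pnatr_eq0|exact: (addIr _ H)].
Qed.

(** All off-diagonal squares equal one number [rho], so the cubic relation is linear in the entry
    M(u,v). If its coefficient 1 - 1/d - 4 rho vanishes, all entries have the same square, which
    contradicts the row sum. Otherwise all off-diagonal entries equal one number [t]; the diagonal
    gives a quadratic equation for [t], and its only common root with the cubic relation is -p/2. *)
Lemma sol_M_values g h : M g h = (g == h)%:R - p / 2.
Proof.
have dE := @inv_dimC R; have p2 := @sqr_invgold R.
have two0 : 2 != 0 :> C by rewrite pnatr_eq0.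
have sum_off u c : \sum_(m : V4 | m != u) c = 3 * c :> C.
  have := V4_sum (fun=> c); rewrite (bigD1 u) //= => e.
  by apply: (addrI c); rewrite e; ring.
pose rho := M 0 Va ^+ 2.
have off u v : u != v -> M u v ^+ 2 = rho.
  move=> uv; case: (eqVneq u 0) => [u0|u0].
    by rewrite u0 (sol_M_offdiag (k := Va)) // -u0.
  by rewrite (sol_M_offdiag (k := 0)) // sol_MC (sol_M_offdiag (k := Va)) // eq_sym.
have diag u : M u u ^+ 2 = 1 - dimC^-1 - 3 * rho.
  have e := sol_M_orth u u; rewrite eqxx (bigD1 u) //= in e.
  rewrite -[1 - _]e (eq_bigr (fun=> rho)) => [|m mu]; last by rewrite -expr2 off // eq_sym.
  by rewrite sum_off; ring.
have cubic u v : u != v -> (1 - dimC^-1 - 4 * rho) * M u v = rho * (1 + dimC^-1) - dimC^-1.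
  move=> uv; have e := sol_M_cubic u v; have e2 := sol_M_sum v.
  rewrite (bigD1 u) //= (eq_bigr (fun m => rho * M v m)) -?mulr_sumr in e; last first.
    by move=> m mu; rewrite off // eq_sym.
  rewrite (bigD1 u) //= in e2.
  move: e e2; rewrite diag (off _ _ uv) [M v u]sol_MC.
  move: (\sum_(i | _) _) => X e /(canRL (addKr _)) XE.
  rewrite XE in e.
  transitivity ((1 - dimC^-1 - 3 * rho) * M u v + rho * (- M u v + - dimC^-1) + rho * dimC^-1).
    by ring.
  by rewrite e; ring.
case: (eqVneq (1 - dimC^-1 - 4 * rho) 0) => [rho0|rho1].
  exfalso.
  have rhoE : 4 * rho = 2 - 2 * p by rewrite -[LHS]addr0 -rho0 dE; ring.
  have all_sq u v : M u v ^+ 2 = rho.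
    case: (eqVneq u v) => [->|/off //]; rewrite diag.
    by rewrite -[RHS]addr0 -rho0; ring.
  have sum0 : M 0 0 + M 0 Va + M 0 Vb + M 0 Vc = 1 - 2 * p.
    by rewrite -V4_sum sol_M_sum dE; ring.
  have pm v : M 0 v = M 0 0 \/ M 0 v = - M 0 0.
    by have /eqP := all_sq 0 v; rewrite -(all_sq 0 0) eqf_sqr => /orP[]/eqP; [left|right].
  have D2 := all_sq 0 0; move: sum0 D2 rhoE p2; move: (M 0 0) (pm Va) (pm Vb) (pm Vc) => D.
  move=> pa pb pc sum0 D2 rhoE p2.
  (* A row sum is M(0,0) times a sum of four signs, whose square is 0, 4 or 16; so the square of the
     row sum is k (4 rho) with k = 0, 1 or 4. *)
  have sum2 : exists2 k : nat, k \in [:: 0; 1; 4]%N & k%:R * (4 * rho) = (1 - 2 * p) ^+ 2.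
    rewrite -sum0 -D2; case: pa => ->; case: pb => ->; case: pc => ->;
    [exists 4%N|exists 1%N|exists 1%N|exists 0%N|exists 1%N|exists 0%N|exists 0%N|exists 1%N] => //; ring.
  case: sum2 => k kin; rewrite rhoE => kE.
  have pE : (1 - 2 * p) ^+ 2 = 5 - 8 * p by ring: p2.
  rewrite pE in kE; move: kin kE; rewrite !inE => /or3P[] /eqP-> kE.
  - have e8 : 8 * p = 5 by apply/eqP; rewrite -subr_eq0 -oppr_eq0 opprB -kE mul0r.
    have : 1 = 0 :> C.
      transitivity ((8 * p) ^+ 2 + 8 * (8 * p) - 64); first by rewrite e8; ring.
      by ring: p2.
    by move/eqP; rewrite oner_eq0.
  - have e2 : 2 * p = 1.
      apply: (mulfI (_ : 3 != 0 :> C)); first by rewrite pnatr_eq0.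
      transitivity (8 * p - 2 + (1 * (2 - 2 * p))); first by ring.
      by rewrite kE; ring.
    have : 1 = 0 :> C.
      transitivity (4 - (2 * p) ^+ 2 - 2 * (2 * p)); first by rewrite e2; ring.
      by ring: p2.
    by move/eqP; rewrite oner_eq0.
  - have : 3 = 0 :> C.
      transitivity (4 * (2 - 2 * p) - (5 - 8 * p)); first by ring.
      by rewrite kE subrr.
    by move/eqP; rewrite pnatr_eq0.
pose t := M 0 Va.
have offE u v : u != v -> M u v = t.
  move=> uv; apply: (mulfI rho1).
  by rewrite !cubic.
have diagE u : M u u = 1 - 2 * p - 3 * t.
  have := sol_M_sum u; rewrite (bigD1 u) //= (eq_bigr (fun=> t)) => [|m mu]; last first.
    by rewrite offE // eq_sym.
  by rewrite sum_off dE => /(canRL (addrK _)) ->; ring.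
have t2 : 12 * t ^+ 2 = (3 - 6 * t) * (2 * p - 1).
  have := diag 0; rewrite diagE /rho -/t dE => e.
  transitivity (12 * t ^+ 2 + (1 - (2 * p - 1) - 3 * t ^+ 2) - (1 - 2 * p - 3 * t) ^+ 2).
    by rewrite e; ring.
  by ring: p2.
have tE : t = - p / 2.
  have := cubic 0 Va isT; rewrite -/t /rho -/t dE => e3.
  have p0 : p != 0.
    by apply: contra_eq_neq p2 => ->; rewrite expr0n subr0 eq_sym oner_eq0.
  apply: (mulfI p0); apply: (mulfI (_ : 6 != 0 :> C)); first by rewrite pnatr_eq0.
  apply/eqP; rewrite -subr_eq0; apply/eqP.
  set L := (X in X = _) in e3; set S := (X in _ = X) in e3.
  (* Reducing the cubic relation twice modulo the quadratic [t2] leaves a linear equation, 6 p (t +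
     p/2) = 0. *)
  transitivity (6 * (L - S)); last by rewrite e3 subrr mulr0.
  have -> : 6 * (L - S) = 12 * (1 - p) * t - 2 * (12 * t ^+ 2) * t - p * (12 * t ^+ 2) + 12 * p - 6.
    by rewrite /L /S; ring.
  rewrite t2.
  have -> : 2 * ((3 - 6 * t) * (2 * p - 1)) * t = (2 * p - 1) * (6 * t - (12 * t ^+ 2)) by ring.
  by rewrite t2; field: p2.
case: (eqVneq g h) => [->|gh]; last by rewrite offE // tE mulNr sub0r.
by rewrite diagE tE mulr1n; field.
Qed.

(** At h = k = 0, (P7) reads A_g(0,0) = A_g(0,0) η_g, and A_g(0,0) has modulus 1 - p/2, which is not
    zero. *)
Lemma sol_eta g : eta x g = 1.
Proof.
have := gh_P7l Hx g 0 0; rewrite oppr0 !addr0 !sol_eps0 !mulr1 sol_A0r sol_rM addr0 sol_M_values eqxx mulr1n.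
set D := 1 - _ => e; have D0 : D != 0.
  apply/eqP => D0; have p2 := @sqr_invgold R.
  have pE : p = 2 by rewrite -[LHS]addr0 -(mulr0 2) -D0 /D; field.
  move: p2; rewrite pE => /eqP; rewrite -subr_eq0 (_ : _ - _ = 5) ?pnatr_eq0 //; ring.
have e0 : D * (eta x g)^* != 0 by rewrite mulf_neq0 // conjC_eq0 -normr_eq0 (gh_eta_circle Hx) oner_eq0.
by apply: (mulfI e0); rewrite -e mulr1.
Qed.

Lemma sol_amp_h0 g h : A g h 0 = (h == 0)%:R - p / 2.
Proof.
rewrite sol_A0r sol_eta rmorph1 mulr1 sol_rM sol_M_values; congr (_%:R - _).
by rewrite -{1}[g]addr0 (inj_eq (addrI g)) eq_sym.
Qed.

Lemma sol_amp_0h g h : A g 0 h = (h == 0)%:R - p / 2.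
Proof. by rewrite -(sol_amp_h0 g) sol_A0l sol_A0r sol_eta rmorph1. Qed.

Lemma sol_amp_diag g k : k != 0 -> A g k k = eps x k g * (- (p / 2)).
Proof.
move=> k0; have := gh_P7l Hx g 0 k; rewrite !V4_opp !(addr0, add0r) sol_eta mulr1 sol_amp_0h.
rewrite (negPf k0) sub0r => ->.
have e1 := sol_eps2 k g; have e2 := sol_eps2 k (g + k).
by rewrite -[_ * eps x k (g + k) * _]mulrA e2 mulr1 mulrCA e1 mulr1.
Qed.

Lemma sol_amp_offdiag_norm g h k : h != 0 -> k != 0 -> h != k ->
  A g h k * (A g h k)^* = (1 + p) / 4.
Proof.
move=> h0 k0 hk; have := sol_M_sqr g h0 k0 hk; rewrite sol_M_values.
rewrite -{1}[g]addr0 (inj_eq (addrI g)) eq_sym (negPf h0) sub0r /n => e.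
have p2 := @sqr_invgold R; apply: (mulIf (_ : 4 != 0 :> C)); first by rewrite pnatr_eq0.
rewrite divfK ?pnatr_eq0 //.
transitivity (2 * (((- (p / 2)) ^+ 2 * 2 + A g h k * (A g h k)^* * 2)) - p ^+ 2).
  by field.
by rewrite e p2; ring.
Qed.

Lemma sol_amp_neq0 g h k : A g h k != 0.
Proof.
have p2 := @sqr_invgold R.
have p0 : p != 0.
  by apply: contra_eq_neq p2 => ->; rewrite expr0n subr0 eq_sym oner_eq0.
have p2' : 2 - p != 0.
  apply: contra_eq_neq p2 => /subr0_eq <-.
  by rewrite -subr_eq0 (_ : _ - _ = 5) ?pnatr_eq0 //; ring.
have nz (b : bool) : b%:R - p / 2 != 0.
  have -> : b%:R - p / 2 = (2 * b%:R - p) / 2 by field.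
  by rewrite mulf_neq0 ?invr_eq0 ?pnatr_eq0 //; case: b; rewrite ?mulr1 // mulr0 sub0r oppr_eq0.
have e0 u v : eps x u v != 0.
  by case: (gh_eps_sign Hx u v) => ->; rewrite ?oppr_eq0 oner_eq0.
case: (eqVneq h 0) => [->|h0]; first by rewrite sol_amp_0h nz.
case: (eqVneq k 0) => [->|k0]; first by rewrite sol_amp_h0 nz.
case: (eqVneq h k) => [->|hk].
  by rewrite sol_amp_diag // mulf_neq0 //; have := nz false; rewrite sub0r.
apply/eqP => A0; have := sol_amp_offdiag_norm g h0 k0 hk; rewrite A0 mul0r => /esym/eqP.
rewrite mulf_eq0 invr_eq0 pnatr_eq0 orbF addrC addr_eq0 => /eqP pE.
by move: p2; rewrite pE => /eqP; rewrite -subr_eq0 (_ : _ - _ = -1) ?oppr_eq0 ?oner_eq0 //; ring.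
Qed.

(** Since 2h = 0, (P5) at g = 0 compares A_0(u,v) with itself; the amplitude is nonzero, so the
    product of signs is 1. *)
Lemma sol_eps_bichar h u v : eps x h (u + v) = eps x h u * eps x h v.
Proof.
have := gh_P5 Hx 0 h u v; rewrite V4_mul2 !add0r (gh_P1_0 Hx) mul1r => e.
have {}e : eps x h u * eps x h v * eps x h (u + v) = 1.
  by apply: (mulIf (sol_amp_neq0 0 u v)); rewrite mul1r -e.
by rewrite -[RHS]mulr1 -(sol_eps2 h (u + v)) mulrA e mul1r.
Qed.

Lemma sol_eps_charl h k g : eps x (h + k) g = eps x h g * eps x k g.
Proof. by rewrite (gh_P1 Hx) V4_mul2 addr0. Qed.

Lemma sol_P7 g h k : A g h k = (A g (h + k) k)^* * eps x k g.
Proof.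
have := gh_P7l Hx g h k; rewrite !V4_opp [A g k _](gh_P6 Hx) sol_eta mulr1 => ->.
rewrite !sol_eps_bichar -!mulrA; congr (_ * _).
have e1 := sol_eps2 k g; have e2 := sol_eps2 k h; have e3 := sol_eps2 k k.
set a := eps x k g in e1 *; set b := eps x k h in e2 *; set c := eps x k k in e3 *.
transitivity (a * (a * a) * (b * b) * (c * c)); first by ring.
by rewrite e1 e2 e3 !mulr1.
Qed.

(** For distinct nonzero h and k, this lemma, [sol_P8r] and [sol_P8lr] cover g = h, g = k and g = h
    + k, so the matrix A_0 and ε determine all the others. *)
Lemma sol_P8l h k : A h h k = A 0 h k * eps x h k.
Proof.
have := gh_P8l Hx 0 h k; rewrite !sol_eta !rmorphM /= rmorph1 !add0r !mulr1 (gh_P1_0 Hx) mulr1 => ->.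
by rewrite -mulrA sol_eps2 mulr1.
Qed.

Lemma sol_P8r h k : A k h k = A 0 h k * eps x k h.
Proof.
have := gh_P8r Hx 0 h k; rewrite !sol_eta !rmorphM /= rmorph1 !add0r !mulr1 (gh_P1_0 Hx) mulr1 => ->.
by rewrite -mulrA sol_eps2 mulr1.
Qed.

Lemma sol_P8lr h k : A (h + k) h k = A 0 h k * eps x (h + k) k * eps x k (h + k).
Proof.
rewrite sol_P7 sol_P8l rmorphM /= sol_epsJ; congr (_ * _ * _).
by rewrite [RHS]sol_P7 (gh_P1_0 Hx) mulr1.
Qed.

End Uniqueness.

(** * The bicharacter and the amplitude w = A_0(a,b) *)

Section UniquenessSigns.
Variables (R : realType) (x : gh_data R V4).
Hypothesis Hx : gh_solution x.
Local Notation C := R[i].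
Local Notation p := (@invgold R).
Local Notation A := (amp x).
Local Notation eps := (eps x).

Lemma invgold_neq0 : p != 0.
Proof.
apply: contra_eq_neq (@sqr_invgold R) => ->.
by rewrite expr0n subr0 eq_sym oner_eq0.
Qed.

Lemma sol_amp0_swap h k : (A 0 h k)^* = A 0 (h + k) k.
Proof. by rewrite [in LHS](sol_P7 Hx) (gh_P1_0 Hx) mulr1 conjCK. Qed.

Let w := A 0 Va Vb.

(** At g = 0, (P6) and (P7) say that the moves (h,k) to (k,h) and (h,k) to (h+k,k) conjugate the
    amplitude; together they reach all six ordered pairs from (a,b). *)
Lemma sol_amp0_cases k l : k != 0 -> l != 0 -> k != l -> A 0 l k = w \/ A 0 l k = w^*.
Proof.
have h1 : A 0 Vc Vb = w^* by rewrite sol_amp0_swap V4_addE.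
have h2 : A 0 Vb Va = w^* by rewrite (gh_P6 Hx).
have h3 : A 0 Vc Va = w by rewrite -[RHS]conjCK -h2 sol_amp0_swap V4_addE.
have h4 : A 0 Va Vc = w^* by rewrite (gh_P6 Hx) h3.
have h5 : A 0 Vb Vc = w by rewrite (gh_P6 Hx) h1 conjCK.
by elim/V4_ind: k; elim/V4_ind: l => // _ _ _; [right|left|left|right|right|left].
Qed.

(** The orthogonality (P4) for g = 0, g' = l in column k, divided by the common factor -p/2. *)
Lemma sol_cross k l : k != 0 -> l != 0 -> k != l ->
  (A 0 l k)^* * (eps l k + eps k l) + A 0 l k * (eps l k * eps k l + 1) = 0.
Proof.
move=> k0 l0 kl; have := gh_P4 Hx 0 l k.
rewrite /kron eq_sym (negPf l0) (negPf k0) mulr0 subr0 (V4_sum2 _ k0 l0 kl).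
rewrite !subr0 !sub0r !V4_opp V4_addxx [k + l + l]V4_addK [k + l]addrC.
rewrite (sol_amp_0h Hx) (negPf k0) (sol_amp_diag Hx 0 k0) (gh_P1_0 Hx) mul1r sub0r.
rewrite [A l 0 k](sol_amp_0h Hx) (negPf k0) sub0r (sol_amp_diag Hx l k0) (sol_P8l Hx).
have -> : A l (l + k) k = (A 0 l k)^* * eps l k * eps k l.
  rewrite (sol_P7 Hx) [l + k + k]V4_addK (sol_P8l Hx) rmorphM /= (sol_epsJ Hx) .
  by [].
rewrite -(sol_amp0_swap l k); set W := A 0 l k; set a := eps l k; set b := eps k l.
have aJ : a^* = a by exact: sol_epsJ. have bJ : b^* = b by exact: sol_epsJ.
have pJ : (p / 2)^* = p / 2 by rewrite rmorphM /= conj_invgold fmorphV rmorph_nat.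
have [q qE] : exists q, q = p / 2 by exists (p / 2).
rewrite -qE in pJ *; rewrite !(rmorphM, rmorphN) /= conjCK aJ bJ pJ qE => e.
apply: (mulfI invgold_neq0); apply: (mulfI (_ : - 2^-1 != 0 :> C)).
  by rewrite oppr_eq0 invr_eq0 pnatr_eq0.
by rewrite !mulr0 -[RHS]e; ring.
Qed.

(** The orthogonality (P4) for g = 0, g' = k in the same column k. *)
Lemma sol_self k l : k != 0 -> l != 0 -> k != l ->
  (eps k k + 1) * (p ^+ 2 / 4) + A 0 l k ^+ 2 * eps k (l + k) + (A 0 l k)^* ^+ 2 * eps k l = 0.
Proof.
move=> k0 l0 kl; have := gh_P4 Hx 0 k k.
rewrite /kron eq_sym (negPf k0) mulr0 subr0 (V4_sum2 _ k0 l0 kl).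
rewrite !subr0 !sub0r !V4_opp V4_addxx [k + l]addrC [l + k + k]V4_addK.
rewrite !(sol_amp_0h Hx) (negPf k0) !sub0r !(sol_amp_diag Hx _ k0) (gh_P1_0 Hx) mul1r.
rewrite !(sol_P8r Hx) -(sol_amp0_swap l k); set W := A 0 l k.
have pJ : (p / 2)^* = p / 2 by rewrite rmorphM /= conj_invgold fmorphV rmorph_nat.
have [q qE] : exists q, q = p / 2 by exists (p / 2).
rewrite -qE in pJ *; rewrite !(rmorphM, rmorphN) /= !(sol_epsJ Hx) conjCK pJ qE => e.
by rewrite -[RHS]e; field.
Qed.

(** If ε_k(k) = 1 and w^2 is real, [sol_self] gives |w|^2 = p^2/4 = (1-p)/4, whereas the
    normalization gives (1+p)/4. *)
Lemma sol_real_pos k : k != 0 -> w ^+ 2 = w^* ^+ 2 -> eps k k != 1.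
Proof.
move=> k0 wJ; apply/eqP => e1.
have [l l0 kl] : exists2 l, l != 0 & k != l.
  by move: k0; elim/V4_ind: k {e1} => // _; [exists Vb|exists Va|exists Va].
have := sol_self k0 l0 kl.
have -> : (A 0 l k)^* ^+ 2 = A 0 l k ^+ 2.
  by case: (sol_amp0_cases k0 l0 kl) => ->; rewrite ?conjCK.
rewrite (sol_eps_bichar Hx) e1 mulr1 => e2.
have n := sol_amp_offdiag_norm Hx 0 l0 k0 (_ : l != k); rewrite eq_sym in n; have {}n := n kl.
have W2 : A 0 l k ^+ 2 * eps k l = - (p ^+ 2 / 4).
  apply: (mulfI (_ : 2 != 0 :> C)); first by rewrite pnatr_eq0.
  apply/eqP; rewrite -subr_eq0; apply/eqP; rewrite -[RHS]e2; ring.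
have W4 : (A 0 l k ^+ 2) ^+ 2 = (p ^+ 2 / 4) ^+ 2.
  rewrite -[RHS]sqrrN -W2 [RHS]exprMn; have := sol_eps2 Hx k l; rewrite -expr2 => ->.
  by rewrite mulr1.
have n2 : ((1 + p) / 4) ^+ 2 = (A 0 l k ^+ 2) ^+ 2.
  rewrite -n exprMn; have -> : (A 0 l k)^* ^+ 2 = A 0 l k ^+ 2.
    by case: (sol_amp0_cases k0 l0 kl) => ->; rewrite ?conjCK.
  by rewrite expr2.
have : p = 0; last by apply/eqP; exact: invgold_neq0.
have p2 := @sqr_invgold R.
move: n2; rewrite W4 p2 => n2.
transitivity (4 * ((1 + p) / 4) ^+ 2 - 4 * ((1 - p) / 4) ^+ 2); first by field.
by rewrite n2 subrr.
Qed.

Lemma sol_eps_sym k l : k != 0 -> l != 0 -> k != l -> eps l k = eps k l -> w ^+ 2 = w^* ^+ 2.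
Proof.
move=> k0 l0 kl e; have := sol_cross k0 l0 kl; rewrite e (sol_eps2 Hx) => e2.
have : (A 0 l k)^* * eps k l = - A 0 l k.
  apply: (mulfI (_ : 2 != 0 :> C)); first by rewrite pnatr_eq0.
  apply/eqP; rewrite -subr_eq0; apply/eqP; rewrite -[RHS]e2; ring.
move/(congr1 (fun t => t ^+ 2)); rewrite sqrrN [LHS]exprMn; have := sol_eps2 Hx k l; rewrite -expr2 => ->.
by rewrite mulr1; case: (sol_amp0_cases k0 l0 kl) => ->; rewrite ?conjCK // => ->.
Qed.

Lemma sol_eps_neg_real k : k != 0 -> eps k k = -1 -> w ^+ 2 = w^* ^+ 2.
Proof.
move=> k0 e1.
have [l l0 kl] : exists2 l, l != 0 & k != l.
  by move: k0; elim/V4_ind: k {e1} => // _; [exists Vb|exists Va|exists Va].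
have := sol_self k0 l0 kl; rewrite (sol_eps_bichar Hx) e1 => e2.
have : A 0 l k ^+ 2 = (A 0 l k)^* ^+ 2.
  have e0 : eps k l != 0 by case: (gh_eps_sign Hx k l) => ->; rewrite ?oppr_eq0 oner_eq0.
  apply: (mulIf e0); apply/eqP; rewrite -subr_eq0 -oppr_eq0; apply/eqP; rewrite -[RHS]e2; ring.
by case: (sol_amp0_cases k0 l0 kl) => ->; rewrite ?conjCK // => ->.
Qed.

(** Suppose ε_k(k) = 1; by [sol_real_pos] it suffices that w^2 is real. A diagonal value -1 anywhere
    makes it real. If all three diagonal values are 1, bilinearity at c = a + b gives ε_a(b) =
    ε_b(a), and this symmetry makes w^2 real as well. *)
Lemma sol_eps_diag k : k != 0 -> eps k k = -1.
Proof.
move=> k0; case: (gh_eps_sign Hx k k) => // ek; exfalso.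
suff : w ^+ 2 = w^* ^+ 2 by move/(sol_real_pos k0)/eqP.
have ecc : eps Vc Vc = eps Va Va * eps Vb Vb * (eps Va Vb * eps Vb Va).
  have -> : Vc = Va + Vb by rewrite V4_addE.
  by rewrite !(sol_eps_bichar Hx, sol_eps_charl Hx); ring.
case: (gh_eps_sign Hx Va Va) => ea; last exact: (sol_eps_neg_real (k := Va)).
case: (gh_eps_sign Hx Vb Vb) => eb; last exact: (sol_eps_neg_real (k := Vb)).
case: (gh_eps_sign Hx Vc Vc) => ec; last exact: (sol_eps_neg_real (k := Vc)).
apply: (sol_eps_sym (k := Va) (l := Vb)) => //.
move: ecc; rewrite ea eb ec !mul1r => e.
by rewrite -[LHS]mul1r {1}e -mulrA (sol_eps2 Hx) mulr1.
Qed.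

Lemma sol_eps_ba : eps Vb Va = - eps Va Vb.
Proof.
have : eps Vc Vc = -1 by rewrite sol_eps_diag.
have -> : Vc = Va + Vb by rewrite V4_addE.
rewrite !(sol_eps_bichar Hx, sol_eps_charl Hx) !sol_eps_diag // => e.
rewrite -[LHS]mul1r -(sol_eps2 Hx Va Vb) -[RHS]mulr1 mulNr -mulrN -e.
by ring.
Qed.

Lemma sol_eps_chi : eps = chi (eps Va Vb).
Proof.
have aa := @sol_eps_diag Va isT; have bb := @sol_eps_diag Vb isT; have cc := @sol_eps_diag Vc isT.
have ba := sol_eps_ba.
have cE : Vc = Va + Vb by rewrite V4_addE.
have ac : eps Va Vc = - eps Va Vb.
  by rewrite cE (sol_eps_bichar Hx) aa mulN1r.
have bc : eps Vb Vc = eps Va Vb.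
  by rewrite cE (sol_eps_bichar Hx) bb ba mulrN1 opprK.
have cb : eps Vc Vb = - eps Va Vb.
  by rewrite cE (sol_eps_charl Hx) bb mulrN1.
have ca : eps Vc Va = eps Va Vb.
  by rewrite cE (sol_eps_charl Hx) aa ba mulN1r opprK.
apply/funext => h; apply/funext => g.
elim/V4_ind: h; elim/V4_ind: g;
  by rewrite /chi /table /= ?(sol_eps0 Hx) ?(gh_P1_0 Hx) ?aa ?bb ?cc ?ba ?ac ?bc ?cb ?ca.
Qed.

Lemma sol_w_sqr : w ^+ 2 = w^* ^+ 2.
Proof. by apply: (sol_eps_neg_real (k := Va)) => //; apply: sol_eps_diag. Qed.

Let s : C := eps Va Vb.
Let z : C := w * (dimC - 1).

(** Here z conj z = d and z^2 is real, so conj z = ±z and z^2 = ±d. *)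
Lemma sol_z_parameters : V4_parameters s z.
Proof.
pose r : C := (Num.sqrt (gh_dim R V4))%:C%C.
suff: (s \in [:: 1; - 1]) /\ (z \in [:: r; - r; 'i * r; - ('i * r)]) by [].
split.
  by rewrite !inE; exact: sign_cases (gh_eps_sign Hx Va Vb).
have p2 := @sqr_invgold R.
have d0 := @dimC_sub1_neq0 R.
have pd : p * (dimC - 1) = 2 by rewrite /invgold divfK.
have zz : z * z^* = dimC.
  rewrite /z rmorphM rmorphB /= conj_dimC rmorph1.
  transitivity ((w * w^*) * (dimC - 1) ^+ 2); first by ring.
  by rewrite (sol_amp_offdiag_norm Hx) // dimC_invgold; field: p2.
have z2 : z ^+ 2 = z^* ^+ 2.
  by rewrite /z rmorphM rmorphB /= conj_dimC rmorph1 !exprMn sol_w_sqr.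
have r2 : r ^+ 2 = dimC.
  rewrite /r -rmorphXn /= sqr_sqrtr //; have := gh_dim_V4_gt4 R; lra.
have i2 : 'i ^+ 2 = -1 :> C := sqrCi _.
move: z2 => /eqP; rewrite eqf_sqr !inE => /orP[]/eqP zJ.
  have /eqP : z ^+ 2 = r ^+ 2 by rewrite r2 -zz -zJ.
  by rewrite eqf_sqr => /orP[]->; rewrite ?orbT.
have /eqP : z ^+ 2 = ('i * r) ^+ 2.
  by rewrite [RHS]exprMn i2 r2 -zz mulN1r -mulrN -zJ.
by rewrite eqf_sqr => /orP[]->; rewrite ?orbT.
Qed.

Lemma sol_V4_data : x = V4_data s z.
Proof.
have aa := @sol_eps_diag Va isT; have bb := @sol_eps_diag Vb isT; have cc := @sol_eps_diag Vc isT.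
have d0 := @dimC_sub1_neq0 R.
have diagE : 1 - p / 2 = (dimC - 1)^-1 * (dimC - 2) by rewrite /invgold; field.
have offE : - (p / 2) = (dimC - 1)^-1 * -1 by rewrite /invgold; field.
suff ampE : A = V4_amp s z.
  have -> : x = GHData eps (eta x) A by case: (x).
  rewrite /V4_data ampE sol_eps_chi; congr GHData.
  by apply/funext => g; rewrite (sol_eta Hx).
have zJ : z^* = w^* * (dimC - 1).
  by rewrite /z rmorphM rmorphB /= conj_dimC rmorph1.
have h1 : A 0 Vc Vb = w^* by rewrite sol_amp0_swap V4_addE.
have h2 : A 0 Vb Va = w^* by rewrite (gh_P6 Hx).
have h3 : A 0 Vc Va = w by rewrite -[RHS]conjCK -h2 sol_amp0_swap V4_addE.
have h4 : A 0 Va Vc = w^* by rewrite (gh_P6 Hx) h3.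
have h5 : A 0 Vb Vc = w by rewrite (gh_P6 Hx) h1 conjCK.
have nz (t : C) : t = (dimC - 1)^-1 * (t * (dimC - 1)) by rewrite mulrCA mulVf ?mulr1.
have e1 h k g : h + k = g -> A g h k = A 0 h k * eps g k * eps k g by move=> <-; exact: sol_P8lr.
have [e1abc e1acb e1bac] : [/\ A Va Vb Vc = A 0 Vb Vc * eps Va Vc * eps Vc Va,
    A Va Vc Vb = A 0 Vc Vb * eps Va Vb * eps Vb Va & A Vb Va Vc = A 0 Va Vc * eps Vb Vc * eps Vc Vb].
  by split; apply: e1; rewrite V4_addE.
have [e1bca e1cab e1cba] : [/\ A Vb Vc Va = A 0 Vc Va * eps Vb Va * eps Va Vb,
    A Vc Va Vb = A 0 Va Vb * eps Vc Vb * eps Vb Vc & A Vc Vb Va = A 0 Vb Va * eps Vc Va * eps Va Vc].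
  by split; apply: e1; rewrite V4_addE.
have ss : s ^+ 2 = 1 by rewrite expr2; exact: sol_eps2 Hx Va Vb.
have ba : eps Vb Va = - s := sol_eps_ba.
have ac : eps Va Vc = - s by rewrite sol_eps_chi.
have bc : eps Vb Vc = s by rewrite sol_eps_chi.
have cb : eps Vc Vb = - s by rewrite sol_eps_chi.
have ca : eps Vc Va = s by rewrite sol_eps_chi.
have D0 g : A g 0 0 = (dimC - 1)^-1 * (dimC - 2).
  by rewrite (sol_amp_h0 Hx) eqxx mulr1n diagE.
have Dr g h : h != 0 -> A g h 0 = (dimC - 1)^-1 * -1.
  by move=> h0; rewrite (sol_amp_h0 Hx) (negPf h0) sub0r offE.
have Dl g h : h != 0 -> A g 0 h = (dimC - 1)^-1 * -1.
  by move=> h0; rewrite (sol_amp_0h Hx) (negPf h0) sub0r offE.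
have Dd g h : h != 0 -> A g h h = (dimC - 1)^-1 * - eps h g.
  by move=> h0; rewrite (sol_amp_diag Hx) // offE mulrCA mulrN1.
apply/funext => g; apply/funext => h; apply/funext => k.
have sE h' k' : chi s h' k' = eps h' k' by rewrite sol_eps_chi.
rewrite /V4_amp -/(@dimC R) !sE zJ.
elim/V4_ind: g; elim/V4_ind: h; elim/V4_ind: k; rewrite /table /= ?D0 ?Dr ?Dl ?Dd ?(gh_P1_0 Hx) ?aa ?bb ?cc ?opprK //.
all: rewrite ?e1abc ?e1acb ?e1bac ?e1bca ?e1cab ?e1cba.
all: rewrite ?(sol_P8l Hx) ?(sol_P8r Hx) ?h1 ?h2 ?h3 ?h4 ?h5 -/w ?ba ?ac ?bc ?cb ?ca /z -/s.
all: by field: ss.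
Qed.

End UniquenessSigns.

Lemma V4_parameters_code (R : realType) (s z : R[i]) : V4_parameters s z ->
  exists b e, [/\ s = zr R (sgn b), z ^+ 2 = zr R (sgn e) * (3 + 2 * invgold) &
    z^* = zr R (sgn e) * z].
Proof.
pose r : R[i] := (Num.sqrt (gh_dim R V4))%:C%C.
move=> [ss]; rewrite -/r => zz.
have [b ->] : exists b, s = zr R (sgn b).
  by move: ss; rewrite !inE => /orP[]/eqP->; [exists false|exists true]; rewrite zr_sgn.
have r2 : r ^+ 2 = 3 + 2 * invgold.
  rewrite -dimC_invgold /r -rmorphXn /= sqr_sqrtr //; have := gh_dim_V4_gt4 R; lra.
have rJ : r^* = r := realCE _.
have i2 : 'i ^+ 2 = -1 :> R[i] := sqrCi _.
have iJ : 'i^* = - 'i :> R[i] := conjCi _.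
exists b; move: zz; rewrite !inE => /or4P[]/eqP->; [exists false|exists false|exists true|exists true];
  split=> //; rewrite zr_sgn ?expr0 ?expr1 ?mul1r ?mulN1r ?sqrrN ?rmorphN ?rmorphM /= ?iJ ?rJ //.
- by rewrite [LHS]exprMn i2 r2 mulN1r.
- by rewrite mulNr.
- by rewrite [LHS]exprMn i2 r2 mulN1r.
- by rewrite mulNr.
Qed.

Theorem V4_solutions (R : realType) (x : gh_data R V4) :
  gh_solution x <-> exists s z : R[i], V4_parameters s z /\ x = V4_data s z.
Proof.
split=> [Hx|[s [z [/V4_parameters_code[b [e [-> z2 zJ]]] ->]]]]; last exact: (V4_data_solution _ z2 zJ).
by exists (eps x Va Vb), (amp x 0 Va Vb * (dimC - 1)); split;
  [exact: sol_z_parameters|exact: sol_V4_data].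
Qed.

(** * Equivalences between the solutions *)

Section Equivalences.
Variable R : realType.
Local Notation C := R[i].
Implicit Types s z : C.

(** The bit [e] tells real z ([false]) from purely imaginary z ([true]). *)
Definition sign_parameters s z (e : bool) : Prop :=
  [/\ is_sign s, z ^+ 2 = (-1) ^+ e * dimC & z^* = (-1) ^+ e * z].

Lemma sign_parametersP s z : V4_parameters s z -> exists e, sign_parameters s z e.
Proof.
move=> /V4_parameters_code[b [e [-> z2 zJ]]]; exists e.
split; last by rewrite -zr_sgn.
  by rewrite zr_sgn; case: b; [right|left].
by rewrite -zr_sgn dimC_invgold.
Qed.

Lemma sign_parameters_neq0 s z e : sign_parameters s z e -> z != 0.
Proof.
case=> _ z2 _; apply: contra_eq_neq z2 => ->.
by rewrite expr0n eq_sym mulf_neq0 ?signr_eq0 ?dimC_neq0.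
Qed.

(** For distinct nonzero h and k the points g, g+h, g+k, g+h+k exhaust G, otherwise they repeat in
    pairs. A single sign at 0 therefore negates exactly the entries that contain z or its
    conjugate. *)
Lemma V4_data_gauge s z : gauge_step (V4_data s z) (V4_data s (- z)).
Proof.
exists (fun g => if g == 0 then -1 else 1).
  by move=> g; case: eqP; [right|left].
congr GHData.
  apply/funext => h; apply/funext => g; rewrite V4_mul2 addr0 /=.
  by case: eqP => _; rewrite ?mulrNN ?mulr1 mul1r.
apply/funext => g; apply/funext => h; apply/funext => k.
rewrite /= /V4_amp -/(@dimC R) rmorphN.
by elim/V4_ind: g; elim/V4_ind: h; elim/V4_ind: k;
  rewrite ?addr0 ?add0r ?V4_addE ?addr0 ?add0r ?V4_addE ?V4_eqE ?eqxx /table /=; ring.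
Qed.

Definition V4_swap (g : V4) : V4 := (g.2, g.1).

Lemma V4_swap_additive : zmod_morphism V4_swap.
Proof. by case=> a b [c d]. Qed.

HB.instance Definition _ := GRing.isZmodMorphism.Build V4 V4 V4_swap V4_swap_additive.

Lemma V4_data_swap s z : aut_step (V4_data s z) (V4_data (- s) z^*).
Proof.
exists V4_swap.
have S0 : V4_swap 0 = 0 by []. have Sa : V4_swap Va = Vb by [].
have Sb : V4_swap Vb = Va by []. have Sc : V4_swap Vc = Vc by [].
split.
- by exists V4_swap; case.
- move=> h g; elim/V4_ind: h; elim/V4_ind: g;
    by rewrite ?S0 ?Sa ?Sb ?Sc /= /chi /table /= ?opprK.
- by [].
move=> g h k; rewrite /= /V4_amp conjCK.
by elim/V4_ind: g; elim/V4_ind: h; elim/V4_ind: k;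
  rewrite ?S0 ?Sa ?Sb ?Sc /chi /table /= ?opprK.
Qed.

(* The Pauli cocycle. *)
Definition V4_cocycle : V4 -> V4 -> C :=
  table [:: [:: 1; 1;     1;     1];
            [:: 1; 1;     'i;    - 'i];
            [:: 1; - 'i;  1;     'i];
            [:: 1; 'i;    - 'i;  1]].

Lemma V4_cocycle_adapted : adapted_cocycle V4_cocycle.
Proof.
have i2 : 'i ^+ 2 = -1 :> C := sqrCi _.
have iJ : 'i^* = - 'i :> C := conjCi _.
have ii : 'i * 'i = -1 :> C by rewrite -expr2.
have inv g : V4_cocycle g g = 1 by elim/V4_ind: g.
have anti g h : V4_cocycle g h * V4_cocycle h g = 1.
  by elim/V4_ind: g; elim/V4_ind: h; rewrite /V4_cocycle /table /= ?(mulr1, mulrN, mulNr, ii, opprK).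
have sJ g h : (V4_cocycle g h)^* = V4_cocycle h g.
  by elim/V4_ind: g; elim/V4_ind: h; rewrite /V4_cocycle /table /= ?rmorphN ?rmorph1 /= ?iJ ?opprK.
split.
- move=> g h; apply/eqP; rewrite -(@pexpr_eq1 _ _ 2) //.
  by rewrite normCK sJ anti.
- by move=> g h k; elim/V4_ind: g; elim/V4_ind: h; elim/V4_ind: k;
    rewrite ?addr0 ?add0r ?V4_addE /V4_cocycle /table /= ?(mulr1, mul1r, mulrN, mulNr, ii, opprK).
- by elim/V4_ind.
- by elim/V4_ind.
- by move=> g; rewrite V4_opp inv.
- exact: anti.
- by move=> g h; rewrite !V4_opp sJ anti.
Qed.

(** The Pauli cocycle takes the values ±i on distinct nonzero elements, so it rotates z by a quarter
    turn and joins the real and the imaginary family. *)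
Lemma V4_data_H2 s z : H2_step (V4_data s z) (V4_data (- s) ('i * z)).
Proof.
have i2 : 'i ^+ 2 = -1 :> C := sqrCi _.
have iJ : 'i^* = - 'i :> C := conjCi _.
exists V4_cocycle, (fun=> 1); split.
- exact: V4_cocycle_adapted.
- by left.
- by elim/V4_ind.
congr GHData.
  apply/funext => h; apply/funext => g; rewrite !mulr1 rmorphM /=.
  elim/V4_ind: h; elim/V4_ind: g; rewrite ?addr0 ?add0r ?V4_addE /V4_cocycle /chi /table /=
    ?rmorphN ?rmorph1 /= ?iJ //; ring: i2.
apply/funext => g; apply/funext => h; apply/funext => k.
rewrite !mulr1 rmorphM /= /V4_amp -/(@dimC R) rmorphM /= iJ.
elim/V4_ind: g; elim/V4_ind: h; elim/V4_ind: k; rewrite ?addr0 ?add0r ?V4_addE /V4_cocycle /chi /table /=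
    ?rmorphN ?rmorph1 /= ?iJ; ring: i2.
Qed.

Lemma V4_data_equiv s z s' z' e : sign_parameters s z e -> sign_parameters s' z' e ->
  gauge_aut_equiv (V4_data s z) (V4_data s' z').
Proof.
move=> [ss z2 zJ] [ss' z2' zJ'].
have opp t t' (u : C) : t ^+ 2 = t' ^+ 2 -> gauge_aut_equiv (V4_data u t) (V4_data u t').
  move/eqP; rewrite eqf_sqr => /orP[]/eqP->; first exact: rst_refl.
  by apply: rst_sym; apply: rst_step; left; exact: V4_data_gauge.
have [->|->] : s' = s \/ s' = - s.
  by case: ss => ->; case: ss' => ->; rewrite ?opprK; [left|right|right|left].
  by apply: opp; rewrite z2 z2'.
apply: (rst_trans _ _ _ (V4_data (- s) z^*)); first by apply: rst_step; right; exact: V4_data_swap.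
by apply: opp; rewrite zJ exprMn z2 sqrr_sign mul1r z2'.
Qed.

Lemma V4_data_H2_equiv s z s' z' e e' : sign_parameters s z e -> sign_parameters s' z' e' ->
  gauge_aut_H2_equiv (V4_data s z) (V4_data s' z').
Proof.
have incl x y : gauge_aut_equiv x y -> gauge_aut_H2_equiv x y.
  elim=> {x y} [x y [h|h]|x|x y _|x y t _ h1 _ h2].
  - by apply: rst_step; constructor 1.
  - by apply: rst_step; constructor 2.
  - exact: rst_refl.
  - exact: rst_sym.
  - exact: rst_trans h1 h2.
move=> h h'; case: (eqVneq e e') => [ee|ee]; first by apply/incl/V4_data_equiv/h'; rewrite -ee.
apply: (rst_trans _ _ _ (V4_data (- s) ('i * z))); first by apply: rst_step; constructor 3; exact: V4_data_H2.
apply/incl/V4_data_equiv/h'.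
have -> : e' = ~~ e by case: (e) (e') ee => [] [].
case: h => [ss z2 zJ]; split.
- by case: ss => ->; rewrite ?opprK; [right|left].
- by rewrite [LHS]exprMn sqrCi z2 signrN mulNr mulN1r.
- by rewrite rmorphM /= conjCi zJ signrN; ring.
Qed.

Lemma sign_parameters_real s z e : sign_parameters s z e -> z \is Num.real -> e = false.
Proof.
move=> h zr; have z0 := sign_parameters_neq0 h; case: h => _ _.
rewrite (CrealP zr); case: e => // /eqP.
by rewrite mulN1r -subr_eq0 opprK -mulr2n mulrn_eq0 (negPf z0).
Qed.

Lemma sign_parameters_imaginary s z e : sign_parameters s z e ->
  (exists2 t : C, t \is Num.real & z = 'i * t) -> e = true.
Proof.
move=> h [t tr zE]; have z0 := sign_parameters_neq0 h; case: h => _ _.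
rewrite [in LHS]zE rmorphM /= conjCi (CrealP tr) mulNr -zE; case: e => // /eqP.
by rewrite expr0 mul1r eq_sym -subr_eq0 opprK -mulr2n mulrn_eq0 (negPf z0).
Qed.

Lemma V4_solution_exists : exists x : gh_data R V4, gh_solution x.
Proof.
exists (V4_data 1 (Num.sqrt (gh_dim R V4))%:C%C); apply/V4_solutions; do 2!eexists; split; last by [].
by split; rewrite inE eqxx.
Qed.

End Equivalences.

(** * Endomorphisms of a star-algebra with finitely many simple objects *)

(** The algebraic content of a von Neumann algebra on which the categorical part rests; [star_pos]
    allows a nonzero intertwiner between irreducible objects to be rescaled to a unitary. *)
Record star_algebra (R : realType) (M : algType R[i]) (star : M -> M) : Prop := {
  starK : involutive star;
  starD : forall x y, star (x + y) = star x + star y;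
  starZ : forall (a : R[i]) x, star (a *: x) = a^* *: star x;
  starM : forall x y, star (x * y) = star y * star x;
  star1 : star 1 = 1;
  star_pos : forall x (c : R[i]), x != 0 -> star x * x = c *: 1 -> 0 < c }.

Section VonNeumann.
Variables (R : realType) (M : algType R[i]) (star : M -> M).

Lemma von_neumann_star_algebra : von_neumann_algebra star -> star_algebra star.
Proof.
case=> H [dot [pi [hd hp _]]].
have dot0 u : dot 0 u = 0.
  have := dot_linearl hd 1 0 0 u; rewrite scale1r add0r mul1r => /eqP.
  by rewrite -subr_eq0 opprD addNKr oppr_eq0 => /eqP.
have dotl u v w : dot (u + v) w = dot u w + dot v w.
  by have := dot_linearl hd 1 u v w; rewrite scale1r mul1r.
have dotZ a u w : dot (a *: u) w = a * dot u w.
  by have := dot_linearl hd a u 0 w; rewrite addr0 dot0 addr0.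
have dotr u v w : dot w (u + v) = dot w u + dot w v.
  by rewrite (dot_conj hd) dotl rmorphD /= -!(dot_conj hd).
have dotZr a u w : dot w (a *: u) = a^* * dot w u.
  by rewrite (dot_conj hd) dotZ rmorphM /= -(dot_conj hd).
have dotI u v : (forall w, dot u w = dot v w) -> u = v.
  move=> h; apply/eqP; rewrite -subr_eq0 -normr_eq0 -sqrf_eq0 (dot_norm hd).
  by rewrite dotl -[- v]scaleN1r dotZ h mulN1r subrr.
have piI x y : (forall u v, dot (pi x u) v = dot (pi y u) v) -> x = y.
  by move=> h; apply: (rep_inj hp); apply/funext => u; apply: dotI => w.
have pi0 u : pi 0 u = 0.
  have := rep_linear hp 1 0 0 u; rewrite !scale1r addr0 => /eqP.
  by rewrite -subr_eq0 opprD addNKr oppr_eq0 => /eqP.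
have piD x y u : pi (x + y) u = pi x u + pi y u.
  by have := rep_linear hp 1 x y u; rewrite !scale1r.
have piZ a x u : pi (a *: x) u = a *: pi x u.
  by have := rep_linear hp a x 0 u; rewrite !addr0 pi0 addr0.
have adj x u v : dot (pi (star x) u) v = dot u (pi x v).
  by rewrite (dot_conj hd) -(rep_star hp) -(dot_conj hd).
split.
- by move=> x; apply: piI => u v; rewrite adj -(rep_star hp).
- by move=> x y; apply: piI => u v; rewrite adj piD dotr piD dotl !adj.
- by move=> a x; apply: piI => u v; rewrite adj !piZ dotZr dotZ adj.
- by move=> x y; apply: piI => u v; rewrite adj !(rep_mul hp) !adj.
- by apply: piI => u v; rewrite adj !(rep_1 hp).
move=> x c x0 xc.
have [u pu0] : exists u, pi x u != 0.
  apply: contrapT => h; move/eqP: x0; apply; apply: (rep_inj hp); apply/funext => u.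
  by rewrite pi0; apply/eqP/negPn/negP => h'; apply: h; exists u.
have u0 : u != 0.
  by apply: contra_neq pu0 => ->; have [l _] := rep_bounded hp x; have := l (-1) 0 0;
     rewrite addr0 scaler0 scaleN1r addNr.
have nu : 0 < dot u u by rewrite -(dot_norm hd) exprn_gt0 // normr_gt0.
have : 0 < dot (pi x u) (pi x u) by rewrite -(dot_norm hd) exprn_gt0 // normr_gt0.
rewrite (rep_star hp) -(rep_mul hp) xc piZ (rep_1 hp) dotZr pmulr_lgt0 // => cJ.
by have := CrealP (gtr0_real cJ); rewrite conjCK => ->.
Qed.

End VonNeumann.

(** * Calculus of intertwiners *)

Section Intertwiners.
Variables (R : realType) (M : algType R[i]) (star : M -> M).
Hypothesis sa : star_algebra star.
Local Notation Hom := (@intertwiner R M).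
Implicit Types (s t : M -> M) (x y S T : M).

Lemma star0 : star 0 = 0.
Proof. by apply: (addrI (star 0)); rewrite -(starD sa) !addr0. Qed.

Lemma star_sum (K : Type) (r : seq K) (P : pred K) (f : K -> M) :
  star (\sum_(i <- r | P i) f i) = \sum_(i <- r | P i) star (f i).
Proof. exact: (big_morph star (starD sa) star0). Qed.

Lemma unitaryV U : unitary star U -> unitary star (star U).
Proof. by case=> h1 h2; split; rewrite (starK sa). Qed.

Lemma unitaryM U U' : unitary star U -> unitary star U' -> unitary star (U * U').
Proof.
case=> h1 h2 [h3 h4]; split; rewrite (starM sa).
  by rewrite mulrA -[star U' * _ * _]mulrA h1 mulr1.
by rewrite mulrA -[U * U' * _]mulrA h4 mulr1.
Qed.

Lemma unitary1 : unitary star 1.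
Proof. by split; rewrite (star1 sa) mulr1. Qed.

Section Endo.
Variable s : M -> M.
Hypothesis hs : star_endo star s.

Lemma endoD x y : s (x + y) = s x + s y.
Proof. by have := endo_linear hs 1 x y; rewrite !scale1r. Qed.

Lemma endo0 : s 0 = 0.
Proof. by apply: (addrI (s 0)); rewrite -endoD !addr0. Qed.

Lemma endoZ (a : R[i]) x : s (a *: x) = a *: s x.
Proof. by have := endo_linear hs a x 0; rewrite endo0 !addr0. Qed.

Lemma endo_sum (K : Type) (r : seq K) (P : pred K) (f : K -> M) :
  s (\sum_(i <- r | P i) f i) = \sum_(i <- r | P i) s (f i).
Proof. exact: (big_morph s endoD endo0). Qed.

Lemma endo_unitary U : unitary star U -> unitary star (s U).
Proof. by case=> h1 h2; split; rewrite -(endo_star hs) -(endo_mul hs) ?h1 ?h2 (endo_1 hs). Qed.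

End Endo.

Lemma endo_id : star_endo star id.
Proof. by split. Qed.

Lemma endo_comp s t : star_endo star s -> star_endo star t -> star_endo star (s \o t).
Proof.
move=> hs ht; split=> [a x y||x y|x] /=.
- by rewrite (endoD ht) (endoZ ht) (endoD hs) (endoZ hs).
- by rewrite (endo_1 ht) (endo_1 hs).
- by rewrite (endo_mul ht) (endo_mul hs).
- by rewrite (endo_star ht) (endo_star hs).
Qed.

Lemma hom1 s : Hom s s 1.
Proof. by move=> x; rewrite mul1r mulr1. Qed.

Lemma homM s t k S T : Hom t k S -> Hom s t T -> Hom s k (S * T).
Proof. by move=> hS hT x; rewrite -mulrA hT mulrA hS mulrA. Qed.

Lemma homV s t T : star_endo star s -> star_endo star t -> Hom s t T -> Hom t s (star T).
Proof.
move=> hs ht hT x; have := hT (star x); rewrite (endo_star hs) (endo_star ht).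
by move/(congr1 star); rewrite !(starM sa) !(starK sa).
Qed.

Lemma homZ s t (a : R[i]) T : Hom s t T -> Hom s t (a *: T).
Proof. by move=> hT x; rewrite -scalerAl hT scalerAr. Qed.

Lemma hom0 s t : Hom s t 0.
Proof. by move=> x; rewrite mul0r mulr0. Qed.

Lemma homD s t S T : Hom s t S -> Hom s t T -> Hom s t (S + T).
Proof. by move=> hS hT x; rewrite mulrDl hS hT mulrDr. Qed.

Lemma hom_sum s t (K : eqType) (r : seq K) (P : pred K) (f : K -> M) :
  (forall i, i \in r -> P i -> Hom s t (f i)) -> Hom s t (\sum_(i <- r | P i) f i).
Proof.
by move=> h; rewrite big_seq_cond; apply: (big_ind (Hom s t)) => [|S T|i /andP[? ?]];
  [exact: hom0|exact: homD|exact: h].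
Qed.

Lemma hom_endo s t t' T : star_endo star s -> Hom t t' T -> Hom (s \o t) (s \o t') (s T).
Proof. by move=> hs hT x /=; rewrite -(endo_mul hs) hT (endo_mul hs). Qed.

Lemma hom_ten s s' t t' S T : star_endo star s -> Hom s s' S -> Hom t t' T ->
  Hom (s \o t) (s' \o t') (S * s T).
Proof. by move=> hs hS hT x /=; rewrite -mulrA -(endo_mul hs) hT !mulrA -hS -!mulrA (endo_mul hs). Qed.

End Intertwiners.

Section FusionBasis.
Variables (R : realType) (M : algType R[i]) (star : M -> M) (I : finType).
Local Notation Hom := (@intertwiner R M).
Implicit Types (s t : M -> M) (x y S T A B : M) (i j k l m q : I).

(* The simple objects [X i] contained in [s] span it. *)
Definition spanned (X : I -> M -> M) s : Prop :=
  exists2 bs : seq (I * M), forall b, b \in bs -> Hom (X b.1) s b.2 &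
    \sum_(b <- bs) b.2 * star b.2 = 1.

(* A multiplicity-free semisimple category: [V i j k : X k -> X i X j] is an isometry
   when [N i j k], and zero otherwise; [Phi i j l m k q] is the coefficient of the
   basis vector through [X k] of [X m -> X i X j X l] in the one through [X q]. *)
Record fusion_basis (C : (M -> M) -> Prop) (X : I -> M -> M) (one : I)
    (N : I -> I -> I -> bool) (V : I -> I -> I -> M)
    (Phi : I -> I -> I -> I -> I -> I -> R[i]) : Prop := {
  fb_star : star_algebra star;
  fb_endo : forall i, star_endo star (X i);
  fb_schur : forall i j T, Hom (X i) (X j) T ->
    exists2 c : R[i], T = c *: 1 & (i != j -> c = 0);
  fb_one : X one = id;
  fb_hom : forall i j k, Hom (X k) (X i \o X j) (V i j k);
  fb_V0 : forall i j k, ~~ N i j k -> V i j k = 0;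
  fb_iso : forall i j k, N i j k -> star (V i j k) * V i j k = 1;
  fb_sum : forall i j, \sum_k V i j k * star (V i j k) = 1;
  fb_one_l : forall i k, V one i k = (k == i)%:R;
  fb_one_r : forall i k, V i one k = (k == i)%:R;
  fb_C : forall s, C s <-> star_endo star s /\ spanned X s;
  fb_assoc : forall i j l m q,
    X i (V j l q) * V i q m = \sum_k Phi i j l m k q *: (V i j k * V k l m) }.

Variables (C : (M -> M) -> Prop) (X : I -> M -> M) (one : I) (N : I -> I -> I -> bool)
  (V : I -> I -> I -> M) (Phi : I -> I -> I -> I -> I -> I -> R[i]).
Hypothesis fb : fusion_basis C X one N V Phi.
Let sa := fb_star fb.
Let Xe := fb_endo fb.

Lemma obj_endo s : C s -> star_endo star s. Proof. by move/(fb_C fb)=> []. Qed.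
Lemma obj_span s : C s -> spanned X s. Proof. by move/(fb_C fb)=> []. Qed.

Lemma one_neq0 : (1 : M) != 0.
Proof. exact: oner_neq0. Qed.

Lemma simple_obj i : C (X i).
Proof.
apply/(fb_C fb); split; first exact: Xe.
exists [:: (i, 1)] => [b|]; first by rewrite inE => /eqP-> /=; exact: hom1.
by rewrite big_seq1 /= (star1 sa) mulr1.
Qed.

Lemma unit_obj : C id.
Proof. by rewrite -(fb_one fb); exact: simple_obj. Qed.

(* Schur's lemma: a family indexed by the simple objects commutes with their intertwiners. *)
Lemma schur_move (f : I -> M) i j T : Hom (X i) (X j) T -> f j * T = T * f i.
Proof.
move=> /(fb_schur fb)[c -> ij]; case: (eqVneq i j) ij => [->|_ ->] //.
  by rewrite -scalerAl -scalerAr mul1r mulr1.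
by rewrite scale0r mul0r mulr0.
Qed.

Lemma schur_move2 (f : I -> M) i j k l T : Hom (X i) (X j) T ->
  f j * X k T = X l T * f i.
Proof.
move=> /(fb_schur fb)[c -> ij]; rewrite !(endoZ (Xe _)) !(endo_1 (Xe _)).
case: (eqVneq i j) ij => [->|_ ->] //.
  by rewrite -scalerAl -scalerAr mul1r mulr1.
by rewrite !scale0r mul0r mulr0.
Qed.

Lemma V_orth i j k l : star (V i j k) * V i j l = ((k == l) && N i j k)%:R.
Proof.
have h : Hom (X l) (X k) (star (V i j k) * V i j l).
  apply: homM (fb_hom fb i j l).
  by apply: homV; [exact: sa|exact: Xe|exact: endo_comp (Xe _) (Xe _)|exact: (fb_hom fb)].
case: eqVneq => [kl|kl] /=.
  rewrite -kl; case: (boolP (N i j k)) => [/(fb_iso fb)|/(fb_V0 fb)] -> //.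
  by rewrite mulr0.
case: (fb_schur fb h) => c -> ->; first by rewrite scale0r.
by rewrite eq_sym.
Qed.

Lemma hom_V i j k T : Hom (X k) (X i \o X j) T -> exists c, T = c *: V i j k.
Proof.
move=> hT; have h l : exists2 c : R[i], star (V i j l) * T = c *: 1 & (k != l -> c = 0).
  apply: (fb_schur fb); apply: homM hT.
  by apply: homV; [exact: sa|exact: Xe|exact: endo_comp (Xe _) (Xe _)|exact: (fb_hom fb)].
have [c ck _] := h k; exists c.
rewrite -[LHS]mul1r -(fb_sum fb i j) mulr_suml (bigD1 k) //= big1 ?addr0 => [|l lk].
  by rewrite -mulrA ck -scalerAr mulr1.
have [d e d0] := h l; rewrite -mulrA e d0; last by rewrite eq_sym.
by rewrite scale0r mulr0.
Qed.

(** The spanning intertwiners satisfy Σ b b^* = 1, so an identity in the algebra can be tested on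
    morphisms from simple objects. Most identities below are proved in this way. *)
Lemma span_ext (f : M -> M) s P Q : star_endo star f -> C s ->
  (forall i A, Hom (X i) s A -> P * f A = Q * f A) -> P = Q.
Proof.
move=> hf /obj_span[bs hb b1] h.
rewrite -[P]mulr1 -[Q]mulr1 -(endo_1 hf) -b1 (endo_sum hf) !mulr_sumr.
rewrite big_seq [RHS]big_seq; apply: eq_bigr => b /hb/h e.
by rewrite (endo_mul hf) !mulrA e.
Qed.

Lemma V_ext (f : M -> M) i j P Q : star_endo star f ->
  (forall k, N i j k -> P * f (V i j k) = Q * f (V i j k)) -> P = Q.
Proof.
move=> hf h; rewrite -[P]mulr1 -[Q]mulr1 -(endo_1 hf) -(fb_sum fb i j) (endo_sum hf) !mulr_sumr.
apply: eq_bigr => k _; rewrite (endo_mul hf) !mulrA.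
case: (boolP (N i j k)) => [/h -> //|/(fb_V0 fb) ->].
by rewrite (endo0 hf) !mulr0 !mul0r.
Qed.

Lemma hom_comp i j k s t A B : star_endo star s -> Hom (X i) s A -> Hom (X j) t B ->
  Hom (X k) (s \o t) (A * X i B * V i j k).
Proof. by move=> hs hA hB; apply: homM (fb_hom fb i j k); exact: hom_ten (Xe i) hA hB. Qed.

Lemma comp_obj s t : C s -> C t -> C (s \o t).
Proof.
move=> hs ht; apply/(fb_C fb); split; first exact: endo_comp (obj_endo hs) (obj_endo ht).
have [bs hb b1] := obj_span hs; have [bt hb' b1'] := obj_span ht.
pose g (b : I * M) := [seq (k, b.2 * X b.1 b'.2 * V b.1 b'.1 k) | b' <- bt, k <- enum I].
exists (flatten [seq g b | b <- bs]).
  move=> _ /flattenP[_ /mapP[b bi ->] /allpairsP[[b' k] [b'i _ ->]]] /=.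
  by apply: hom_comp; [exact: obj_endo|exact: hb|exact: hb'].
rewrite big_flatten big_map -[RHS]b1; apply: eq_bigr => b _.
rewrite big_allpairs_dep /= -[X in _ = X * _](mulr1 b.2) -(endo_1 (Xe b.1)) -b1' (endo_sum (Xe _)).
rewrite mulr_sumr mulr_suml; apply: eq_bigr => b' _.
rewrite big_enum /= (endo_mul (Xe _)) mulrA.
rewrite -[in RHS](mulr1 (b.2 * X b.1 b'.2)) -(fb_sum fb b.1 b'.1) mulr_sumr !mulr_suml.
apply: eq_bigr => k _.
by rewrite !(starM sa) -(endo_star (Xe _)) !mulrA.
Qed.

End FusionBasis.

(** * Auto-equivalences from symmetries of the associator *)

(** The combinatorial form of an auto-equivalence: c rescales the channel k of X_i X_j, and
    [sy_assoc] says that the permuted and rescaled basis has the original associator. [sy_unit]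
    makes the tensor structure unitary. *)
Record associator_symmetry (R : realType) (I : finType) (one : I) (N : I -> I -> I -> bool)
    (Phi : I -> I -> I -> I -> I -> I -> R[i]) (pi : {perm I}) (c : I -> I -> I -> R[i]) : Prop := {
  sy_N : forall i j k, N (pi i) (pi j) (pi k) = N i j k;
  sy_one : pi one = one;
  sy_unit : forall i j k, c i j k * (c i j k)^* = 1;
  sy_one_l : forall i, c one i i = 1;
  sy_one_r : forall i, c i one i = 1;
  sy_assoc : forall i j l m k q, N i j k -> N k l m -> N j l q -> N i q m ->
    c i j k * c k l m * Phi (pi i) (pi j) (pi l) (pi m) (pi k) (pi q) =
    c j l q * c i q m * Phi i j l m k q }.

Section Transport.
Variables (R : realType) (M : algType R[i]) (star : M -> M) (I : finType).
Local Notation Hom := (@intertwiner R M).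
Implicit Types (s t : M -> M) (x y S T A B : M) (i j k l m q : I).
Variables (C : (M -> M) -> Prop) (X : I -> M -> M) (one : I) (N : I -> I -> I -> bool)
  (V : I -> I -> I -> M) (Phi : I -> I -> I -> I -> I -> I -> R[i]).
Hypothesis fb : fusion_basis star C X one N V Phi.
Let sa := fb_star fb.
Let Xe := fb_endo fb.
Let XM i := endo_mul (Xe i).

Definition spanning_seq s : seq (I * M) :=
  if pselect (spanned star X s) is left h then s2val (cid2 h) else [::].

Lemma spanning_seqP s : C s ->
  (forall b, b \in spanning_seq s -> Hom (X b.1) s b.2) /\
  \sum_(b <- spanning_seq s) b.2 * star b.2 = 1.
Proof.
move=> /(obj_span fb) hs; rewrite /spanning_seq; case: pselect => // h.
by case: cid2 => bs.
Qed.

Lemma spanning_seq_hom s b : C s -> b \in spanning_seq s -> Hom (X b.1) s b.2.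
Proof. by move=> /spanning_seqP[h _]; exact: h. Qed.

Lemma spanning_seq_sum s P : C s -> \sum_(b <- spanning_seq s) b.2 * star b.2 * P = P.
Proof. by move=> /spanning_seqP[_ h]; rewrite -mulr_suml h mul1r. Qed.

Lemma star_hom i s A : C s -> Hom (X i) s A -> Hom s (X i) (star A).
Proof. by move=> hs hA; apply: homV hA; [exact: sa|exact: Xe|exact: (obj_endo fb hs)]. Qed.

Lemma spanning_seq_schur s b i A : C s -> b \in spanning_seq s -> Hom (X i) s A ->
  Hom (X i) (X b.1) (star b.2 * A).
Proof.
by move=> hs hb hA; apply: homM hA; apply: star_hom => //; exact: spanning_seq_hom.
Qed.

(* Replaces the simple summand [X i] of [s] by [X (f i)]. *)
Definition transport (f : I -> I) s x : M :=
  \sum_(b <- spanning_seq s) b.2 * X (f b.1) x * star b.2.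

(** By Schur's lemma b^* A is a scalar between equal simple objects, or zero, so it moves past
    X_{f(i)}(x). The relation characterizes [transport] independently of the chosen spanning
    family. *)
Lemma transportE f s i A x : C s -> Hom (X i) s A ->
  transport f s x * A = A * X (f i) x.
Proof.
move=> hs hA; rewrite /transport mulr_suml -[RHS](spanning_seq_sum _ hs).
rewrite big_seq [RHS]big_seq; apply: eq_bigr => b hb.
rewrite -!mulrA; congr (_ * _).
rewrite (schur_move fb (fun k => X (f k) x) (spanning_seq_schur hs hb hA)).
by rewrite mulrA.
Qed.

Lemma transport_hom f s i A : C s -> Hom (X i) s A -> Hom (X (f i)) (transport f s) A.
Proof. by move=> hs hA x; rewrite (transportE f x hs hA). Qed.

Lemma transport_endo f s : C s -> star_endo star (transport f s).
Proof.
move=> hs; have ext := span_ext fb (endo_id star) hs.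
split.
- move=> a x y; rewrite /transport scaler_sumr -big_split /=; apply: eq_bigr => b _.
  by rewrite (endoD (Xe _)) (endoZ (Xe _)) mulrDr mulrDl -scalerAr -scalerAl.
- by apply: ext => i A hA; rewrite (transportE _ _ hs hA) (endo_1 (Xe _)) mulr1 mul1r.
- move=> x y; apply: ext => i A hA; rewrite (transportE _ _ hs hA) XM mulrA.
  by rewrite -(transportE f x hs hA) -!mulrA (transportE f y hs hA).
move=> x; rewrite /transport (star_sum sa); apply: eq_bigr => b _.
by rewrite !(starM sa) (starK sa) (endo_star (Xe _)) mulrA.
Qed.

Lemma transport_obj f s : C s -> C (transport f s).
Proof.
move=> hs; apply/(fb_C fb); split; first exact: transport_endo.
exists [seq (f b.1, b.2) | b <- spanning_seq s].
  by move=> _ /mapP[b hb ->] /=; apply: transport_hom => //; exact: spanning_seq_hom.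
by rewrite big_map /=; case: (spanning_seqP hs).
Qed.

Lemma transport_intertwiner f s t T : C s -> C t -> Hom s t T ->
  Hom (transport f s) (transport f t) T.
Proof.
move=> hs ht hT x; apply: (span_ext fb (endo_id star) hs) => i A hA.
rewrite -mulrA (transportE f x hs hA) mulrA -mulrA -[RHS]mulrA.
by rewrite (transportE f x ht (homM hT hA)) mulrA.
Qed.

Lemma transport_simple f i : transport f (X i) = X (f i).
Proof.
apply/funext => x; have := transportE f x (simple_obj fb i) (hom1 (X i)).
by rewrite mulr1 mul1r.
Qed.

Lemma transportK f g s : cancel f g -> C s -> transport g (transport f s) = s.
Proof.
move=> fg hs; apply/funext => x; apply: (span_ext fb (endo_id star) hs) => i A hA.
rewrite (transportE g x (transport_obj f hs) (transport_hom f hs hA)) fg.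
by rewrite (hA x).
Qed.

(** Extends a family [w] on pairs of simple objects to all pairs. Two relabellings are kept because
    the star exchanges them ([ten_transport_star]); unitarity is then an instance of
    [ten_transport_comp]. *)
Definition ten_transport (f g : I -> I) (w : I -> I -> M) s t : M :=
  \sum_(a <- spanning_seq s) \sum_(b <- spanning_seq t)
    a.2 * X (f a.1) b.2 * w a.1 b.1 * X (g a.1) (star b.2) * star a.2.

Lemma ten_transportE f g w s t i j A B : C s -> C t -> Hom (X i) s A -> Hom (X j) t B ->
  ten_transport f g w s t * A * X (g i) B = A * X (f i) B * w i j.
Proof.
move=> hs ht hA hB; rewrite /ten_transport !mulr_suml.
transitivity (\sum_(a <- spanning_seq s) a.2 * star a.2 * (A * X (f i) B * w i j)); last first.
  exact: spanning_seq_sum.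
rewrite big_seq [RHS]big_seq; apply: eq_bigr => a ha.
have hT := spanning_seq_schur hs ha hA.
transitivity (\sum_(b <- spanning_seq t)
   a.2 * (star a.2 * A) * X (f i) (b.2 * star b.2 * B) * w i j); last first.
  rewrite -!mulr_suml -mulr_sumr -(endo_sum (Xe _)) (spanning_seq_sum _ ht) !mulrA.
  by [].
rewrite !mulr_suml big_seq [RHS]big_seq; apply: eq_bigr => b hb.
have hS := spanning_seq_schur ht hb hB.
have e := schur_move fb (fun k => X (f k) b.2 * w k b.1 * X (g k) (star b.2)) hT.
rewrite /= in e.
transitivity (a.2 * (X (f a.1) b.2 * w a.1 b.1 * X (g a.1) (star b.2) * (star a.2 * A)) * X (g i) B).
  by rewrite !mulrA.
rewrite e -!mulrA; congr (_ * (_ * (_ * _))).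
rewrite -(XM (g i)) (schur_move2 fb (w i) (g i) (f i) hS) [LHS]mulrA.
by rewrite -(XM (f i)) mulrA.
Qed.

Lemma ten_transport_star f g w s t :
  star (ten_transport f g w s t) = ten_transport g f (fun i j => star (w i j)) s t.
Proof.
rewrite /ten_transport (star_sum sa); apply: eq_bigr => a _.
rewrite (star_sum sa); apply: eq_bigr => b _.
by rewrite !(starM sa) -!(endo_star (Xe _)) !(starK sa) !mulrA.
Qed.

Lemma ten_span_ext g s t P Q : C s -> C t ->
  (forall i j A B, Hom (X i) s A -> Hom (X j) t B -> P * A * X (g i) B = Q * A * X (g i) B) ->
  P = Q.
Proof.
move=> hs ht h; apply: (span_ext fb (endo_id star) hs) => i A hA.
by apply: (span_ext fb (Xe (g i)) ht) => j B hB; exact: h.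
Qed.

Lemma ten_transport_comp f g h w w' s t : C s -> C t ->
  ten_transport f g w s t * ten_transport g h w' s t =
  ten_transport f h (fun i j => w i j * w' i j) s t.
Proof.
move=> hs ht; apply: (ten_span_ext (g := h) hs ht) => i j A B hA hB.
rewrite (ten_transportE _ _ _ hs ht hA hB).
transitivity (ten_transport f g w s t * (ten_transport g h w' s t * A * X (h i) B)).
  by rewrite !mulrA.
rewrite (ten_transportE _ _ _ hs ht hA hB) mulrA mulrA (ten_transportE _ _ _ hs ht hA hB).
by rewrite mulrA.
Qed.

Lemma ten_transport1 f w s t : C s -> C t -> (forall i j, w i j = 1) ->
  ten_transport f f w s t = 1.
Proof.
move=> hs ht w1; apply: (ten_span_ext (g := f) hs ht) => i j A B hA hB.
by rewrite (ten_transportE _ _ _ hs ht hA hB) w1 mulr1 mul1r.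
Qed.

Section Symmetry.
Variables (pi : {perm I}) (c : I -> I -> I -> R[i]).
Hypothesis sy : associator_symmetry one N Phi pi c.

Definition ten_simple i j : M :=
  \sum_k c i j k *: (V i j k * star (V (pi i) (pi j) (pi k))).

Lemma ten_simple_V i j k : N i j k ->
  ten_simple i j * V (pi i) (pi j) (pi k) = c i j k *: V i j k.
Proof.
move=> nk; rewrite /ten_simple mulr_suml (bigD1 k) //= big1 ?addr0 => [|q qk].
  by rewrite -scalerAl -mulrA (V_orth fb) eqxx (sy_N sy) nk mulr1.
by rewrite -scalerAl -mulrA (V_orth fb) (inj_eq perm_inj) (negPf qk) mulr0 scaler0.
Qed.

Lemma star_ten_simple_V i j k : N i j k ->
  star (ten_simple i j) * V i j k = (c i j k)^* *: V (pi i) (pi j) (pi k).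
Proof.
move=> nk; rewrite /ten_simple (star_sum sa) mulr_suml (bigD1 k) //= big1 ?addr0 => [|q qk].
  by rewrite (starZ sa) -scalerAl (starM sa) (starK sa) -mulrA (V_orth fb) eqxx nk mulr1.
by rewrite (starZ sa) -scalerAl (starM sa) (starK sa) -mulrA (V_orth fb) (negPf qk) mulr0 scaler0.
Qed.

Lemma pi_V_ext (f : M -> M) i j P Q : star_endo star f ->
  (forall k, N i j k -> P * f (V (pi i) (pi j) (pi k)) = Q * f (V (pi i) (pi j) (pi k))) ->
  P = Q.
Proof.
move=> hf h; apply: (V_ext fb (i := pi i) (j := pi j) hf) => k.
by rewrite -[k](permKV pi) (sy_N sy); exact: h.
Qed.

Lemma ten_simple_unitary i j : unitary star (ten_simple i j).
Proof.
split.
  apply: (pi_V_ext (i := i) (j := j) (endo_id star)) => k nk.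
  rewrite -mulrA ten_simple_V // -scalerAr star_ten_simple_V // scalerA (sy_unit sy).
  by rewrite scale1r mul1r.
apply: (V_ext fb (i := i) (j := j) (endo_id star)) => k nk.
rewrite -mulrA star_ten_simple_V // -scalerAr ten_simple_V // scalerA mulrC (sy_unit sy).
by rewrite scale1r mul1r.
Qed.

(** Morphisms are left unchanged: by [transport_intertwiner], an intertwiner from s to t remains one
    between the relabelled objects. All information is in the objects and the tensor structure. *)
Definition symmetry_functor : monoidal_data M :=
  MonoidalData (FunctorData (transport pi) (fun _ _ T => T))
    (ten_transport id pi ten_simple) 1.
Local Notation F := symmetry_functor.
Local Notation ten := (ten_transport id pi ten_simple).

Lemma symmetry_is_functor (p : {perm I}) :
  is_functor C (FunctorData (transport p) (fun _ _ T => T)).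
Proof.
split => //=.
- by move=> s; exact: transport_obj.
- by move=> s t T; exact: transport_intertwiner.
Qed.

Lemma ten_unitary s t : C s -> C t -> unitary star (ten s t).
Proof.
move=> hs ht; split; rewrite ten_transport_star ten_transport_comp // ten_transport1 // => i j;
  by case: (ten_simple_unitary i j).
Qed.

Lemma star_V_hom i j k x :
  star (V i j k) * X i (X j x) = X k x * star (V i j k).
Proof.
have h : Hom (X i \o X j) (X k) (star (V i j k)).
  apply: homV (fb_hom fb i j k); [exact: sa|exact: Xe|].
  exact: (endo_comp (Xe i) (Xe j)).
exact: h.
Qed.

Lemma ten_simple_expand P (f : M -> M) i j Q : star_endo star f ->
  P * f (ten_simple i j) * Q =
  \sum_k c i j k *: (P * f (V i j k) * f (star (V (pi i) (pi j) (pi k))) * Q).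
Proof.
move=> hf; rewrite /ten_simple (endo_sum hf) mulr_sumr mulr_suml; apply: eq_bigr => k _.
by rewrite (endoZ hf) (endo_mul hf) -scalerAr -scalerAl !mulrA.
Qed.

Lemma transport_ten_simple s t i j A B x : C s -> C t -> Hom (X i) s A -> Hom (X j) t B ->
  transport pi (s \o t) x * (A * X i B * ten_simple i j) =
  A * X i B * ten_simple i j * X (pi i) (X (pi j) x).
Proof.
move=> hs ht hA hB; have hst := comp_obj fb hs ht.
rewrite -[LHS]mulr1 mulrA (ten_simple_expand _ _ _ _ (endo_id star)).
rewrite (ten_simple_expand _ _ _ _ (endo_id star)); apply: eq_bigr => k _.
congr (_ *: _); rewrite mulr1.
have hV := hom_comp fb k (obj_endo fb hs) hA hB.
transitivity (transport pi (s \o t) x * (A * X i B * V i j k) *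
  star (V (pi i) (pi j) (pi k))); first by rewrite !mulrA.
rewrite (transportE pi x hst hV) -[RHS]mulrA star_V_hom.
by rewrite !mulrA.
Qed.

Lemma ten_hom s t : C s -> C t ->
  Hom (transport pi s \o transport pi t) (transport pi (s \o t)) (ten s t).
Proof.
move=> hs ht x; apply: (ten_span_ext (g := pi) hs ht) => i j A B hA hB /=.
have tE := ten_transportE id pi ten_simple hs ht hA hB.
transitivity (ten s t * (transport pi s (transport pi t x) * A) * X (pi i) B).
  by rewrite !mulrA.
rewrite (transportE pi _ hs hA).
transitivity (ten s t * A * X (pi i) (transport pi t x * B)).
  by rewrite (XM (pi i)) !mulrA.
rewrite (transportE pi _ ht hB) (XM (pi i)) mulrA tE.
rewrite -(transport_ten_simple x hs ht hA hB) -tE.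
by rewrite !mulrA.
Qed.

Lemma ten_natural s s' t t' S T : C s -> C s' -> C t -> C t' -> Hom s s' S -> Hom t t' T ->
  S * s T * ten s t = ten s' t' * (S * transport pi s T).
Proof.
move=> hs hs' ht ht' hS hT; apply: (ten_span_ext (g := pi) hs ht) => i j A B hA hB.
have tE := ten_transportE id pi ten_simple hs ht hA hB.
have tE' := ten_transportE id pi ten_simple hs' ht' (homM hS hA) (homM hT hB).
transitivity (S * s T * (ten s t * A * X (pi i) B)); first by rewrite !mulrA.
rewrite tE; transitivity (S * (s T * A) * X i B * ten_simple i j); first by rewrite !mulrA.
rewrite -(hA T); transitivity (S * A * X i (T * B) * ten_simple i j).
  by rewrite (XM i) !mulrA.
rewrite -tE'; transitivity (ten s' t' * S * (A * X (pi i) T) * X (pi i) B).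
  by rewrite (XM (pi i)) !mulrA.
by rewrite -(transportE pi T hs hA) !mulrA.
Qed.

Lemma V_assoc_coef i j l m k q : N i j k ->
  star (V i j k) * (X i (V j l q) * V i q m) = Phi i j l m k q *: V k l m.
Proof.
move=> nk; rewrite (fb_assoc fb) mulr_sumr (bigD1 k) //= big1 ?addr0 => [|r rk].
  by rewrite -scalerAr mulrA (V_orth fb) eqxx nk mul1r.
by rewrite -scalerAr mulrA (V_orth fb) eq_sym (negPf rk) mul0r scaler0.
Qed.

(** Both sides are compared on the basis paths X_{πi}(V(πj,πl,πq)) V(πi,πq,πm), where equality of
    the coefficients is [sy_assoc]. *)
Lemma ten_simple_assoc i j l :
  \sum_k c i j k *: (V i j k * ten_simple k l * star (V (pi i) (pi j) (pi k))) =
  \sum_q c j l q *: (X i (V j l q) * ten_simple i q * X (pi i) (star (V (pi j) (pi l) (pi q)))).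
Proof.
apply: (pi_V_ext (i := j) (j := l) (Xe (pi i))) => q nq.
apply: (pi_V_ext (i := i) (j := q) (endo_id star)) => m nm.
have Xorth k : X (pi i) (star (V (pi j) (pi l) (pi k))) * X (pi i) (V (pi j) (pi l) (pi q)) =
    (k == q)%:R.
  rewrite -(XM (pi i)) (V_orth fb) (inj_eq perm_inj) (sy_N sy).
  case: eqVneq => [->|_]; rewrite /= ?nq; [exact: (endo_1 (Xe _))|exact: (endo0 (Xe _))].
transitivity (c j l q * c i q m *: (X i (V j l q) * V i q m)); last first.
  rewrite mulr_suml mulr_suml (bigD1 q) //= big1 ?addr0 => [|k kq].
    rewrite -!scalerAl -[_ * X (pi i) (star _) * X (pi i) _]mulrA Xorth eqxx mulr1 -mulrA ten_simple_V //.
    by rewrite -scalerAr scalerA.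
  rewrite -!scalerAl -[_ * X (pi i) (star _) * X (pi i) _]mulrA Xorth (negPf kq).
  by rewrite mulr0 mul0r scaler0.
rewrite mulr_suml mulr_suml (fb_assoc fb) scaler_sumr; apply: eq_bigr => k _.
case: (boolP (N i j k)) => [nk|/(fb_V0 fb) ->]; last by rewrite !mul0r !scaler0 !mul0r.
transitivity (c i j k *: (V i j k * ten_simple k l * (star (V (pi i) (pi j) (pi k)) *
    (X (pi i) (V (pi j) (pi l) (pi q)) * V (pi i) (pi q) (pi m))))).
  by rewrite -!scalerAl !mulrA.
rewrite V_assoc_coef ?(sy_N sy) // -scalerAr -mulrA.
case: (boolP (N k l m)) => [nklm|nklm].
  rewrite ten_simple_V // -scalerAr !scalerA -(sy_assoc sy nk nklm nq nm).
  by rewrite mulrA mulrAC.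
have -> : V k l m = 0 by exact: (fb_V0 fb).
have -> : V (pi k) (pi l) (pi m) = 0 by apply: (fb_V0 fb); rewrite (sy_N sy).
by rewrite !mulr0 !scaler0.
Qed.

Lemma ten_assoc s t u : C s -> C t -> C u ->
  ten (s \o t) u * ten s t = ten s (t \o u) * transport pi s (ten t u).
Proof.
move=> hs ht hu; have hst := comp_obj fb hs ht; have htu := comp_obj fb ht hu.
apply: (ten_span_ext (g := pi) hs ht) => i j A B hA hB.
apply: (span_ext fb (f := X (pi i) \o X (pi j)) _ hu) => [|l D hD /=].
  exact: (endo_comp (Xe _) (Xe _)).
transitivity (A * X i B * X i (X j D) *
   \sum_k c i j k *: (V i j k * ten_simple k l * star (V (pi i) (pi j) (pi k)))).
  have tE := ten_transportE id pi ten_simple hs ht hA hB.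
  transitivity (ten (s \o t) u * (ten s t * A * X (pi i) B) * X (pi i) (X (pi j) D)).
    by rewrite !mulrA.
  rewrite tE mulrA (ten_simple_expand _ _ _ _ (endo_id star)) mulr_sumr; apply: eq_bigr => k _.
  rewrite -[RHS]scalerAr; congr (_ *: _).
  have hV := hom_comp fb k (obj_endo fb hs) hA hB.
  have tE' := ten_transportE id pi ten_simple hst hu hV hD.
  transitivity (ten (s \o t) u * (A * X i B * V i j k) *
     (star (V (pi i) (pi j) (pi k)) * X (pi i) (X (pi j) D))); first by rewrite !mulrA.
  rewrite star_V_hom mulrA tE'.
  transitivity (A * X i B * (V i j k * X k D) * ten_simple k l * star (V (pi i) (pi j) (pi k))).
    by rewrite !mulrA.
  by rewrite (fb_hom fb i j k D) /= !mulrA.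
rewrite ten_simple_assoc.
have tE := ten_transportE id pi ten_simple ht hu hB hD.
transitivity (ten s (t \o u) * (transport pi s (ten t u) * A) * X (pi i) (B * X (pi j) D)); last first.
  by rewrite (XM (pi i)) !mulrA.
rewrite (transportE pi _ hs hA).
transitivity (ten s (t \o u) * A * X (pi i) (ten t u * B * X (pi j) D)); last first.
  by rewrite !(XM (pi i)) !mulrA.
rewrite tE.
transitivity (ten s (t \o u) * A * X (pi i) (B * X j D) * X (pi i) (ten_simple j l) * 1); last first.
  by rewrite (XM (pi i) (B * _)) mulr1 mulrA.
rewrite (ten_simple_expand _ _ _ _ (Xe (pi i))) mulr_sumr.
apply: eq_bigr => q _; rewrite -[LHS]scalerAr mulr1; congr (_ *: _).
have hV := hom_comp fb q (obj_endo fb ht) hB hD.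
have tE' := ten_transportE id pi ten_simple hs htu hA hV.
transitivity (ten s (t \o u) * A * X (pi i) (B * X j D * V j l q) *
  X (pi i) (star (V (pi j) (pi l) (pi q)))); last by rewrite (XM (pi i)) !mulrA.
by rewrite tE' !(XM i) !mulrA.
Qed.

Lemma ten_simple_one_l j : ten_simple one j = 1.
Proof.
rewrite /ten_simple (bigD1 j) //= big1 ?addr0 => [|k kj].
  by rewrite (sy_one sy) !(fb_one_l fb) !eqxx (sy_one_l sy) (star1 sa) mulr1 scale1r.
by rewrite (fb_one_l fb) (negPf kj) mul0r scaler0.
Qed.

Lemma ten_simple_one_r j : ten_simple j one = 1.
Proof.
rewrite /ten_simple (bigD1 j) //= big1 ?addr0 => [|k kj].
  by rewrite (sy_one sy) !(fb_one_r fb) !eqxx (sy_one_r sy) (star1 sa) mulr1 scale1r.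
by rewrite (fb_one_r fb) (negPf kj) mul0r scaler0.
Qed.

Lemma hom_one_id : Hom (X one) id 1.
Proof. by rewrite (fb_one fb); exact: hom1. Qed.

Lemma ten_unit_l s : C s -> ten id s = 1.
Proof.
move=> hs; apply: (span_ext fb (Xe (pi one)) hs) => j B hB.
have := ten_transportE id pi ten_simple (unit_obj fb) hs hom_one_id hB.
by rewrite ten_simple_one_l !mulr1 !mul1r /= (sy_one sy).
Qed.

Lemma ten_unit_r s : C s -> ten s id = 1.
Proof.
move=> hs; apply: (span_ext fb (endo_id star) hs) => i A hA.
have := ten_transportE id pi ten_simple hs (unit_obj fb) hA hom_one_id.
by rewrite ten_simple_one_r !(endo_1 (Xe _)) !mulr1 mul1r.
Qed.

Lemma symmetry_functor_monoidal : star_monoidal_functor star C F.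
Proof.
have Fid : transport pi id = id by rewrite -[in LHS](fb_one fb) transport_simple (sy_one sy) (fb_one fb).
split => //=.
- exact: symmetry_is_functor.
- exact: ten_unitary.
- exact: ten_hom.
- by move=> s s' t t' S T *; exact: ten_natural.
- exact: ten_assoc.
- exact: unitary1.
- by rewrite Fid; exact: hom1.
- by move=> s hs; rewrite ten_unit_l // mulr1.
- by move=> s hs; rewrite ten_unit_r // (endo_1 (transport_endo pi hs)) mulr1.
Qed.

Lemma symmetry_functor_autoequivalence : star_monoidal_autoequivalence star C F.
Proof.
split; first exact: symmetry_functor_monoidal.
split; first exact: symmetry_is_functor.
exists (FunctorData (transport (pi^-1)%g) (fun _ _ T => T)).
split; first exact: symmetry_is_functor.
  exists (fun=> 1); split => //= [s hs|s hs|s t T *].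
  - by rewrite (transportK (permK pi) hs); exact: hom1.
  - by exists 1; rewrite mulr1.
  - by rewrite mulr1 mul1r.
exists (fun=> 1); split => //= [s hs|s hs|s t T *].
- by rewrite (transportK (permKV pi) hs); exact: hom1.
- by exists 1; rewrite mulr1.
- by rewrite mulr1 mul1r.
Qed.

End Symmetry.
End Transport.

(** * The combinatorial data of an auto-equivalence *)

Section Skeleton.
Variables (R : realType) (M : algType R[i]) (star : M -> M) (I : finType).
Local Notation Hom := (@intertwiner R M).
Implicit Types (s t : M -> M) (x y S T A B : M) (i j k l m q : I).
Variables (C : (M -> M) -> Prop) (X : I -> M -> M) (one : I) (N : I -> I -> I -> bool)
  (V : I -> I -> I -> M) (Phi : I -> I -> I -> I -> I -> I -> R[i]).
Hypothesis fb : fusion_basis star C X one N V Phi.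
Let sa := fb_star fb.
Let Xe := fb_endo fb.

(* Up to the unitaries [v i], the functor [F] maps [X i] to [X (pi i)] and the basis
   isometries to multiples of basis isometries. *)
Record skeleton (F : monoidal_data M) (pi : {perm I}) (v : I -> M)
    (c : I -> I -> I -> R[i]) : Prop := {
  sk_hom : forall i, Hom (X (pi i)) (F (X i)) (v i);
  sk_unitary : forall i, unitary star (v i);
  sk_pi_one : pi one = one;
  sk_one : v one = munit F;
  sk_N : forall i j k, N i j k -> N (pi i) (pi j) (pi k);
  sk_c0 : forall i j k, N i j k -> c i j k != 0;
  sk_V : forall i j k, N i j k ->
    fhom F (X k) (X i \o X j) (V i j k) * v k =
    mten F (X i) (X j) * v i * X (pi i) (v j) * ((c i j k)^-1 *: V (pi i) (pi j) (pi k)) }.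

Section Functor.
Variable F : monoidal_data M.
Hypothesis hF : star_monoidal_functor star C F.
Let fF := mon_functor hF.

Lemma functor_endo s : C s -> star_endo star (F s).
Proof. by move=> /(fun_obj fF) /(obj_endo fb). Qed.

Lemma functor0 s t : C s -> C t -> fhom F s t 0 = 0.
Proof.
move=> hs ht; have := mon_linear hF (1 : R[i]) hs ht (hom0 s t) (hom0 s t).
rewrite scale1r addr0 scale1r => /eqP.
by rewrite -subr_eq0 opprD addNKr oppr_eq0 => /eqP.
Qed.

Lemma functorZ s t (a : R[i]) T : C s -> C t -> Hom s t T ->
  fhom F s t (a *: T) = a *: fhom F s t T.
Proof.
move=> hs ht hT; have := mon_linear hF a hs ht hT (hom0 s t).
by rewrite functor0 // !addr0.
Qed.

Lemma functorD s t S T : C s -> C t -> Hom s t S -> Hom s t T ->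
  fhom F s t (S + T) = fhom F s t S + fhom F s t T.
Proof.
move=> hs ht hS hT; have := mon_linear hF 1 hs ht hS hT.
by rewrite !scale1r.
Qed.

Lemma functor_sum s t (K : eqType) (r : seq K) (f : K -> M) : C s -> C t ->
  (forall b, b \in r -> Hom s t (f b)) ->
  fhom F s t (\sum_(b <- r) f b) = \sum_(b <- r) fhom F s t (f b).
Proof.
move=> hs ht; elim: r => [|a r IH] h; first by rewrite !big_nil functor0.
have h' : forall b, b \in r -> Hom s t (f b) by move=> b ir; apply: h; rewrite inE ir orbT.
rewrite !big_cons functorD // ?IH //; first by apply: h; rewrite inE eqxx.
by apply: hom_sum => b ir _; exact: h'.
Qed.

Lemma functor_span_sum s : C s ->
  \sum_(b <- spanning_seq star X s)
    fhom F (X b.1) s b.2 * star (fhom F (X b.1) s b.2) = 1.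
Proof.
move=> hs; have [hb b1] := spanning_seqP fb hs.
rewrite -(fun_id fF hs) -b1.
rewrite functor_sum // => [|b ib].
  rewrite big_seq [RHS]big_seq; apply: eq_bigr => b ib.
  have hA := hb b ib; have hX := simple_obj fb b.1.
  rewrite -(mon_star hF hX hs hA).
  by rewrite -(fun_comp fF hs hX hs hA (star_hom fb hs hA)).
by apply: homM (star_hom fb hs (hb b ib)); exact: hb.
Qed.

Lemma functor_span_ext (f : M -> M) s P Q : star_endo star f -> C s ->
  (forall i A, Hom (X i) s A -> P * f (fhom F (X i) s A) = Q * f (fhom F (X i) s A)) -> P = Q.
Proof.
move=> hf hs h; have [hb _] := spanning_seqP fb hs.
rewrite -[P]mulr1 -[Q]mulr1 -(endo_1 hf) -(functor_span_sum hs) (endo_sum hf) !mulr_sumr.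
rewrite big_seq [RHS]big_seq; apply: eq_bigr => b /hb/h e.
by rewrite (endo_mul hf) !mulrA e.
Qed.

(* F (A X_i(B)) as a morphism from [X i X j] to [s t]. *)
Lemma functor_ten s t i j A B : C s -> C t -> Hom (X i) s A -> Hom (X j) t B ->
  fhom F (X i \o X j) (s \o t) (A * X i B) * mten F (X i) (X j) =
  mten F s t * (fhom F (X i) s A * F (X i) (fhom F (X j) t B)).
Proof.
by move=> hs ht hA hB; apply: (mon_ten_natural hF) => //; exact: (simple_obj fb).
Qed.

Section WithSkeleton.
Variables (pi : {perm I}) (v : I -> M) (c : I -> I -> I -> R[i]).
Hypothesis sk : skeleton F pi v c.

Lemma skeleton_V_hom i j k y :
  V (pi i) (pi j) (pi k) * X (pi k) y = X (pi i) (X (pi j) y) * V (pi i) (pi j) (pi k).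
Proof. exact: (fb_hom fb). Qed.

(** Apply F to the associativity relation on X_i X_j X_l. The unitary [P] identifies X_{πi} X_{πj}
    X_{πl} with F(X_i X_j X_l), and coherence of the tensor structure makes the same [P] appear for
    both bracketings; after removing it, the coefficients at channel k are compared. *)
Lemma skeleton_symmetry i j l m k q : N i j k -> N k l m -> N j l q -> N i q m ->
  c i j k * c k l m * Phi (pi i) (pi j) (pi l) (pi m) (pi k) (pi q) =
  c j l q * c i q m * Phi i j l m k q.
Proof.
move=> nk nklm nq nm.
have CX p := simple_obj fb p.
have Cij := comp_obj fb (CX i) (CX j); have Cjl := comp_obj fb (CX j) (CX l).
have Cijl := comp_obj fb Cij (CX l).
have Xu p U : unitary star U -> unitary star (X p U) by apply: endo_unitary; exact: Xe.
pose P := mten F (X i \o X j) (X l) * mten F (X i) (X j) * v i * X (pi i) (v j) *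
  X (pi i) (X (pi j) (v l)).
have vu := sk_unitary sk.
have mU (a b : M) : unitary star a -> unitary star b -> unitary star (a * b) := @unitaryM _ _ _ sa a b.
have Pu : star P * P = 1.
  suff: unitary star P by case.
  apply: (mU _ _ (mU _ _ (mU _ _ (mU _ _ _ _) _) _) _) => //.
  - exact: (mon_ten_unitary hF).
  - exact: (mon_ten_unitary hF).
  - exact: Xu.
  - by do 2!apply: (Xu).
pose ci i j k := (c i j k)^-1.
have left p : N i j p -> N p l m ->
   fhom F (X m) (X i \o X j \o X l) (V i j p * V p l m) * v m =
   P * ((ci i j p * ci p l m) *: (V (pi i) (pi j) (pi p) * V (pi p) (pi l) (pi m))).
  move=> np npm; have Cpl := comp_obj fb (CX p) (CX l).
  have hV1 : Hom (X p \o X l) (X i \o X j \o X l) (V i j p).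
    by move=> x; exact: (fb_hom fb i j p (X l x)).
  have e := mon_ten_natural hF (CX p) Cij (CX l) (CX l) (fb_hom fb i j p) (hom1 (X l)).
  rewrite (endo_1 (Xe p)) mulr1 (fun_id fF (CX l)) (endo_1 (functor_endo (CX p))) mulr1 in e.
  rewrite (fun_comp fF (CX m) Cpl Cijl hV1 (fb_hom fb p l m)) -mulrA (sk_V sk npm) !mulrA.
  rewrite e -[mten F (X i \o X j) (X l) * _ * _]mulrA (sk_V sk np) /P.
  rewrite -!(scalerAl, scalerAr) scalerA mulrC; congr (_ *: _).
  rewrite !mulrA.
  congr (_ * _); rewrite -!mulrA; do 4!congr (_ * _).
  exact: skeleton_V_hom.
have right : fhom F (X m) (X i \o X j \o X l) (X i (V j l q) * V i q m) * v m =
   P * ((ci j l q * ci i q m) *: (X (pi i) (V (pi j) (pi l) (pi q)) * V (pi i) (pi q) (pi m))).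
  have Ciq := comp_obj fb (CX i) (CX q).
  have hV1 : Hom (X i \o X q) (X i \o X j \o X l) (X i (V j l q)).
    exact: (hom_endo (Xe i) (fb_hom fb j l q)).
  have e := mon_ten_natural hF (CX i) (CX i) (CX q) Cjl (hom1 (X i)) (fb_hom fb j l q).
  rewrite mul1r (fun_id fF (CX i)) mul1r in e.
  rewrite (fun_comp fF (CX m) Ciq Cijl hV1 (fb_hom fb i q m)) -mulrA (sk_V sk nm) !mulrA.
  have hv y : F (X i) y * v i = v i * X (pi i) y by rewrite (sk_hom sk).
  have FiM := endo_mul (functor_endo (CX i)); have XM := endo_mul (Xe (pi i)).
  transitivity (mten F (X i) (X j \o X l) * F (X i) (fhom F (X q) (X j \o X l) (V j l q)) *
      v i * X (pi i) (v q) * (ci i q m *: V (pi i) (pi q) (pi m))).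
    by congr (_ * _ * _ * _); exact: e.
  rewrite -[_ * F (X i) _ * v i]mulrA hv -!mulrA [X (pi i) _ * (X (pi i) _ * _)]mulrA -XM.
  rewrite (sk_V sk nq) !XM !mulrA -[_ * v i * X (pi i) (mten F (X j) (X l))]mulrA -hv.
  rewrite !mulrA -(mon_assoc hF (CX i) (CX j) (CX l)).
  rewrite (endoZ (Xe (pi i))) /P -!(scalerAl, scalerAr) scalerA mulrC; congr (_ *: _).
  by rewrite !mulrA.
clearbody P.
have eF : ci j l q * ci i q m *: (X (pi i) (V (pi j) (pi l) (pi q)) * V (pi i) (pi q) (pi m)) =
    \sum_(p | N i j p && N p l m) Phi i j l m p q *:
      (ci i j p * ci p l m *: (V (pi i) (pi j) (pi p) * V (pi p) (pi l) (pi m))).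
  rewrite -[LHS]mul1r -[RHS]mul1r -Pu -!mulrA -right; congr (_ * _).
  rewrite (fb_assoc fb) functor_sum => [||//|p _]; try exact: CX; last first.
    apply: homZ; apply: homM (fb_hom fb p l m) => x.
    exact: (fb_hom fb i j p (X l x)).
  rewrite mulr_suml mulr_sumr [RHS]big_mkcond /=; apply: eq_bigr => p _.
  have hp : Hom (X m) (X i \o X j \o X l) (V i j p * V p l m).
    by apply: homM (fb_hom fb p l m) => x; exact: (fb_hom fb i j p (X l x)).
  rewrite functorZ //; case: ifP => [/andP[np npm]|].
    by rewrite -scalerAl left // scalerAr.
  move/negbT; rewrite negb_and => /orP[]/(fb_V0 fb) ->.
    by rewrite mul0r functor0 // scaler0 mul0r.
  by rewrite mulr0 functor0 // scaler0 mul0r.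
have nk' := sk_N sk nk; have nklm' := sk_N sk nklm.
have := congr1 (fun T => star (V (pi k) (pi l) (pi m)) * (star (V (pi i) (pi j) (pi k)) * T)) eF.
rewrite -2!scalerAr (V_assoc_coef fb) // -scalerAr (fb_iso fb) // scalerA.
rewrite mulr_sumr mulr_sumr (bigD1 k) ?nk //= big1 ?addr0 => [|p /andP[_ pk]]; last first.
  by rewrite -4!scalerAr [star (V (pi i) _ _) * _]mulrA (V_orth fb) (inj_eq perm_inj) eq_sym (negPf pk) mul0r mulr0 !scaler0.
rewrite -4!scalerAr [star (V (pi i) _ _) * _]mulrA (fb_iso fb) // mul1r (fb_iso fb) // scalerA.
move/eqP; rewrite -subr_eq0 -scalerBl scaler_eq0 oner_eq0 orbF subr_eq0 => /eqP e.
have c0 := sk_c0 sk.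
rewrite /ci in e; apply: (mulfI (mulf_neq0 (invr_neq0 (c0 _ _ _ nq)) (invr_neq0 (c0 _ _ _ nm)))).
rewrite mulrCA e; field.
by rewrite !c0.
Qed.

End WithSkeleton.

Lemma hom_inv s t u w : Hom s t u -> w * u = 1 -> u * w = 1 -> Hom t s w.
Proof.
move=> hu wu uw x.
by rewrite -[LHS]mulr1 -{}uw !mulrA -[w * t x * u]mulrA -hu !mulrA wu mul1r.
Qed.

Section Equivalence.
Hypothesis eF : is_equivalence C F.

(** The preimage is F'(T) conjugated by the natural isomorphism [u]. By construction T and its
    proposed image agree after F', and naturality of [u'] removes F'. *)
Lemma functor_full s t T : C s -> C t -> Hom (F s) (F t) T ->
  exists2 T0, Hom s t T0 & fhom F s t T0 = T.
Proof.
move=> hs ht hT; case: eF => _ [F' [fF' [u nu] [u' nu']]].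
have hFs := fun_obj fF hs; have hFt := fun_obj fF ht.
have hF'T := fun_hom fF' hFs hFt hT.
have [ws [wus uws]] := nat_inv nu hs; have [wt [wut uwt]] := nat_inv nu ht.
have hT0 : Hom s t (u t * fhom F' (F s) (F t) T * ws).
  apply: homM (hom_inv (nat_hom nu hs) wus uws).
  exact: (homM (nat_hom nu ht) hF'T).
exists (u t * fhom F' (F s) (F t) T * ws) => //.
have e := nat_natural nu hs ht hT0.
rewrite /= -mulrA wus mulr1 in e.
have {}e : fhom F' (F s) (F t) T =
    fhom F' (F s) (F t) (fhom F s t (u t * fhom F' (F s) (F t) T * ws)).
  by have := congr1 (fun z => wt * z) e; rewrite /= !mulrA wut !mul1r.
have := nat_natural nu' hFs hFt hT.
have := nat_natural nu' hFs hFt (fun_hom fF hs ht hT0).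
rewrite /= -e => <- e2.
have [w [_ uw]] := nat_inv nu' hFs.
by rewrite -[LHS]mulr1 -[RHS]mulr1 -uw !mulrA e2.
Qed.

Lemma functor_schur i j T : Hom (F (X i)) (F (X j)) T ->
  exists2 a : R[i], T = a *: 1 & (i != j -> a = 0).
Proof.
move=> /(functor_full (simple_obj fb i) (simple_obj fb j))[T0 hT0 <-].
case: (fb_schur fb hT0) => a e ij; subst T0; case: (eqVneq i j) ij => [<-|ij a0].
  exists a => //.
  rewrite functorZ; [|exact: (simple_obj fb i)|exact: (simple_obj fb i)|exact: hom1].
  by rewrite (fun_id fF (simple_obj fb i)).
exists 0 => //; rewrite a0 // !scale0r functor0 //; exact: (simple_obj fb _).
Qed.

End Equivalence.
End Functor.

(** Some spanning intertwiner b is nonzero; b^* b and b b^* are then the same positive scalar, and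
    dividing b by its square root gives a unitary. *)
Lemma irreducible_simple s : C s ->
  (forall T, Hom s s T -> exists a : R[i], T = a *: 1) ->
  exists i, exists2 v, Hom (X i) s v & unitary star v.
Proof.
move=> hs irr; have [hb b1] := spanning_seqP fb hs.
have [b bs b0] : exists2 b, b \in spanning_seq star X s & b.2 != 0.
  apply: contrapT => h; have := oner_neq0 M; rewrite -b1 big_seq big1 ?eqxx // => b bs.
  by case: (eqVneq b.2 0) => [->|b0]; rewrite ?mul0r //; case: h; exists b.
have hA := hb b bs; exists b.1.
have [a aE _] := fb_schur fb (homM (star_hom fb hs hA) hA).
have a_gt0 : 0 < a := star_pos sa b0 aE.
have [a' a'E] := irr _ (homM hA (star_hom fb hs hA)).
have aa' : a' = a.
  have : b.2 * star b.2 * b.2 = b.2 * (star b.2 * b.2) by rewrite mulrA.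
  rewrite aE a'E -scalerAl -scalerAr mul1r mulr1 => /eqP.
  by rewrite -subr_eq0 -scalerBl scaler_eq0 (negPf b0) orbF subr_eq0 => /eqP.
pose r := sqrtC a; have r_gt0 : 0 < r by rewrite sqrtC_gt0.
have rr : r^-1 ^+ 2 * a = 1 by rewrite exprVn sqrtCK mulVf // gt_eqF.
have rJ : (r^-1)^* = r^-1 by rewrite fmorphV /= (CrealP (gtr0_real r_gt0)).
exists (r^-1 *: b.2); first exact: homZ.
by split; rewrite (starZ sa) rJ -scalerAl -scalerAr scalerA -expr2 ?aE ?a'E ?aa' scalerA rr scale1r.
Qed.

Lemma skeleton_exists F : star_monoidal_autoequivalence star C F ->
  exists pi v c, skeleton F pi v c.
Proof.
case=> hF eF; have fF := mon_functor hF.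
have CX := simple_obj fb.
(* The unit keeps its index and is given the unitary [munit F]; for the other indices F(X_i) is
   irreducible because F is full. *)
have FX i : exists jv : I * M, [/\ Hom (X jv.1) (F (X i)) jv.2, unitary star jv.2 &
    i = one -> jv = (one, munit F)].
  case: (eqVneq i one) => [->|i1].
    exists (one, munit F); split=> //=; last exact: (mon_unit_unitary hF).
    by have := mon_unit_hom hF; rewrite (fb_one fb).
  have [||j [v hv uv]] := irreducible_simple (s := F (X i)).
  - exact: (fun_obj fF (CX i)).
  - by move=> T /(functor_schur hF eF)[a -> _]; exists a.
  by exists (j, v); split => // /eqP; rewrite (negPf i1).
have [f fP] := choice FX.
have finj : injective (fun i => (f i).1).
  move=> i j ij; have [hi ui _] := fP i; have [hj uj _] := fP j.
  have h : Hom (F (X i)) (F (X j)) ((f j).2 * star (f i).2).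
    apply: homM hj _; rewrite -ij.
    by apply: homV hi; [exact: sa|exact: Xe|exact: (functor_endo hF (CX i))].
  have [a e ij0] := functor_schur hF eF h.
  apply/eqP/negPn/negP => /ij0 a0; have := oner_neq0 M.
  case: (unitaryM sa uj (unitaryV sa ui)) => <- _.
  by rewrite e a0 scale0r mulr0 eqxx.
pose pi := perm finj; exists pi, (fun i => (f i).2).
have piE i : pi i = (f i).1 by rewrite permE.
have hv i : Hom (X (pi i)) (F (X i)) (f i).2 by rewrite piE; case: (fP i).
have uv i : unitary star (f i).2 by case: (fP i).
have cE ijk : exists a : R[i], N ijk.1.1 ijk.1.2 ijk.2 ->
    [/\ N (pi ijk.1.1) (pi ijk.1.2) (pi ijk.2), a != 0 &
      fhom F (X ijk.2) (X ijk.1.1 \o X ijk.1.2) (V ijk.1.1 ijk.1.2 ijk.2) * (f ijk.2).2 =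
      mten F (X ijk.1.1) (X ijk.1.2) * (f ijk.1.1).2 * X (pi ijk.1.1) (f ijk.1.2).2 *
      (a^-1 *: V (pi ijk.1.1) (pi ijk.1.2) (pi ijk.2))].
  case: ijk => [[i j] k] /=; case: (boolP (N i j k)) => [nk|_]; last by exists 0.
  have Cij := comp_obj fb (CX i) (CX j).
  pose U := mten F (X i) (X j) * (f i).2 * X (pi i) (f j).2.
  have uU : unitary star U.
    apply: (unitaryM sa); last exact: (endo_unitary (Xe _) (uv j)).
    by apply: (unitaryM sa) => //; exact: (mon_ten_unitary hF (CX i) (CX j)).
  have hU : Hom (X (pi i) \o X (pi j)) (F (X i \o X j)) U.
    rewrite /U -mulrA; apply: homM (mon_ten_hom hF (CX i) (CX j)) _.
    exact: (hom_ten (Xe _) (hv i) (hv j)).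
  have hFV := fun_hom fF (CX k) Cij (fb_hom fb i j k).
  have [a ae] : exists a, star U * (fhom F (X k) (X i \o X j) (V i j k) * (f k).2) =
       a *: V (pi i) (pi j) (pi k).
    apply: (hom_V fb); apply: homM (homM hFV (hv k)).
    apply: homV hU; [exact: sa|exact: (endo_comp (Xe _) (Xe _))|exact: (functor_endo hF Cij)].
  have e : fhom F (X k) (X i \o X j) (V i j k) * (f k).2 = U * (a *: V (pi i) (pi j) (pi k)).
    by rewrite -ae mulrA; case: uU => _ ->; rewrite mul1r.
  (* F preserves star and composition, so star F(V) F(V) = F(1) = 1 and F(V) cannot vanish. *)
  have nz : a *: V (pi i) (pi j) (pi k) != 0.
    apply/eqP => z; move: e; rewrite z mulr0 => /(congr1 (fun T => T * star (f k).2)).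
    rewrite -mulrA; case: (uv k) => _ ->; rewrite mulr1 mul0r => z'.
    have := mon_star hF (CX k) Cij (fb_hom fb i j k).
    rewrite z' (star0 sa) => z''.
    have hV' : Hom (X i \o X j) (X k) (star (V i j k)).
      by apply: homV (fb_hom fb i j k); [exact: sa|exact: Xe|exact: (endo_comp (Xe _) (Xe _))].
    have := fun_comp fF (CX k) Cij (CX k) hV' (fb_hom fb i j k).
    rewrite (fb_iso fb nk) (fun_id fF (CX k)) z' mulr0 => /eqP.
    by rewrite oner_eq0.
  exists a^-1 => _; rewrite invrK; split => //.
  - by apply: contraNT nz => /(fb_V0 fb) ->; rewrite scaler0.
  - by rewrite invr_eq0; apply: contraNneq nz => ->; rewrite scale0r.
have [c cP] := choice cE.
exists (fun i j k => c (i, j, k)); split => //.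
- by rewrite piE; case: (fP one) => _ _ ->.
- by case: (fP one) => _ _ ->.
- by move=> i j k nk; case: (cP (i, j, k) nk).
- by move=> i j k nk; case: (cP (i, j, k) nk).
- by move=> i j k nk; case: (cP (i, j, k) nk).
Qed.

End Skeleton.

(** * Cohomologous scalars give monoidally isomorphic functors *)

Section SkeletonIso.
Variables (R : realType) (M : algType R[i]) (star : M -> M) (I : finType).
Local Notation Hom := (@intertwiner R M).
Implicit Types (s t : M -> M) (x y S T A B : M) (i j k l m q : I).
Variables (C : (M -> M) -> Prop) (X : I -> M -> M) (one : I) (N : I -> I -> I -> bool)
  (V : I -> I -> I -> M) (Phi : I -> I -> I -> I -> I -> I -> R[i]).
Hypothesis fb : fusion_basis star C X one N V Phi.
Let sa := fb_star fb.
Let Xe := fb_endo fb.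
Let CX := simple_obj fb.

Lemma N_one_l i : N one i i.
Proof.
by apply: contraT => /(fb_V0 fb)/eqP; rewrite (fb_one_l fb) eqxx oner_eq0.
Qed.

Lemma skeleton_one_l F pi v c : star_monoidal_functor star C F -> skeleton star X one N V F pi v c ->
  forall i, c one i i = 1.
Proof.
move=> hF sk i; have := sk_V sk (N_one_l i).
rewrite (sk_pi_one sk) !(fb_one_l fb) !eqxx (fb_one fb) (sk_one sk).
have -> : fhom F (X i) (id \o X i) 1 = 1 by exact: (fun_id (mon_functor hF) (CX i)).
rewrite (mon_unit_l hF (CX i)) !mul1r -scalerAr mulr1 => e.
have v0 : v i != 0.
  apply/eqP => z; case: (sk_unitary sk i); rewrite z mulr0 => /esym/eqP.
  by rewrite oner_eq0.
have /eqP : (1 - (c one i i)^-1) *: v i = 0 by rewrite scalerBl scale1r -e subrr.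
by rewrite scaler_eq0 (negPf v0) orbF subr_eq0 eq_sym invr_eq1 => /eqP.
Qed.

Section NaturalTransformation.
Variables (F1 F2 : monoidal_data M).
Hypotheses (h1 : star_monoidal_functor star C F1) (h2 : star_monoidal_functor star C F2).
Variable w : I -> M.
Hypothesis hw : forall i, Hom (F1 (X i)) (F2 (X i)) (w i).
Let f1 := mon_functor h1.
Let f2 := mon_functor h2.

(** The extension of a family on simple objects to all objects that naturality along the spanning
    intertwiners dictates. *)
Definition nat_extension s : M :=
  \sum_(b <- spanning_seq star X s)
    fhom F2 (X b.1) s b.2 * w b.1 * star (fhom F1 (X b.1) s b.2).

Lemma nat_schur i j T : Hom (X i) (X j) T ->
  w j * fhom F1 (X i) (X j) T = fhom F2 (X i) (X j) T * w i.
Proof.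
move=> hT; case: (fb_schur fb hT) => a e; subst T; case: (eqVneq i j) => [<- _|ij a0].
  rewrite (functorZ h1 _ (CX i) (CX i) (hom1 _)) (functorZ h2 _ (CX i) (CX i) (hom1 _)).
  by rewrite (fun_id f1 (CX i)) (fun_id f2 (CX i)) -scalerAl -scalerAr mul1r mulr1.
rewrite a0 // scale0r (functor0 h1 (CX i) (CX j)) (functor0 h2 (CX i) (CX j)).
by rewrite mulr0 mul0r.
Qed.

Lemma nat_extensionE s i A : C s -> Hom (X i) s A ->
  nat_extension s * fhom F1 (X i) s A = fhom F2 (X i) s A * w i.
Proof.
move=> hs hA; rewrite /nat_extension mulr_suml.
rewrite -[RHS]mul1r -(functor_span_sum fb h2 hs) mulr_suml big_seq [RHS]big_seq.
apply: eq_bigr => b hb; have hbA := spanning_seq_hom fb hs hb.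
have hsb := star_hom fb hs hbA; have hT := homM hsb hA.
rewrite -(mon_star h1 (CX b.1) hs hbA) -(mon_star h2 (CX b.1) hs hbA).
rewrite -!mulrA -(fun_comp f1 (CX i) hs (CX b.1) hsb hA) (nat_schur hT).
by rewrite (fun_comp f2 (CX i) hs (CX b.1) hsb hA) !mulrA.
Qed.

Lemma nat_extension_hom s : C s -> Hom (F1 s) (F2 s) (nat_extension s).
Proof.
move=> hs; apply: hom_sum => b hb _; have hbA := spanning_seq_hom fb hs hb.
apply: (@homM _ _ _ (F1 (X b.1))).
  exact: (homM (fun_hom f2 (CX b.1) hs hbA) (hw b.1)).
rewrite -(mon_star h1 (CX b.1) hs hbA).
exact: (fun_hom f1 hs (CX b.1) (star_hom fb hs hbA)).
Qed.

Lemma nat_extension_natural s t T : C s -> C t -> Hom s t T ->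
  fhom F2 s t T * nat_extension s = nat_extension t * fhom F1 s t T.
Proof.
move=> hs ht hT; apply: (functor_span_ext fb h1 (endo_id star) hs) => i A hA.
rewrite -mulrA (nat_extensionE hs hA) mulrA -(fun_comp f2 (CX i) hs ht hT hA).
rewrite -(nat_extensionE ht (homM hT hA)) (fun_comp f1 (CX i) hs ht hT hA).
by rewrite mulrA.
Qed.

End NaturalTransformation.

Lemma nat_extensionK F1 F2 w w' s : star_monoidal_functor star C F1 ->
  star_monoidal_functor star C F2 -> (forall i, w' i * w i = 1) -> C s ->
  nat_extension F2 F1 w' s * nat_extension F1 F2 w s = 1.
Proof.
move=> h1 h2 ww hs; apply: (functor_span_ext fb h1 (endo_id star) hs) => i A hA.
rewrite -mulrA (nat_extensionE h1 h2 _ hs hA) mulrA (nat_extensionE h2 h1 _ hs hA).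
by rewrite -mulrA ww mulr1 mul1r.
Qed.

(** On X_i the isomorphism is mu_i v2_i v1_i^*, extended by naturality. Compatibility with tensor
    products need only be tested on the basis isometries, where it is the coboundary relation. *)
Lemma skeleton_isomorphic F1 F2 pi v1 v2 c1 c2 (mu : I -> R[i]) :
  star_monoidal_functor star C F1 -> star_monoidal_functor star C F2 ->
  skeleton star X one N V F1 pi v1 c1 -> skeleton star X one N V F2 pi v2 c2 ->
  (forall i, mu i != 0) ->
  (forall i j k, N i j k -> c2 i j k * mu i * mu j = c1 i j k * mu k) ->
  monoidally_isomorphic C F1 F2.
Proof.
move=> h1 h2 s1 s2 mu0 cmu.
have f1 := mon_functor h1; have f2 := mon_functor h2.
have mu1 : mu one = 1.
  have := cmu _ _ _ (N_one_l one).
  rewrite (skeleton_one_l h1 s1) (skeleton_one_l h2 s2) !mul1r => e.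
  by apply: (mulfI (mu0 one)); rewrite mulr1.
have u1 i := sk_unitary s1 i; have u2 i := sk_unitary s2 i.
pose w i := mu i *: (v2 i * star (v1 i)).
pose w' i := (mu i)^-1 *: (v1 i * star (v2 i)).
have hw i : Hom (F1 (X i)) (F2 (X i)) (w i).
  apply/homZ/homM; first exact: (sk_hom s2 i).
  by apply: homV (sk_hom s1 i); [exact: sa|exact: Xe|exact: (functor_endo fb h1 (CX i))].
have wv i : w i * v1 i = mu i *: v2 i.
  by rewrite /w -scalerAl -mulrA; case: (u1 i) => -> _; rewrite mulr1.
have ww i : w' i * w i = 1.
  rewrite {1}/w' -scalerAl -mulrA {1}/w -scalerAr [star _ * _]mulrA; case: (u2 i) => -> _.
  rewrite mul1r -scalerAr scalerA mulVf ?mu0 //; case: (u1 i) => _ ->.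
  exact: scale1r.
have ww' i : w i * w' i = 1.
  rewrite {1}/w -scalerAl -mulrA {1}/w' -scalerAr [star _ * _]mulrA; case: (u1 i) => -> _.
  rewrite mul1r -scalerAr scalerA mulfV ?mu0 //; case: (u2 i) => _ ->.
  exact: scale1r.
pose u := nat_extension F1 F2 w.
have uE := nat_extensionE h1 h2 w.
exists u; split.
- split=> [s hs|s hs|s t T hs ht hT].
  + exact: nat_extension_hom.
  + by exists (nat_extension F2 F1 w' s); rewrite !nat_extensionK.
  + exact: nat_extension_natural.
- move=> s t hs ht; have hst := comp_obj fb hs ht.
  have e1 := functor_endo fb h1 hs; have eX i := functor_endo fb h1 (CX i).
  apply: (functor_span_ext fb h1 (endo_id star) hs) => i A hA.
  apply: (functor_span_ext fb h1 (eX i) ht) => j B hB.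
  have Cij := comp_obj fb (CX i) (CX j).
  have hAB : Hom (X i \o X j) (s \o t) (A * X i B) := hom_ten (Xe i) hA hB.
  have FA := fun_hom f1 (CX i) hs hA.
  transitivity (fhom F2 (X i \o X j) (s \o t) (A * X i B) *
     (mten F2 (X i) (X j) * (w i * F1 (X i) (w j)))).
    rewrite [RHS]mulrA (functor_ten fb h2 hs ht hA hB).
    transitivity (mten F2 s t * (u s * fhom F1 (X i) s A) * F1 (X i) (u t * fhom F1 (X j) t B)).
      rewrite (endo_mul (eX i)) !mulrA; congr (_ * _); rewrite -!mulrA.
      by congr (_ * (_ * _)); rewrite (FA (u t)).
    rewrite (uE _ _ _ hs hA) (uE _ _ _ ht hB) (endo_mul (eX i)) -!mulrA.
    by do 2!congr (_ * _); rewrite mulrA (hw i _) mulrA.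
  transitivity (fhom F2 (X i \o X j) (s \o t) (A * X i B) * (u (X i \o X j) * mten F1 (X i) (X j))).
    congr (_ * _); set P := mten F2 _ _ * _.
    have [m1 m2] := mon_ten_unitary h1 (CX i) (CX j).
    suff Pu : P * star (mten F1 (X i) (X j)) = u (X i \o X j).
      by rewrite -Pu -mulrA m1 mulr1.
    apply: (functor_span_ext fb h1 (endo_id star) Cij) => k D hD.
    rewrite (uE _ _ _ Cij hD).
    have [a ->] := hom_V fb hD.
    have hV := fb_hom fb i j k.
    rewrite (functorZ h1 _ (CX k) Cij hV) (functorZ h2 _ (CX k) Cij hV).
    rewrite -scalerAr -scalerAl; congr (_ *: _).
    case: (boolP (N i j k)) => [nk|/(fb_V0 fb) ->]; last first.
      by rewrite (functor0 h1 (CX k) Cij) (functor0 h2 (CX k) Cij) mulr0 mul0r.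
    have [v1v v1v'] := u1 k.
    rewrite -[fhom F1 _ _ _]mulr1 -v1v' [fhom F1 _ _ _ * _]mulrA (sk_V s1 nk).
    transitivity (P * (star (mten F1 (X i) (X j)) * mten F1 (X i) (X j)) * v1 i * X (pi i) (v1 j) *
       ((c1 i j k)^-1 *: V (pi i) (pi j) (pi k)) * star (v1 k)); first by rewrite !mulrA.
    rewrite m1 mulr1 /P.
    transitivity (mten F2 (X i) (X j) * w i * (F1 (X i) (w j) * v1 i) * X (pi i) (v1 j) *
       ((c1 i j k)^-1 *: V (pi i) (pi j) (pi k)) * star (v1 k)); first by rewrite !mulrA.
    rewrite -(sk_hom s1 i (w j)).
    transitivity (mten F2 (X i) (X j) * (w i * v1 i) * X (pi i) (w j * v1 j) *
       ((c1 i j k)^-1 *: V (pi i) (pi j) (pi k)) * star (v1 k)).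
      by rewrite (endo_mul (Xe _)) !mulrA.
    have -> : w k = mu k *: (v2 k * star (v1 k)) by [].
    rewrite !wv (endoZ (Xe _)) -[RHS]scalerAr [fhom F2 _ _ _ * _]mulrA (sk_V s2 nk).
    have c10 := sk_c0 s1 nk; have c20 := sk_c0 s2 nk.
    rewrite -!(scalerAl, scalerAr) !scalerA; congr (_ *: _).
    have := cmu _ _ _ nk => e.
    apply: (mulfI c10); apply: (mulfI c20).
    transitivity (c2 i j k * mu i * mu j); first by field.
    by rewrite e; field.
  transitivity (u (s \o t) * (mten F1 s t * (fhom F1 (X i) s A * F1 (X i) (fhom F1 (X j) t B)))).
    rewrite -(functor_ten fb h1 hs ht hA hB) [RHS]mulrA -(nat_extension_natural h1 h2 w Cij hst hAB).
    by rewrite mulrA.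
  by rewrite !mulrA.
have h := nat_extensionE h1 h2 w (unit_obj fb) (hom_one_id fb).
rewrite (fb_one fb) (fun_id f1 (unit_obj fb)) (fun_id f2 (unit_obj fb)) mulr1 mul1r in h.
by rewrite /u h -(sk_one s1) wv mu1 scale1r (sk_one s2).
Qed.

End SkeletonIso.

(** * The fusion basis of a realization *)

Section Irreducible.
Variables (R : realType) (M : algType R[i]) (star : M -> M).
Hypothesis sa : star_algebra star.
Local Notation Hom := (@intertwiner R M).

Definition irreducible (s : M -> M) : Prop := forall T, Hom s s T -> exists c : R[i], T = c *: 1.

Lemma irreducible_unitary s t T : star_endo star s -> star_endo star t ->
  irreducible s -> irreducible t -> Hom s t T -> T != 0 ->
  exists2 U, unitary star U & Hom s t U.
Proof.
move=> es et irs irt hT T0; have hT' := homV sa es et hT.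
have [a aE] := irs _ (homM hT' hT); have [a' a'E] := irt _ (homM hT hT').
have a_gt0 : 0 < a := star_pos sa T0 aE.
have aa' : a' = a.
  have : T * star T * T = T * (star T * T) by rewrite mulrA.
  rewrite aE a'E -scalerAl -scalerAr mul1r mulr1 => /eqP.
  by rewrite -subr_eq0 -scalerBl scaler_eq0 (negPf T0) orbF subr_eq0 => /eqP.
pose r := sqrtC a; have r_gt0 : 0 < r by rewrite sqrtC_gt0.
have rr : r^-1 ^+ 2 * a = 1 by rewrite exprVn sqrtCK mulVf // gt_eqF.
have rJ : (r^-1)^* = r^-1 by rewrite fmorphV /= (CrealP (gtr0_real r_gt0)).
exists (r^-1 *: T); last exact: homZ.
by split; rewrite (starZ sa) rJ -scalerAl -scalerAr scalerA -expr2 ?aE ?a'E ?aa' scalerA rr scale1r.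
Qed.

End Irreducible.

Section Realization.
Variables (R : realType) (x : gh_data R V4) (M : algType R[i]) (star : M -> M)
  (alpha : V4 -> M -> M) (rho : M -> M) (S : M) (T : V4 -> M).
Hypothesis Hx : gh_solution x.
Hypothesis sa : star_algebra star.
Hypothesis factor : is_factor M.
Hypothesis rz : realization x star alpha rho S T.
Local Notation Hom := (@intertwiner R M).
Implicit Types (g h : V4) (y : M).

Let act := rz_action rz.
Let ae g := act_endo act g.
Let re := rz_endo rz.

Lemma alphaK g y : alpha g (alpha g y) = y.
Proof. by rewrite -(act_D act) V4_addxx (act_0 act). Qed.

Lemma alpha_rho g y : alpha g (rho y) = rho (alpha g y).
Proof. by rewrite (rz_commutation rz) V4_opp. Qed.

Lemma alpha_T g h : alpha g (T h) = eps x g h *: T h.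
Proof. by rewrite (rz_alpha_T rz) V4_mul2 addr0. Qed.

Lemma rz_S_neq0 : S != 0.
Proof. by apply/eqP => S0; have := rz_S_isometry rz; rewrite /Defs.isometry S0 mulr0 => /esym/eqP; rewrite oner_eq0. Qed.

Lemma alpha_irreducible g : irreducible (alpha g).
Proof.
move=> U hU; apply: factor => y; have := hU (alpha g y).
by rewrite alphaK.
Qed.

Lemma alpha_rho_irreducible g : irreducible (alpha g \o rho).
Proof.
move=> U hU; have [c cE] : exists c : R[i], alpha g U = c *: 1.
  apply: (rz_irreducible rz) => y; have := congr1 (alpha g) (hU y).
  by rewrite !(endo_mul (ae g)) /= !alphaK.
by exists c; rewrite -[U](alphaK g) cE (endoZ (ae g)) (endo_1 (ae g)).
Qed.

Lemma alpha_rho_endo g : star_endo star (alpha g \o rho).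
Proof. exact: (endo_comp (ae g) re). Qed.

Lemma alpha_disjoint g h U : Hom (alpha g) (alpha h) U -> g != h -> U = 0.
Proof.
move=> hU gh; apply/eqP/negPn/negP => U0.
have [W [uW1 uW2] hW] := irreducible_unitary sa (ae g) (ae h) (alpha_irreducible (g := g))
  (alpha_irreducible (g := h)) hU U0.
apply: (act_outer act (g := h + g)); first by rewrite addr_eq0 V4_opp eq_sym.
exists W => // y; rewrite (act_D act).
by rewrite -[LHS]mulr1 -uW2 mulrA -(hW (alpha g y)) alphaK.
Qed.

Lemma rz_T_neq0 g : T g != 0.
Proof. by apply/eqP => T0; have := rz_T_isometry rz g; rewrite /Defs.isometry T0 mulr0 => /esym/eqP; rewrite oner_eq0. Qed.

(** If α_g and α_hρ were unitarily equivalent, ρ would be onto. Then the range projections of S and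
    of the four T_g commute with the whole factor, so each is 1, and they cannot sum to 1. *)
Lemma alpha_rho_disjoint g h U : Hom (alpha g) (alpha h \o rho) U -> U = 0.
Proof.
move=> hU; apply/eqP/negPn/negP => U0.
have [W [uW1 uW2] hW] := irreducible_unitary sa (ae g) (alpha_rho_endo h)
  (alpha_irreducible (g := g)) (alpha_rho_irreducible (g := h)) hU U0.
have surj y : exists y', rho y' = y.
  exists (alpha g (star W * alpha h y * W)).
  have := hW (alpha g (star W * alpha h y * W)); rewrite alphaK /= => e.
  have : alpha h (rho (alpha g (star W * alpha h y * W))) * (W * star W) = alpha h y * (W * star W).
    by rewrite mulrA -e !mulrA uW2 mul1r -!mulrA uW2.
  by rewrite uW2 !mulr1 => /(congr1 (alpha h)); rewrite !alphaK.
have proj V (s : M -> M) : star V * V = 1 -> Hom s (rho \o rho) V -> star_endo star s -> V * star V = 1.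
  move=> V1 hV ek; have hV' := homV sa ek (endo_comp re re) hV.
  have [c cE] : exists c : R[i], V * star V = c *: 1.
    apply: factor => y; have [y1 <-] := surj y; have [y2 <-] := surj y1.
    exact: (homM hV hV' y2).
  have : V * star V * V = V by rewrite -mulrA V1 mulr1.
  rewrite cE -scalerAl mul1r => /eqP.
  rewrite -subr_eq0 -{2}[V]scale1r -scalerBl scaler_eq0 subr_eq0 => /orP[/eqP->|/eqP V0].
    by rewrite scale1r.
  by move: V1; rewrite V0 mulr0 => /esym/eqP; rewrite oner_eq0.
have := rz_sum rz; rewrite (proj S id (rz_S_isometry rz) (rz_S rz) (endo_id star)).
rewrite (eq_bigr (fun=> 1)) => [|k _]; last first.
  by apply: (proj (T k) (alpha k \o rho)); [exact: (rz_T_isometry rz)|exact: (rz_T rz)|exact: alpha_rho_endo].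
rewrite V4_sum => e; have : (4%:R : R[i]) *: (1 : M) == 0.
  apply/eqP; rewrite scaler_nat; apply: (addrI 1); rewrite addr0 -[RHS]e.
  by rewrite !mulrS mulr0n addr0 !addrA.
by rewrite scaler_eq0 oner_eq0 orbF pnatr_eq0.
Qed.

Lemma rho_alpha_disjoint g h U : Hom (alpha g \o rho) (alpha h) U -> U = 0.
Proof.
move=> hU; have := homV sa (alpha_rho_endo g) (ae h) hU => /alpha_rho_disjoint e.
by rewrite -[U](starK sa) e (star0 sa).
Qed.

Lemma rz_hom_from_alpha k W : k != 0 -> Hom (alpha k) (rho \o rho) W -> W = 0.
Proof.
move=> k0 hW; rewrite -[W]mul1r -(rz_sum rz) mulrDl mulr_suml big1 => [|g _].
  rewrite addr0 -mulrA [star S * W](_ : _ = 0) ?mulr0 //.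
  apply: (alpha_disjoint (g := k) (h := 0)) => //.
  apply: homM hW => y; rewrite (act_0 act).
  exact: (homV sa (endo_id star) (endo_comp re re) (rz_S rz)).
rewrite -mulrA [star (T g) * W](_ : _ = 0) ?mulr0 //.
apply: (alpha_rho_disjoint (g := k) (h := g)); apply: homM hW.
exact: (homV sa (alpha_rho_endo g) (endo_comp re re) (rz_T rz g)).
Qed.

(** A unitary between α_gρ and α_hρ gives an isometry P from ρ to α_kρ with k = g + h nonzero. Then
    α_k(PS) intertwines α_k with ρ^2, which has no summand α_k, so PS = 0, contradicting S ≠ 0. *)
Lemma rho_disjoint g h U : Hom (alpha g \o rho) (alpha h \o rho) U -> g != h -> U = 0.
Proof.
move=> hU gh; apply/eqP/negPn/negP => U0.
have [W [uW1 uW2] hW] := irreducible_unitary sa (alpha_rho_endo g) (alpha_rho_endo h)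
  (alpha_rho_irreducible (g := g)) (alpha_rho_irreducible (g := h)) hU U0.
pose k := g + h; have k0 : k != 0 by rewrite addr_eq0 V4_opp.
pose P := alpha g W.
have hP y : P * rho y = alpha k (rho y) * P.
  have := congr1 (alpha g) (hW y).
  by rewrite !(endo_mul (ae g)) /= alphaK -(act_D act).
have PS : P * S = 0.
  rewrite -[P * S](alphaK k) (_ : alpha k (P * S) = 0) ?(endo0 (ae k)) //.
  apply: (rz_hom_from_alpha k0) => y.
  have eS : S * y = rho (rho y) * S := rz_S rz y.
  by rewrite -(endo_mul (ae k)) -mulrA eS mulrA hP -mulrA (endo_mul (ae k)) alphaK.
have PP : star P * P = 1 by rewrite /P -(endo_star (ae g)) -(endo_mul (ae g)) uW1 (endo_1 (ae g)).
have := rz_S_neq0; rewrite -[S]mul1r -PP -mulrA PS mulr0 eqxx.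
by [].
Qed.

Lemma star_T_T g h : star (T g) * T h = (g == h)%:R.
Proof.
case: (eqVneq g h) => [<-|gh]; first exact: (rz_T_isometry rz).
apply: (rho_disjoint (g := h) (h := g)); last by rewrite eq_sym.
apply: homM (rz_T rz h).
exact: (homV sa (alpha_rho_endo g) (endo_comp re re) (rz_T rz g)).
Qed.

Lemma star_S_T g : star S * T g = 0.
Proof.
apply: (rho_alpha_disjoint (g := g) (h := 0)); apply: homM (rz_T rz g) => y.
rewrite (act_0 act).
exact: (homV sa (endo_id star) (endo_comp re re) (rz_S rz)).
Qed.

Lemma star_T_S g : star (T g) * S = 0.
Proof. by rewrite -[LHS](starK sa) (starM sa) (starK sa) star_S_T (star0 sa). Qed.

Lemma star_S_S : star S * S = 1. Proof. exact: (rz_S_isometry rz). Qed.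

(* The simple objects [alpha g] and [alpha g \o rho] are indexed by [(g, false)] and [(g, true)]. *)
Definition gh_simple (i : V4 * bool) : M -> M :=
  if i.2 then alpha i.1 \o rho else alpha i.1.

Definition gh_fusion (i j k : V4 * bool) : bool :=
  if i.2 && j.2 then k.2 || (k.1 == i.1 + j.1) else k == (i.1 + j.1, i.2 || j.2).

(** As α_gρα_hρ = α_{g+h}ρ^2, the copy of α_kρ in it is embedded by T_u with u = k + g + h, and
    α_{g+h} by S. *)
Definition gh_isometry (i j k : V4 * bool) : M :=
  if i.2 && j.2 then
    if k.2 then T (k.1 + i.1 + j.1) else if k.1 == i.1 + j.1 then S else 0
  else (k == (i.1 + j.1, i.2 || j.2))%:R.

(** The expansion coefficients of α_i(T_t) when only j and l involve ρ; of ρ(S) when all three do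
    and q is the S channel; and of α_iρ(T_t)S or α_iρ(T_t)T_y otherwise. Here [t] and [y] are the
    labels of the T channels of (j,l) and (i,q). *)
Definition gh_coef (i j l m k q : V4 * bool) : R[i] :=
  let dinv : R[i] := (gh_dim R V4)^-1%:C%C in
  let sdinv : R[i] := (Num.sqrt (gh_dim R V4))^-1%:C%C in
  let t := q.1 + j.1 + l.1 in
  match i.2, j.2, l.2 with
  | false, true, true => if q.2 then eps x i.1 t else 1
  | true, true, true =>
    if q.2 then eps x (i.1 + t) t *
      (if m.2 then
         let y := m.1 + i.1 + q.1 in
         if k.2 then amp x t (t + (k.1 + i.1 + j.1)) (t + y) else (t == y)%:R * sdinv
       else (k == (m.1 + l.1, true))%:R)
    else if k.2 then sdinv else dinv
  | _, _, _ => 1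
  end.

Definition gh_associator (i j l m k q : V4 * bool) : R[i] :=
  (gh_fusion j l q && gh_fusion i q m)%:R * gh_coef i j l m k q.

Lemma gh_simple_endo i : star_endo star (gh_simple i).
Proof. by case: i => g [] /=; [exact: alpha_rho_endo|exact: ae]. Qed.

Lemma gh_simple_schur i j U : Hom (gh_simple i) (gh_simple j) U ->
  exists2 c : R[i], U = c *: 1 & (i != j -> c = 0).
Proof.
have zero (P : Prop) : U = 0 -> exists2 c : R[i], U = c *: 1 & (P -> c = 0).
  by move=> ->; exists 0; rewrite ?scale0r.
case: i j => [g []] [h []] hU.
- case: (eqVneq g h) => gh; last exact/zero/(rho_disjoint hU).
  rewrite -gh in hU *; case: (alpha_rho_irreducible hU) => c ->; exists c => //.
  by rewrite eqxx.
- exact/zero/(rho_alpha_disjoint hU).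
- exact/zero/(alpha_rho_disjoint hU).
- case: (eqVneq g h) => gh; last exact/zero/(alpha_disjoint hU).
  rewrite -gh in hU *; case: (alpha_irreducible hU) => c ->; exists c => //.
  by rewrite eqxx.
Qed.

Lemma gh_isometry_hom i j k :
  Hom (gh_simple k) (gh_simple i \o gh_simple j) (gh_isometry i j k).
Proof.
move=> y; rewrite /gh_isometry; case: ifP => [/andP[i2 j2]|ij].
  rewrite /gh_simple i2 j2 /=.
  have e : alpha i.1 (rho (alpha j.1 (rho y))) = rho (rho (alpha (i.1 + j.1) y)).
    by rewrite -!alpha_rho -(act_D act).
  rewrite e; case: ifP => [k2|_] /=.
    have := rz_T rz (k.1 + i.1 + j.1) (alpha (i.1 + j.1) y) => /= <-.
    by rewrite -!alpha_rho -(act_D act) -[k.1 + i.1 + j.1]addrA V4_addK.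
  case: eqP => [->|_]; last by rewrite mul0r mulr0.
  exact: (rz_S rz (alpha (i.1 + j.1) y)).
case: eqP => [->|_]; last by rewrite mul0r mulr0.
rewrite mulr1 mul1r /gh_simple /=; move: ij.
case: (i) (j) => [g []] [h []] //= _.
- by rewrite -!alpha_rho (act_D act).
- by rewrite (act_D act).
- by rewrite (act_D act).
Qed.

Lemma gh_isometry0 i j k : ~~ gh_fusion i j k -> gh_isometry i j k = 0.
Proof.
rewrite /gh_fusion /gh_isometry; case: ifP => _; last by move/negPf->.
by case: (k.2) => //= /negPf->.
Qed.

Lemma gh_isometryK i j k : gh_fusion i j k -> star (gh_isometry i j k) * gh_isometry i j k = 1.
Proof.
rewrite /gh_fusion /gh_isometry; case: ifP => _; last by move->; rewrite (star1 sa) mulr1.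
by case: (k.2) => /=; rewrite ?star_T_T ?eqxx // => ->; exact: star_S_S.
Qed.

Lemma sum_pair_bool (F : V4 * bool -> M) :
  \sum_k F k = \sum_g F (g, false) + \sum_g F (g, true).
Proof.
transitivity (\sum_g \sum_(b : bool) F (g, b)).
  by rewrite pair_bigA; apply: eq_bigr => [[]].
by rewrite -big_split; apply: eq_bigr => g _; rewrite big_bool /= addrC.
Qed.

Lemma gh_isometry_sum i j : \sum_k gh_isometry i j k * star (gh_isometry i j k) = 1.
Proof.
rewrite /gh_isometry; case: (i.2 && j.2); last first.
  pose k0 : V4 * bool := (i.1 + j.1, i.2 || j.2); rewrite (bigD1 k0) //= eqxx (star1 sa) mulr1.
  by rewrite big1 ?addr0 // => k /negPf->; rewrite mul0r.
rewrite sum_pair_bool /= -[RHS](rz_sum rz); congr (_ + _).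
  rewrite (bigD1 (i.1 + j.1)) //= eqxx.
  by rewrite big1 ?addr0 // => k /negPf->; rewrite mul0r.
rewrite (reindex_inj (addIr (i.1 + j.1))) /=; apply: eq_bigr => k _.
by rewrite -[_ + i.1 + j.1]addrA V4_addK.
Qed.

Lemma gh_isometry_indicator i j k : ~~ (i.2 && j.2) ->
  gh_isometry i j k = (k == (i.1 + j.1, i.2 || j.2))%:R.
Proof. by rewrite /gh_isometry => /negPf->. Qed.

Lemma sum_indicator (k0 : V4 * bool) (a : V4 * bool -> R[i]) (W : V4 * bool -> M) :
  \sum_k a k *: ((k == k0)%:R * W k) = a k0 *: W k0.
Proof.
rewrite (bigD1 k0) //= eqxx mul1r big1 ?addr0 // => k /negPf->.
by rewrite mul0r scaler0.
Qed.

Lemma gh_associator_zero i j l m q : ~~ (gh_fusion j l q && gh_fusion i q m) ->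
  gh_simple i (gh_isometry j l q) * gh_isometry i q m =
  \sum_k gh_associator i j l m k q *: (gh_isometry i j k * gh_isometry k l m).
Proof.
move=> h; rewrite big1 => [|k _]; last by rewrite /gh_associator (negPf h) mul0r scale0r.
move: h; rewrite negb_and => /orP[]/gh_isometry0 ->; last by rewrite mulr0.
by rewrite (endo0 (gh_simple_endo i)) mul0r.
Qed.

Lemma rho_S : rho S = (gh_dim R V4)^-1%:C%C *: S +
   (Num.sqrt (gh_dim R V4))^-1%:C%C *: \sum_g T g * T g.
Proof. exact: (rz_rho_S rz). Qed.

(** Writing α_g = α_{g+t}α_t reduces to the given formula for α_tρ(T_t); since ε is a bicharacter,
    all terms acquire the same sign ε_{g+t}(t). *)
Lemma alpha_rho_T_alpha g t : alpha g (rho (T t)) = eps x (g + t) t *: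
  (T t * S * star S + (Num.sqrt (gh_dim R V4))^-1%:C%C *: (S * star (T t)) +
   \sum_h \sum_k amp x t h k *: (T (t + h) * T (t + h + k) * star (T (t + k)))).
Proof.
have -> : alpha g (rho (T t)) = alpha (g + t) (alpha t (rho (T t))).
  by rewrite -(act_D act) V4_addK.
have aeg := ae (g + t).
have aS := rz_alpha_S rz (g + t).
rewrite (rz_rho_T rz) !(sol_eta Hx) rmorph1 mul1r scale1r.
rewrite !(endoD aeg) (endoZ aeg) !(endo_mul aeg) !(endo_star aeg) aS !alpha_T.
rewrite (starZ sa) (sol_epsJ Hx) !scalerDr -!(scalerAl, scalerAr); congr (_ + _ + _).
  by rewrite !scalerA mulrC.
rewrite (endo_sum aeg) scaler_sumr; apply: eq_bigr => h _.
rewrite (endo_sum aeg) scaler_sumr; apply: eq_bigr => k _.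
rewrite (endoZ aeg) !(endo_mul aeg) (endo_star aeg) !alpha_T (starZ sa) (sol_epsJ Hx).
rewrite -!(scalerAl, scalerAr) !scalerA; congr (_ *: _).
rewrite !(sol_eps_bichar Hx (g + t)).
set a := eps x (g + t) t; set b := eps x (g + t) h; set c := eps x (g + t) k.
have aa : a * a = 1 by exact: sol_eps2.
have bb : b * b = 1 by exact: sol_eps2.
have cc : c * c = 1 by exact: sol_eps2.
transitivity (amp x t h k * a * (a * a) * (b * b) * (c * c)); first by ring.
by rewrite aa bb cc !mulr1 mulrC.
Qed.

Lemma alpha_rho_T_S g t : alpha g (rho (T t)) * S = eps x (g + t) t *: (T t * S).
Proof.
rewrite alpha_rho_T_alpha -scalerAl; congr (_ *: _).
have e1 : T t * S * star S * S = T t * S by rewrite -mulrA star_S_S mulr1.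
have e2 : S * star (T t) * S = 0 by rewrite -mulrA star_T_S mulr0.
rewrite !mulrDl e1 -scalerAl e2 scaler0 addr0.
rewrite mulr_suml big1 ?addr0 // => h _; rewrite mulr_suml big1 // => k _.
by rewrite -scalerAl -[_ * star _ * S]mulrA star_T_S mulr0 scaler0.
Qed.

Lemma alpha_rho_T_T g t (v : V4) : alpha g (rho (T t)) * T v = eps x (g + t) t *:
  (((t == v)%:R * (Num.sqrt (gh_dim R V4))^-1%:C%C) *: S +
   \sum_u amp x t (t + u) (t + v) *: (T u * T (u + t + v))).
Proof.
rewrite alpha_rho_T_alpha -scalerAl; congr (_ *: _).
have e1 : T t * S * star S * T v = 0 by rewrite -mulrA star_S_T mulr0.
have e2 : S * star (T t) * T v = S * (t == v)%:R by rewrite -mulrA star_T_T.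
rewrite !mulrDl e1 add0r -scalerAl e2; congr (_ + _).
  by case: eqP => _; rewrite ?mulr1 ?mul1r // mulr0 mul0r scaler0 scale0r.
rewrite mulr_suml (reindex_inj (addrI t)) /=; apply: eq_bigr => u _.
rewrite mulr_suml (bigD1 (t + v)) //= big1 ?addr0 => [|k kt].
  rewrite -scalerAl -[_ * star _ * T v]mulrA star_T_T V4_addKr eqxx mulr1 V4_addKr.
  by rewrite addrA.
rewrite -scalerAl -[_ * star _ * T v]mulrA star_T_T (_ : (t + k == v) = false) ?mulr0 ?scaler0 //.
by apply: contra_neqF kt => /eqP <-; rewrite V4_addKr.
Qed.

Lemma gh_associator_left i j l m q : ~~ (i.2 && j.2) ->
  \sum_k gh_coef i j l m k q *: (gh_isometry i j k * gh_isometry k l m) =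
  gh_coef i j l m (i.1 + j.1, i.2 || j.2) q *:
    gh_isometry (i.1 + j.1, i.2 || j.2) l m.
Proof.
move=> ij; under eq_bigr => k _ do rewrite (gh_isometry_indicator k ij).
exact: (sum_indicator _ (fun k => gh_coef i j l m k q) (fun k => gh_isometry k l m)).
Qed.

Lemma gh_fusion_indicator i j k : ~~ (i.2 && j.2) -> gh_fusion i j k ->
  k = (i.1 + j.1, i.2 || j.2).
Proof. by rewrite /gh_fusion => /negPf-> /eqP. Qed.

Lemma gh_isometry1 i j : ~~ (i.2 && j.2) -> gh_isometry i j (i.1 + j.1, i.2 || j.2) = 1.
Proof. by move=> ij; rewrite gh_isometry_indicator // eqxx. Qed.

Lemma gh_associator_110 (i j l : V4) m q : gh_fusion (j, true) (l, false) q ->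
  gh_simple (i, true) (gh_isometry (j, true) (l, false) q) * gh_isometry (i, true) q m =
  \sum_k gh_coef (i, true) (j, true) (l, false) m k q *:
    (gh_isometry (i, true) (j, true) k * gh_isometry k (l, false) m).
Proof.
move=> /(@gh_fusion_indicator (j, true) (l, false) q isT) ->.
rewrite (@gh_isometry1 (j, true) (l, false)) // (endo_1 (gh_simple_endo _)) mul1r.
case: m => m tm; rewrite (bigD1 (m + l, tm)) //= big1 ?addr0 => [|k km].
  rewrite scale1r (@gh_isometry_indicator (m + l, tm) (l, false)) ?andbF //= V4_addK orbF eqxx mulr1.
  rewrite /gh_isometry /=; case: tm; first by rewrite -!addrA (addrCA l) [l + j]addrC.
  by rewrite -[in RHS](inj_eq (addIr l)) V4_addK addrA.
rewrite scale1r (@gh_isometry_indicator k (l, false)) ?andbF //= orbF.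
case: eqP => [[mk tk]|_]; last by rewrite mulr0.
by move: km; rewrite mk tk V4_addK -surjective_pairing eqxx.
Qed.

Lemma gh_associator_111S (i j l m q : V4) tm :
  gh_fusion (j, true) (l, true) (q, false) -> gh_fusion (i, true) (q, false) (m, tm) ->
  gh_simple (i, true) (gh_isometry (j, true) (l, true) (q, false)) *
    gh_isometry (i, true) (q, false) (m, tm) =
  \sum_k gh_coef (i, true) (j, true) (l, true) (m, tm) k (q, false) *:
    (gh_isometry (i, true) (j, true) k * gh_isometry k (l, true) (m, tm)).
Proof.
move=> /eqP /= -> /(@gh_fusion_indicator (i, true) (_, false) _ isT) [-> ->].
rewrite (@gh_isometry1 (i, true) (_, false)) // mulr1 /= /gh_isometry /= eqxx.
rewrite /gh_simple /= alpha_rho (rz_alpha_S rz) rho_S sum_pair_bool /=; congr (_ + _).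
  rewrite (bigD1 (i + j)) //= [X in _ * X](_ : _ = 1) ?addrA ?eqxx // mulr1.
  by rewrite big1 ?addr0 // => k /negPf->; rewrite mul0r scaler0.
rewrite scaler_sumr [RHS](reindex_inj (addIr (i + j))) /=; apply: eq_bigr => k _.
congr (_ *: (T _ * T _)).
  by rewrite -[_ + i + j]addrA V4_addK.
by rewrite [i + (j + l)]addrA [k + (i + j)]addrC addrACA V4_addxx add0r [l + k]addrC V4_addK.
Qed.

Lemma gh_associator_111TS (i j l m q : V4) :
  gh_fusion (i, true) (q, true) (m, false) ->
  gh_simple (i, true) (gh_isometry (j, true) (l, true) (q, true)) *
    gh_isometry (i, true) (q, true) (m, false) =
  \sum_k gh_coef (i, true) (j, true) (l, true) (m, false) k (q, true) *:
    (gh_isometry (i, true) (j, true) k * gh_isometry k (l, true) (m, false)).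
Proof.
move=> /eqP /= ->.
rewrite /gh_isometry /gh_simple /gh_coef /= eqxx alpha_rho_T_S sum_pair_bool /= big1 ?add0r => [|k _]; last first.
  by rewrite !xpair_eqE andbF mulr0n !mulr0 ?scale0r ?scaler0.
rewrite (bigD1 (i + q + l)) //= big1 ?addr0 => [|k /negPf kE]; last first.
  by rewrite xpair_eqE kE mulr0n mulr0 scale0r.
rewrite eqxx mulr1n mulr1 V4_addK eqxx; congr (_ *: (T _ * S)).
by rewrite [i + q + l + i]addrAC [i + q + i]addrAC V4_addxx add0r addrAC.
Qed.

Lemma gh_associator_111TT (i j l m q : V4) :
  gh_simple (i, true) (gh_isometry (j, true) (l, true) (q, true)) *
    gh_isometry (i, true) (q, true) (m, true) =
  \sum_k gh_coef (i, true) (j, true) (l, true) (m, true) k (q, true) *: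
    (gh_isometry (i, true) (j, true) k * gh_isometry k (l, true) (m, true)).
Proof.
rewrite /gh_isometry /gh_simple /gh_coef /= alpha_rho_T_T sum_pair_bool /= scalerDr; congr (_ + _).
  rewrite (bigD1 (i + j)) //= eqxx big1 ?addr0 => [|k /negPf->]; last by rewrite mul0r scaler0.
  rewrite V4_shift xpair_eqE eqxx andbT.
  case: eqP => _; first by rewrite mulr1 scalerA.
  by rewrite mulr0 mul0r scale0r !scaler0.
rewrite scaler_sumr [RHS](reindex_inj (addIr (i + j))) /=; apply: eq_bigr => k _.
rewrite scalerA -[_ + i + j]addrA V4_addK.
by rewrite (V4_shift2 k i j q l m).
Qed.

Lemma gh_associatorP i j l m q :
  gh_simple i (gh_isometry j l q) * gh_isometry i q m =
  \sum_k gh_associator i j l m k q *: (gh_isometry i j k * gh_isometry k l m).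
Proof.
case: (boolP (gh_fusion j l q && gh_fusion i q m)) => [nn|]; last exact: gh_associator_zero.
rewrite /gh_associator nn; under eq_bigr => k _ do rewrite mul1r.
case/andP: nn; case: i j l q m => [i [] ] [j [] ] [l [] ] [q tq] [m tm] njlq niqm.
- case: tq njlq niqm => njlq niqm; last exact: gh_associator_111S.
  by case: tm niqm => niqm; [exact: gh_associator_111TT|exact: gh_associator_111TS].
- exact: gh_associator_110.
- rewrite gh_associator_left // (@gh_fusion_indicator (j, false) (l, true) _ isT njlq).
  rewrite (@gh_isometry1 (j, false) (l, true)) // (endo_1 (gh_simple_endo _)) mul1r scale1r.
  by rewrite /gh_isometry /=; case: (tm); rewrite !addrA // [m + i + j + _]addrA.
- rewrite gh_associator_left // (@gh_fusion_indicator (j, false) (l, false) _ isT njlq).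
  rewrite (@gh_isometry1 (j, false) (l, false)) // (endo_1 (gh_simple_endo _)) mul1r scale1r.
  by rewrite /gh_isometry /= addrA.
- rewrite gh_associator_left // (@gh_fusion_indicator (i, false) (q, tq) _ isT niqm).
  rewrite (@gh_isometry1 (i, false) (q, tq)) // mulr1.
  rewrite /gh_coef /gh_isometry /gh_simple /=; case: tq {niqm} njlq => njlq.
    rewrite alpha_T; congr (_ *: T _).
    by rewrite addrACA V4_addxx add0r.
  have -> : q = j + l by exact/eqP.
  rewrite scale1r eqxx addrA eqxx.
  exact: (rz_alpha_S rz).
- rewrite gh_associator_left // (@gh_fusion_indicator (j, true) (l, false) _ isT njlq).
  rewrite (@gh_isometry1 (j, true) (l, false)) // (endo_1 (gh_simple_endo _)) mul1r scale1r.
  by rewrite /gh_isometry /= addrA.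
- rewrite gh_associator_left // (@gh_fusion_indicator (j, false) (l, true) _ isT njlq).
  rewrite (@gh_isometry1 (j, false) (l, true)) // (endo_1 (gh_simple_endo _)) mul1r scale1r.
  by rewrite /gh_isometry /= addrA.
- rewrite gh_associator_left // (@gh_fusion_indicator (j, false) (l, false) _ isT njlq).
  rewrite (@gh_isometry1 (j, false) (l, false)) // (endo_1 (gh_simple_endo _)) mul1r scale1r.
  by rewrite /gh_isometry /= addrA.
Qed.

Local Notation one := ((0, false) : V4 * bool).

Lemma gh_simple_one : gh_simple one = id.
Proof. by apply/funext => y; rewrite /gh_simple /= (act_0 act). Qed.

Lemma gh_isometry_one_l i k : gh_isometry one i k = (k == i)%:R.
Proof. by rewrite gh_isometry_indicator //= add0r -surjective_pairing. Qed.

Lemma gh_isometry_one_r i k : gh_isometry i one k = (k == i)%:R.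
Proof. by rewrite gh_isometry_indicator /= ?andbF // addr0 orbF -surjective_pairing. Qed.

Lemma gh_fusion_basis0 : fusion_basis star
  (fun s => star_endo star s /\ spanned star gh_simple s)
  gh_simple one gh_fusion gh_isometry gh_associator.
Proof.
split.
- exact: sa.
- exact: gh_simple_endo.
- exact: gh_simple_schur.
- exact: gh_simple_one.
- exact: gh_isometry_hom.
- exact: gh_isometry0.
- exact: gh_isometryK.
- exact: gh_isometry_sum.
- exact: gh_isometry_one_l.
- exact: gh_isometry_one_r.
- by [].
- exact: gh_associatorP.
Qed.

Local Notation generated := (generated_object star rho).

Lemma generated_spanned s : generated s -> star_endo star s /\ spanned star gh_simple s.
Proof.
elim=> {s} [||s t _ hs _ ht|s t U _ [es [bs hb b1]] et U1 hU|
    s1 s2 t U1 U2 _ [_ [b1 h1 e1]] _ [_ [b2 h2 e2]] et _ hU1 _ hU2 UU].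
- exact: (unit_obj gh_fusion_basis0).
- split; first exact: re.
  exists [:: ((0, true) : V4 * bool, 1)] => [b|]; last by rewrite big_seq1 /= (star1 sa) mulr1.
  by rewrite inE => /eqP-> y; rewrite /gh_simple /= (act_0 act) mulr1 mul1r.
- exact: (comp_obj gh_fusion_basis0 hs ht).
- split=> //; have hU' := homV sa et es hU.
  exists [seq (b.1, star U * b.2) | b <- bs].
    by move=> _ /mapP[b /hb h ->] /=; exact: homM hU' h.
  rewrite big_map -[RHS]U1 -[in RHS](mulr1 (star U)) -b1 mulr_sumr mulr_suml.
  by apply: eq_bigr => b _; rewrite /= (starM sa) (starK sa) !mulrA.
split=> //; exists ([seq (b.1, U1 * b.2) | b <- b1] ++ [seq (b.1, U2 * b.2) | b <- b2]).
  move=> b; rewrite mem_cat => /orP[] /mapP[b' /[dup] hb' _ ->] /=.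
    exact: homM hU1 (h1 _ hb').
  exact: homM hU2 (h2 _ hb').
rewrite big_cat !big_map /= -[RHS]UU; congr (_ + _).
  rewrite -[X in _ = X * _](mulr1 U1) -e1 mulr_sumr mulr_suml; apply: eq_bigr => b _.
  by rewrite (starM sa) !mulrA.
rewrite -[X in _ = X * _](mulr1 U2) -e2 mulr_sumr mulr_suml; apply: eq_bigr => b _.
by rewrite (starM sa) !mulrA.
Qed.

(* Contains every simple object: [rho ^ 3]; contains the unit twice: [rho ^ 4]. *)
Lemma generated_simple i : exists2 A, star A * A = 1 & Hom (gh_simple i) (rho \o (rho \o rho)) A.
Proof.
have eT g y : T g * alpha g (rho y) = rho (rho y) * T g := rz_T rz g y.
have eS y : S * y = rho (rho y) * S := rz_S rz y.
have rV U : star (rho U) = rho (star U) by rewrite (endo_star re).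
have eT0 y : T 0 * rho y = rho (rho y) * T 0 by have := eT 0 y; rewrite (act_0 act).
case: i => g [].
  exists (rho (T 0) * T g) => [|y].
    rewrite (starM sa) rV mulrA -[_ * rho _ * rho _]mulrA -(endo_mul re) star_T_T eqxx.
    by rewrite (endo_1 re) mulr1 star_T_T eqxx.
  by rewrite /gh_simple /= -mulrA eT mulrA -(endo_mul re) eT0 (endo_mul re) mulrA.
exists (rho (T g) * S) => [|y].
  rewrite (starM sa) rV mulrA -[_ * rho _ * rho _]mulrA -(endo_mul re) star_T_T eqxx.
  by rewrite (endo_1 re) mulr1 star_S_S.
by rewrite /gh_simple /= -mulrA eS mulrA -(endo_mul re) -alpha_rho eT (endo_mul re) mulrA.
Qed.

(** ρ^4 contains the identity twice, through the orthogonal isometries [Z1] = SS and [Z2] = T_0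
    ρ(T_0) S. Composing with ρ^4 keeps the old isometries in the first copy and puts the new one in
    the second; [E] keeps every simple object available for the next step. *)
Lemma generated_many (bs : seq (V4 * bool)) : exists (kappa : M -> M) (ys : seq M) (E : V4 * bool -> M),
  [/\ generated kappa, size ys = size bs,
      forall r, (r < size bs)%N -> Hom (gh_simple (nth one bs r)) kappa (nth 0 ys r),
      forall r r', (r < size bs)%N -> (r' < size bs)%N ->
        star (nth 0 ys r) * nth 0 ys r' = (r == r')%:R &
      forall i, star (E i) * E i = 1 /\ Hom (gh_simple i) kappa (E i)].
Proof.
elim: bs => [|i bs [kappa [ys [E [gk sz hy oy hE]]]]].
  have [E hE] := choice (fun i => let: ex_intro2 A h1 h2 := generated_simple i in
    ex_intro (fun A => star A * A = 1 /\ Hom (gh_simple i) (rho \o (rho \o rho)) A) A (conj h1 h2)).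
  exists (rho \o (rho \o rho)), [::], E; split => //.
  have gr := gen_rho star rho.
  exact: (gen_comp gr (gen_comp gr gr)).
have eT g y : T g * alpha g (rho y) = rho (rho y) * T g := rz_T rz g y.
have eS y : S * y = rho (rho y) * S := rz_S rz y.
have eT0 y : T 0 * rho y = rho (rho y) * T 0 by have := eT 0 y; rewrite (act_0 act).
have rV U : star (rho U) = rho (star U) by rewrite (endo_star re).
pose mu : M -> M := rho \o (rho \o (rho \o rho)).
pose Z1 := S * S; pose Z2 := T 0 * rho (T 0) * S.
have h1 y : Z1 * y = mu y * Z1 by rewrite /Z1 -[LHS]mulrA (eS y) !mulrA eS.
have h2 y : Z2 * y = mu y * Z2.
  rewrite /Z2 -[LHS]mulrA (eS y) !mulrA -[T 0 * _ * _]mulrA -(endo_mul re) (eT0 y) (endo_mul re).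
  by rewrite !mulrA (eT0 (rho (rho y))).
have z1 : star Z1 * Z1 = 1 by rewrite /Z1 (starM sa) mulrA -[_ * star S * S]mulrA star_S_S mulr1 star_S_S.
have z12 : star Z1 * Z2 = 0.
  by rewrite /Z1 /Z2 (starM sa) !mulrA -[_ * star S * T 0]mulrA star_S_T mulr0 !mul0r.
have z2 : star Z2 * Z2 = 1.
  rewrite /Z2 !(starM sa) !mulrA -[_ * star (T 0) * T 0]mulrA star_T_T eqxx mulr1.
  by rewrite rV -[_ * rho _ * rho _]mulrA -(endo_mul re) star_T_T eqxx (endo_1 re) mulr1 star_S_S.
have z21 : star Z2 * Z1 = 0 by rewrite -[LHS](starK sa) (starM sa) (starK sa) z12 (star0 sa).
exists (mu \o kappa), (Z2 * E i :: [seq Z1 * v | v <- ys]), (fun j => Z1 * E j); split.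
- have gr := gen_rho star rho.
  exact: (gen_comp (gen_comp gr (gen_comp gr (gen_comp gr gr))) gk).
- by rewrite /= size_map sz.
- case=> [_|r] /=.
    by move=> y; rewrite -mulrA (proj2 (hE i) y) mulrA h2 -mulrA.
  rewrite ltnS => rs; rewrite (nth_map 0) ?sz // => y.
  by rewrite -mulrA (hy r rs y) mulrA h1 -mulrA.
- case=> [|r] [|r'] //=; rewrite ?ltnS => rs rs'.
  + by rewrite (starM sa) mulrA -[_ * star Z2 * _]mulrA z2 mulr1; case: (hE i).
  + by rewrite (nth_map 0) ?sz // (starM sa) mulrA -[_ * star Z2 * _]mulrA z21 mulr0 mul0r.
  + by rewrite (nth_map 0) ?sz // (starM sa) mulrA -[_ * star Z1 * _]mulrA z12 mulr0 mul0r.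
  + by rewrite !(nth_map 0) ?sz // (starM sa) mulrA -[_ * star Z1 * _]mulrA z1 mulr1 oy.
move=> j; split; first by rewrite (starM sa) mulrA -[_ * star Z1 * _]mulrA z1 mulr1; case: (hE j).
by move=> y; rewrite -mulrA (proj2 (hE j) y) mulrA h1 -mulrA.
Qed.

(** With orthonormal intertwiners y_r into a generated object, W = Σ y_r b_r^* embeds s as a
    subobject, because star W W = Σ b_r b_r^* = 1. *)
Lemma spanned_generated s : star_endo star s -> spanned star gh_simple s -> generated s.
Proof.
move=> es [bs hb b1].
have [kappa [ys [_ [gk sz hy oy _]]]] := generated_many [seq b.1 | b <- bs].
rewrite size_map in sz hy oy.
have ek := proj1 (generated_spanned gk).
pose W := \sum_(r < size bs) nth 0 ys r * star (nth (one, 0) bs r).2.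
have hbr (r : 'I_(size bs)) : Hom (gh_simple (nth (one, 0) bs r).1) s (nth (one, 0) bs r).2.
  by apply: hb; exact: mem_nth.
apply: (gen_sub (sigma := kappa) (V := W)) => //.
  rewrite /Defs.isometry /W (star_sum sa) -b1 (big_nth (one, 0)) big_mkord mulr_suml.
  apply: eq_bigr => r _; rewrite mulr_sumr (bigD1 r) //= big1 ?addr0 => [|r' r'r].
    by rewrite (starM sa) (starK sa) mulrA -[_ * star _ * nth _ _ _]mulrA oy // eqxx mulr1.
  rewrite (starM sa) (starK sa) mulrA -[_ * star _ * nth _ _ _]mulrA oy //.
  by rewrite eq_sym [_ == _ :> nat](negPf r'r) mulr0 mul0r.
apply: hom_sum => r _ _; apply: (@homM _ _ _ (gh_simple (nth (one, 0) bs r).1)).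
  by have := hy r (ltn_ord r); rewrite (nth_map (one, 0)).
exact: (homV sa (gh_simple_endo _) es (hbr r)).
Qed.

Lemma gh_fusion_basis : fusion_basis star generated gh_simple one gh_fusion gh_isometry gh_associator.
Proof.
have -> : generated = (fun s => star_endo star s /\ spanned star gh_simple s).
  apply/funext => s; apply/propext; split; first exact: generated_spanned.
  by case; exact: spanned_generated.
exact: gh_fusion_basis0.
Qed.

End Realization.

(** * Symmetries of the associator *)

Section KleinPermutations.

Definition V4_bit (b : bool) (g : V4) : bool := (if b then g.1 else g.2) != 0.

Lemma V4_bitD b : {morph V4_bit b : g h / g + h >-> g (+) h}.
Proof. by case: b; apply: V4_ind; apply: V4_ind. Qed.

Lemma V4_bit0 b : V4_bit b 0 = false.
Proof. by case: b. Qed.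

Lemma V4_eq_bit g h : (forall b, V4_bit b g = V4_bit b h) -> g = h.
Proof.
move=> e; move: (e true) (e false).
by elim/V4_ind: g {e}; elim/V4_ind: h.
Qed.

End KleinPermutations.

Ltac V4_arith := apply: V4_eq_bit => ?; rewrite ?V4_bitD ?V4_bit0;
  repeat (case: (V4_bit _ _) => //).

Section KleinPermutations.
Implicit Types (p q : {perm V4}) (g h k : V4) (i j l : V4 * bool).

(** A permutation preserves the sum of all four elements, which is 0. For distinct nonzero g and h
    this is the affine relation; the other cases are immediate. *)
Lemma V4_perm_affine p g h : p (g + h) = p g + p h + p 0.
Proof.
have sum0 : p 0 + p Va + p Vb + p Vc = 0.
  have s0 : \sum_(g : V4) g = 0 by rewrite V4_sum add0r !V4_addE.
  rewrite -(V4_sum (fun g => p g)) -[RHS]s0 [RHS](reindex_inj (@perm_inj _ p)).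
  by [].
apply: V4_eq_bit => b; have := congr1 (V4_bit b) sum0; rewrite !V4_bitD V4_bit0.
by elim/V4_ind: g; elim/V4_ind: h; rewrite ?V4_addE ?add0r ?addr0;
  do 4!case: (V4_bit b (p _)).
Qed.

Definition gh_lift_fun p (i : V4 * bool) : V4 * bool :=
  if i.2 then (p i.1, true) else (p i.1 + p 0, false).

Lemma gh_lift_inj p : injective (gh_lift_fun p).
Proof.
move=> [g []] [h []] // /(congr1 fst) /=; first by move/perm_inj->.
by move/addIr/perm_inj->.
Qed.

(* Every permutation [p] of [V4] is affine; its linear part acts on the [alpha g]. *)
Definition gh_lift p : {perm V4 * bool} := perm (@gh_lift_inj p).

Lemma gh_lift_true p g : gh_lift p (g, true) = (p g, true).
Proof. by rewrite permE. Qed.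

Lemma gh_lift_false p g : gh_lift p (g, false) = (p g + p 0, false).
Proof. by rewrite permE. Qed.

Lemma gh_liftM p q i : gh_lift (p * q) i = gh_lift q (gh_lift p i).
Proof.
case: i => g []; first by rewrite !gh_lift_true permM.
rewrite !gh_lift_false !permM (V4_perm_affine q); congr (_, _); V4_arith.
Qed.

Lemma gh_lift1 i : gh_lift 1 i = i.
Proof. by case: i => g []; rewrite ?gh_lift_true ?gh_lift_false !perm1 ?addr0. Qed.

Lemma gh_fusion_lift p i j l : gh_fusion (gh_lift p i) (gh_lift p j) (gh_lift p l) = gh_fusion i j l.
Proof.
have eqE (g h : V4) (a b : bool) : ((g, a) == (h, b)) = (g == h) && (a == b) by [].
have eqD (k g h : V4) : (g + k == h + k) = (g == h) by exact: (inj_eq (@addIr _ k)).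
have pE g h : p g + p h = p (g + h) + p 0 by rewrite V4_perm_affine; V4_arith.
have pE' g h : p g + p 0 + p h = p (g + h) by rewrite V4_perm_affine; V4_arith.
have pE'' g h : p g + (p h + p 0) = p (g + h) by rewrite V4_perm_affine; V4_arith.
have pE3 g h : p g + p 0 + (p h + p 0) = p (g + h) + p 0 by rewrite V4_perm_affine; V4_arith.
case: i j l => [g []] [h []] [u []]; rewrite ?gh_lift_true ?gh_lift_false /gh_fusion //=;
  rewrite ?eqE ?andbF ?andbT //.
- by rewrite (pE g) eqD (inj_eq perm_inj).
- by rewrite (pE'' g) (inj_eq perm_inj).
- by rewrite (pE' g) (inj_eq perm_inj).
- by rewrite (pE3 g) eqD (inj_eq perm_inj).
Qed.

Lemma V4_perm3 p g h k : p (g + h + k) + p g + p h = p k.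
Proof. by rewrite 2!V4_perm_affine; V4_arith. Qed.

Lemma V4_add3 g h k : g + h + k + g + h = k.
Proof. V4_arith. Qed.

End KleinPermutations.

(** * The symmetry condition, channel by channel *)

Section Equations.
Variables (R : realType) (x : gh_data R V4).
Local Notation E := (eps x).
Local Notation A := (amp x).
Implicit Types (p : {perm V4}) (g h l u y w : V4) (i j k m q : V4 * bool) (c : V4 * bool -> V4 * bool -> V4 * bool -> R[i]).

Definition gh_symmetric p c : Prop := forall i j (l : V4 * bool) m k q,
  gh_fusion i j k -> gh_fusion k l m -> gh_fusion j l q -> gh_fusion i q m ->
  c i j k * c k l m *
    gh_coef x (gh_lift p i) (gh_lift p j) (gh_lift p l) (gh_lift p m) (gh_lift p k) (gh_lift p q) =
  c j l q * c i q m * gh_coef x i j l m k q.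

Definition sym00 c g h := c (g, false) (h, false) (g + h, false).
Definition sym01 c g h := c (g, false) (h, true) (g + h, true).
Definition sym10 c g h := c (g, true) (h, false) (g + h, true).
Definition symS c g h := c (g, true) (h, true) (g + h, false).
Definition symT c g h y := c (g, true) (h, true) (g + h + y, true).

(* The equations of [gh_symmetric], listed according to the types of [i], [j], [l] and to
   the channels [S], [T u], [T y], [T w] of [k], [q], [m]. *)
Record gh_equations p c : Prop := {
  eq000 : forall g h l, sym00 c g h * sym00 c (g + h) l = sym00 c h l * sym00 c g (h + l);
  eq001 : forall g h l, sym00 c g h * sym01 c (g + h) l = sym01 c h l * sym01 c g (h + l);
  eq010 : forall g h l, sym01 c g h * sym10 c (g + h) l = sym10 c h l * sym01 c g (h + l);
  eq100 : forall g h l, sym10 c g h * sym10 c (g + h) l = sym00 c h l * sym10 c g (h + l);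
  eq011S : forall g h l, sym01 c g h * symS c (g + h) l = symS c h l * sym00 c g (h + l);
  eq011T : forall g h l y, sym01 c g h * symT c (g + h) l y * E (p g + p 0) (p y) =
    symT c h l y * sym01 c g (h + l + y) * E g y;
  eq101S : forall g h l, sym10 c g h * symS c (g + h) l = sym01 c h l * symS c g (h + l);
  eq101T : forall g h l y, sym10 c g h * symT c (g + h) l y = sym01 c h l * symT c g (h + l) y;
  eq110S : forall g h l, symS c g h * sym00 c (g + h) l = sym10 c h l * symS c g (h + l);
  eq110T : forall g h l y, symT c g h y * sym10 c (g + h + y) l = sym10 c h l * symT c g (h + l) y;
  eq111SS : forall g h l, symS c g h * sym01 c (g + h) l = symS c h l * sym10 c g (h + l);
  eq111TS : forall g h l u, symT c g h u * symT c (g + h + u) l u = symS c h l * sym10 c g (h + l);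
  eq111ST : forall g h l y, symS c g h * sym01 c (g + h) l * E (p g + p y) (p y) =
    symT c h l y * symT c g (h + l + y) y * E (g + y) y;
  eq111TTS : forall g h l y, symT c g h y * symS c (g + h + y) l * E (p g + p y) (p y) =
    symT c h l y * symS c g (h + l + y) * E (g + y) y;
  eq111TTT : forall g h l u y w, symT c g h u * symT c (g + h + u) l (u + y + w) *
      (E (p g + p y) (p y) * A (p y) (p y + p u) (p y + p w)) =
    symT c h l y * symT c g (h + l + y) w * (E (g + y) y * A y (y + u) (y + w)) }.

Lemma gh_fusion_channel g h (k : V4 * bool) : gh_fusion (g, true) (h, true) k ->
  k = (g + h, false) \/ exists u, k = (g + h + u, true).
Proof.
case: k => k []; rewrite /gh_fusion /=; last by move/eqP->; left.
by move=> _; right; exists (g + h + k); rewrite V4_addKr.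
Qed.

Let dinv : R[i] := (gh_dim R V4)^-1%:C%C.
Let sdinv : R[i] := (Num.sqrt (gh_dim R V4))^-1%:C%C.

Lemma dinv_neq0 : dinv != 0.
Proof. by rewrite /dinv fmorph_eq0 invr_eq0 -(fmorph_eq0 (real_complex R)) (dimC_neq0 R). Qed.

Lemma sdinv_neq0 : sdinv != 0.
Proof.
have d_gt0 : 0 < gh_dim R V4 by rewrite gh_dim_V4 ltr_wpDr ?sqrtr_ge0.
by rewrite /sdinv fmorph_eq0 invr_eq0 gt_eqF // sqrtr_gt0.
Qed.

Lemma gh_symmetricP p c : gh_symmetric p c -> gh_equations p c.
Proof.
move=> H.
have e3 g h (l : V4) : g + (h + l) = g + h + l by rewrite addrA.
have e4 g h (l : V4) y : g + (h + l + y) = g + h + l + y by rewrite !addrA.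
split => [g h l|g h l|g h l|g h l|g h l|g h l y|g h l|g h l y|g h l|g h l y|g h l|g h l u|g h l y|g h l y|g h l u y w].
- have := H (g, false) (h, false) (l, false) (g + h + l, false) (g + h, false) (h + l, false).
  by rewrite /gh_fusion /gh_coef !gh_lift_false /= e3 !eqxx !mulr1 /sym00 e3; apply.
- have := H (g, false) (h, false) (l, true) (g + h + l, true) (g + h, false) (h + l, true).
  by rewrite /gh_fusion /gh_coef !gh_lift_false /= e3 !eqxx !mulr1 /sym00 /sym01 e3; apply.
- have := H (g, false) (h, true) (l, false) (g + h + l, true) (g + h, true) (h + l, true).
  by rewrite /gh_fusion /gh_coef !gh_lift_false !gh_lift_true /= e3 !eqxx !mulr1 /sym01 /sym10 e3; apply.
- have := H (g, true) (h, false) (l, false) (g + h + l, true) (g + h, true) (h + l, false).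
  by rewrite /gh_fusion /gh_coef !gh_lift_false !gh_lift_true /= e3 !eqxx !mulr1 /sym00 /sym10 e3; apply.
- have := H (g, false) (h, true) (l, true) (g + h + l, false) (g + h, true) (h + l, false).
  by rewrite /gh_fusion /gh_coef !gh_lift_false !gh_lift_true /= e3 !eqxx !mulr1 /sym00 /sym01 /symS e3; apply.
- have := H (g, false) (h, true) (l, true) (g + (h + l + y), true) (g + h, true) (h + l + y, true).
  rewrite /gh_fusion /gh_coef !gh_lift_false !gh_lift_true /= !eqxx V4_perm3 V4_add3 /symT /sym01 e4.
  by apply.
- have := H (g, true) (h, false) (l, true) (g + h + l, false) (g + h, true) (h + l, true).
  by rewrite /gh_fusion /gh_coef !gh_lift_false !gh_lift_true /= e3 !eqxx !mulr1 /sym01 /sym10 /symS e3; apply.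
- have := H (g, true) (h, false) (l, true) (g + h + l + y, true) (g + h, true) (h + l, true).
  by rewrite /gh_fusion /gh_coef !gh_lift_false !gh_lift_true /= !eqxx !mulr1 /sym01 /sym10 /symT e3; apply.
- have := H (g, true) (h, true) (l, false) (g + h + l, false) (g + h, false) (h + l, true).
  by rewrite /gh_fusion /gh_coef !gh_lift_false !gh_lift_true /= e3 !eqxx !mulr1 /sym00 /sym10 /symS e3; apply.
- have := H (g, true) (h, true) (l, false) (g + h + l + y, true) (g + h + y, true) (h + l, true).
  rewrite /gh_fusion /gh_coef !gh_lift_false !gh_lift_true /= (addrAC (g + h)) !eqxx !mulr1 /sym10 /symT e3.
  by rewrite (addrAC (g + h)); apply.
- have := H (g, true) (h, true) (l, true) (g + h + l, true) (g + h, false) (h + l, false).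
  rewrite /gh_fusion /gh_coef !gh_lift_false !gh_lift_true /= e3 !eqxx /sym01 /sym10 /symS e3 => /(_ isT isT isT isT).
  exact: (mulIf dinv_neq0).
- have := H (g, true) (h, true) (l, true) (g + h + l, true) (g + h + u, true) (h + l, false).
  rewrite /gh_fusion /gh_coef !gh_lift_false !gh_lift_true /= e3 !eqxx /sym10 /symS /symT e3.
  rewrite (_ : g + h + u + l + u = g + h + l); last by V4_arith.
  by move=> /(_ isT isT isT isT); exact: (mulIf sdinv_neq0).
- have := H (g, true) (h, true) (l, true) (g + h + l, true) (g + h, false) (h + l + y, true).
  rewrite /gh_fusion /gh_coef !gh_lift_false !gh_lift_true /= !eqxx V4_perm3 V4_add3.
  have e : g + h + l + g + (h + l + y) = y by V4_arith.
  have e' : p (g + h + l) + p g + p (h + l + y) = p y.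
    by rewrite !V4_perm_affine; V4_arith.
  rewrite e e' !eqxx /sym01 /symS /symT mulr1n mul1r !mulrA => /(_ isT isT isT isT).
  rewrite (_ : g + (h + l + y) + y = g + h + l); last by V4_arith.
  exact: (mulIf sdinv_neq0).
- have := H (g, true) (h, true) (l, true) (g + h + l + y, false) (g + h + y, true) (h + l + y, true).
  rewrite /gh_fusion /gh_coef !gh_lift_false !gh_lift_true /= V4_perm3 V4_add3 e4.
  have e : g + h + l + y = g + h + y + l by V4_arith.
  have e' : p (g + h + l + y) + p 0 + p l = p (g + h + y) by rewrite e V4_perm_affine; V4_arith.
  have e'' : g + h + l + y + l = g + h + y by V4_arith.
  by rewrite /symS /symT e4 e' e'' e !eqxx !mulr1 => /(_ isT isT isT isT).
- have := H (g, true) (h, true) (l, true) (g + (h + l + y) + w, true) (g + h + u, true) (h + l + y, true).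
  rewrite /gh_fusion /gh_coef !gh_lift_true /= !V4_perm3 !V4_add3 /symT.
  rewrite (_ : g + h + u + l + (u + y + w) = g + (h + l + y) + w); last by V4_arith.
  by apply.
Qed.

Lemma gh_equationsP p c : gh_equations p c -> gh_symmetric p c.
Proof.
move=> H; have e3 g h (l : V4) : g + h + l = g + (h + l) by rewrite addrA.
have e4 g h (l : V4) y : g + h + l + y = g + (h + l + y) by rewrite !addrA.
move=> [g b1] [h b2] [l b3] m k q.
case: b1 b2 b3 => [] [] [].
- move=> /gh_fusion_channel[->|[u ->]]; last first.
    move=> nm /gh_fusion_channel[e|[y e]]; subst q.
      rewrite /gh_fusion /= => /eqP ?; subst m.
      have := eq111TS H g h l u; rewrite /symS /symT /sym10.
      rewrite (_ : g + h + u + l + u = g + (h + l)); last by V4_arith.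
      by rewrite /gh_coef !gh_lift_true !gh_lift_false /= => ->.
    case: m nm => m [] nm; last first.
      rewrite /gh_fusion /= in nm *; have mE' := eqP nm; move=> /eqP mE.
      have uE : u = g + h + l + m by rewrite mE'; V4_arith.
      have yE : y = g + h + l + m by rewrite mE; V4_arith.
      have {uE yE} uy : u = y by rewrite uE -yE.
      move: mE'; rewrite {}uy => mE' {nm}; have := eq111TTS H g h l y; rewrite /symS /symT -mE mE'.
      rewrite /gh_coef !gh_lift_true !gh_lift_false /= V4_perm3 V4_add3.
      have e' : p (g + h + y + l) + p 0 + p l = p (g + h + y) by rewrite V4_perm_affine; V4_arith.
      have e'' : g + h + y + l + l = g + h + y by V4_arith.
      by rewrite e' e'' !eqxx !mulr1.
    move=> _; pose w := m + (g + (h + l + y)).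
    have mE : m = g + (h + l + y) + w by rewrite /w; V4_arith.
    have := eq111TTT H g h l u y w; rewrite /symT mE.
    rewrite (_ : g + h + u + l + (u + y + w) = g + (h + l + y) + w); last by V4_arith.
    by rewrite /gh_coef !gh_lift_true /= !V4_perm3 !V4_add3.
  rewrite /gh_fusion /= => /eqP ? /gh_fusion_channel[e|[y e]]; subst m q => /=.
    have := eq111SS H g h l; rewrite /symS /sym01 /sym10 e3.
    by rewrite /gh_coef !gh_lift_true !gh_lift_false /= => ->.
  move=> _; have := eq111ST H g h l y; rewrite /symS /symT /sym01.
  rewrite (_ : g + (h + l + y) + y = g + h + l); last by V4_arith.
  rewrite /gh_coef !gh_lift_true !gh_lift_false /= V4_perm3 V4_add3.
  have e : g + h + l + g + (h + l + y) = y by V4_arith.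
  have e' : p (g + h + l) + p g + p (h + l + y) = p y.
    by rewrite !V4_perm_affine; V4_arith.
  by rewrite e e' !eqxx mulr1n mul1r !mulrA => ->.
- move=> /gh_fusion_channel[->|[y ->]]; rewrite /gh_fusion /= => /eqP-> /eqP-> _.
    have := eq110S H g h l; rewrite /symS /sym00 /sym10 e3.
    by rewrite /gh_coef !gh_lift_true !gh_lift_false /= !mulr1.
  have := eq110T H g h l y; rewrite /symT /sym10.
  rewrite (_ : g + (h + l) + y = g + h + y + l); last by V4_arith.
  by rewrite /gh_coef !gh_lift_true !gh_lift_false /= !mulr1.
- rewrite /gh_fusion /= => /eqP -> nm /eqP ->; case: m nm => m [] /= nm mE.
    pose y := m + (g + (h + l)); have -> : m = g + (h + l) + y by rewrite /y; V4_arith.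
    have := eq101T H g h l y; rewrite /symT /sym10 /sym01 !e3.
    by rewrite /gh_coef !gh_lift_true !gh_lift_false /= !mulr1.
  move/eqP: mE nm => -[->] _.
  have := eq101S H g h l; rewrite /symS /sym10 /sym01 !e3.
  by rewrite /gh_coef !gh_lift_true !gh_lift_false /= !mulr1.
- rewrite /gh_fusion /= => /eqP-> /eqP-> /eqP-> _.
  have := eq100 H g h l; rewrite /sym00 /sym10 !e3.
  by rewrite /gh_coef !gh_lift_true !gh_lift_false /= !mulr1.
- rewrite /gh_fusion /= => /eqP-> nm /gh_fusion_channel[->|[y ->]] /eqP mE; subst m.
    have := eq011S H g h l; rewrite /symS /sym00 /sym01 !e3.
    by rewrite /gh_coef !gh_lift_true !gh_lift_false /= !mulr1.
  have := eq011T H g h l y; rewrite /symT /sym01 e4.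
  by rewrite /gh_coef !gh_lift_true !gh_lift_false /= V4_perm3 V4_add3.
- rewrite /gh_fusion /= => /eqP-> /eqP-> /eqP-> _.
  have := eq010 H g h l; rewrite /sym01 /sym10 !e3.
  by rewrite /gh_coef !gh_lift_true !gh_lift_false /= !mulr1.
- rewrite /gh_fusion /= => /eqP-> /eqP-> /eqP-> _.
  have := eq001 H g h l; rewrite /sym00 /sym01 !e3.
  by rewrite /gh_coef !gh_lift_true !gh_lift_false /= !mulr1.
- rewrite /gh_fusion /= => /eqP-> /eqP-> /eqP-> _.
  have := eq000 H g h l; rewrite /sym00 !e3.
  by rewrite /gh_coef !gh_lift_false /= !mulr1.
Qed.

End Equations.

(** * Permutations realized by symmetries of the associator *)

Section RealizedSymmetries.
Variables (R : realType) (x : gh_data R V4).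
Local Notation C := R[i].
Implicit Types (p q : {perm V4}) (g h : V4) (c : V4 * bool -> V4 * bool -> V4 * bool -> C).
Local Notation one := ((0, false) : V4 * bool).

Definition gh_realized p : Prop :=
  exists c, associator_symmetry one gh_fusion (gh_associator x) (gh_lift p) c.

Lemma gh_realized_intro p c : (forall i j k, c i j k * (c i j k)^* = 1) ->
  (forall i, c one i i = 1) -> (forall i, c i one i = 1) -> gh_symmetric x p c -> gh_realized p.
Proof.
move=> c1 cl cr H; exists c; split => //.
- exact: gh_fusion_lift.
- by rewrite gh_lift_false V4_addxx.
move=> i j l m k q nk nklm nq nm.
rewrite /gh_associator !gh_fusion_lift nq nm !mul1r; exact: H.
Qed.

Lemma gh_symmetricM p q c c' : gh_symmetric x p c -> gh_symmetric x q c' ->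
  gh_symmetric x (p * q) (fun i j k => c i j k * c' (gh_lift p i) (gh_lift p j) (gh_lift p k)).
Proof.
move=> H H' i j l m k r nk nklm nr nm; rewrite !gh_liftM.
have e := H _ _ _ _ _ _ nk nklm nr nm.
have /(_ _)/= := H' (gh_lift p i) (gh_lift p j) (gh_lift p l) (gh_lift p m) (gh_lift p k) (gh_lift p r).
rewrite !gh_fusion_lift => /(_ nk nklm nr nm) e'.
rewrite [in LHS]mulrACA -[LHS]mulrA [X in _ * X = _]e' [LHS]mulrCA [X in _ * X = _]e.
by rewrite [LHS]mulrA [X in X * _ = _]mulrC [X in X * _ = _]mulrACA.
Qed.

Lemma associator_symmetric p c : associator_symmetry one gh_fusion (gh_associator x) (gh_lift p) c ->
  gh_symmetric x p c.
Proof.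
move=> H i j l m k q nk nklm nq nm; have := sy_assoc H nk nklm nq nm.
by rewrite /gh_associator !gh_fusion_lift nq nm !mul1r.
Qed.

Lemma gh_realizedM p q : gh_realized p -> gh_realized q -> gh_realized (p * q).
Proof.
move=> [c H] [c' H'].
apply: (gh_realized_intro (c := fun i j k => c i j k * c' (gh_lift p i) (gh_lift p j) (gh_lift p k))).
- by move=> i j k; rewrite rmorphM /= mulrACA (sy_unit H) (sy_unit H') mulr1.
- by move=> i; rewrite (sy_one_l H) (sy_one H) (sy_one_l H') mulr1.
- by move=> i; rewrite (sy_one_r H) (sy_one H) (sy_one_r H') mulr1.
exact: (gh_symmetricM (associator_symmetric H) (associator_symmetric H')).
Qed.

Lemma gh_realized_automorphism p : p 0 = 0 ->
  (forall g h, eps x (p g) (p h) = eps x g h) ->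
  (forall g h k, amp x (p g) (p h) (p k) = amp x g h k) -> gh_realized p.
Proof.
move=> p0 pe pA; apply: (gh_realized_intro (c := fun _ _ _ => 1)) => //.
  by move=> i j k; rewrite rmorph1 mulr1.
have pD g h : p g + p h = p (g + h) by rewrite V4_perm_affine p0 addr0.
by apply: gh_equationsP; split; rewrite /sym00 /sym01 /sym10 /symS /symT => *;
  rewrite ?p0 ?addr0 ?pD ?pe ?pA.
Qed.

Lemma gh_realized1 : gh_realized 1.
Proof. by apply: gh_realized_automorphism => *; rewrite !perm1. Qed.

Lemma V4_translation_inj (t : V4) : injective (fun g : V4 => g + t).
Proof. exact: addIr. Qed.

Definition V4_translation (t : V4) : {perm V4} := perm (@V4_translation_inj t).

(** Translation by t changes the signs ε by the character b = ε(·, t). The T channels are corrected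
    by a square root [tau] of b; the remaining condition on [tau] is the equation in which every
    channel is of type T. *)
Lemma gh_realized_translation (t : V4) (tau : V4 -> C) : gh_solution x ->
  tau 0 = 1 -> (forall u, tau u * (tau u)^* = 1) ->
  (forall u, tau u ^+ 2 = eps x u t) ->
  (forall u y w, eps x (u + y) t * (tau u * tau (u + y + w)) * amp x (y + t) (y + u) (y + w) =
     tau y * tau w * amp x y (y + u) (y + w)) ->
  gh_realized (V4_translation t).
Proof.
move=> Hx tau0 tauJ tau2 tauA; pose b u := eps x u t.
have b0 : b 0 = 1 by exact: (sol_eps0 Hx).
have bb u : b u * b u = 1 by exact: (sol_eps2 Hx).
have bD u v : b (u + v) = b u * b v by exact: (sol_eps_charl Hx).
have bJ u : b u * (b u)^* = 1 by rewrite /b (sol_epsJ Hx) bb.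
pose c (i j k : V4 * bool) : C :=
  if i.2 then
    if j.2 && k.2 then b i.1 * tau (k.1 + i.1 + j.1) else b j.1
  else 1.
apply: (gh_realized_intro (c := c)).
- move=> [g []] [h []] [k []]; rewrite /c /= ?rmorph1 ?mulr1 ?bJ //.
  by rewrite rmorphM /= mulrACA bJ tauJ mulr1.
- by [].
- by move=> [g []]; rewrite /c /= ?b0.
have cT g h u : symT c g h u = b g * tau u.
  by rewrite /symT /c /= V4_add3.
have eD u v w : eps x u (v + w) = eps x u v * eps x u w by exact: (sol_eps_bichar Hx).
have tt u : tau u * tau u = b u by rewrite -expr2 tau2.
have tE y : V4_translation t y = y + t by rewrite permE.
have tD g y : g + t + (y + t) = g + y by V4_arith.
have eT g y : eps x g (y + t) = eps x g y * b g := eD g y t.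
apply: gh_equationsP; split=> [g h l|g h l|g h l|g h l|g h l|g h l y|g h l|g h l y|g h l|g h l y|g h l|g h l u|g h l y|g h l y|g h l u y w];
  rewrite ?cT /sym00 /sym01 /sym10 /symS /c /= ?tE ?tD ?addr0 ?eT ?bD ?mul1r ?mulr1 //.
- by have := bb g; move: (b g) (b h) (tau y) (eps x g y) => u v w e hu; ring: hu.
- by have := bb h; move: (b g) (b h) (tau y) => bg bh ty hu; ring: hu.
- by have := bb l; move: (b h) (b l) => bh bl hu; ring: hu.
- by rewrite mulrC.
- by have := bb l; move: (b h) (b l) => bh bl hu; ring: hu.
- have := tt u; have := bb g; have := bb l; have := bb u.
  by move: (b g) (b h) (b l) (b u) (tau u) => bg bh bl bu tu h1 h2 h3 h4; ring: h1 h2 h3 h4.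
- have := tt y.
  by move: (b g) (b h) (b y) (tau y) (eps x _ _) => bg bh by' ty e h1; ring: h1.
- have := bb g; have := bb h.
  by move: (b g) (b h) (b y) (b l) (tau y) (eps x _ _) => bg bh by' bl ty e h1 h2; ring: h1 h2.
have := tauA u y w; rewrite -/(b _) bD.
have := bb g.
move: (eps x (g + y) y) (b g) (b h) (b u) (b y) (amp x (y + t) _ _) (amp x y _ _).
move=> e bg bh bu by' a a' h1 h2.
transitivity (bg * bh * e * (bg * bg) * (bu * by' * (tau u * tau (u + y + w)) * a)); first by ring.
by rewrite h1 h2; ring.
Qed.

End RealizedSymmetries.

Section Generators.
Variables (R : realType) (s z : R[i]).
Hypothesis sz : V4_parameters s z.
Local Notation C := R[i].

Definition V4_rotation_fun (g : V4) : V4 := (g.2, g.1 + g.2).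

Lemma V4_rotation_inj : injective V4_rotation_fun.
Proof. by move=> g h; elim/V4_ind: g; elim/V4_ind: h. Qed.

Definition V4_rotation : {perm V4} := perm V4_rotation_inj.

Lemma V4_rotationE : (V4_rotation 0 = 0) * (V4_rotation Va = Vb) *
  (V4_rotation Vb = Vc) * (V4_rotation Vc = Va).
Proof. by rewrite /V4_rotation !permE; do !split; apply/eqP. Qed.

Lemma gh_realized_rotation : gh_realized (V4_data s z) V4_rotation.
Proof.
apply: gh_realized_automorphism; first by rewrite V4_rotationE.
  by move=> g h; elim/V4_ind: g; elim/V4_ind: h; rewrite !V4_rotationE /= /chi /table /= ?opprK.
move=> g h k; rewrite /= /V4_amp.
by elim/V4_ind: g; elim/V4_ind: h; elim/V4_ind: k;
  rewrite !V4_rotationE /chi /table /= ?opprK.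
Qed.

Lemma V4_solution_data : gh_solution (V4_data s z).
Proof. by apply/V4_solutions; exists s, z. Qed.

Lemma gh_realized_translation_a : gh_realized (V4_data s z) (V4_translation Va).
Proof.
have i2 : 'i * 'i = -1 :> C by rewrite -expr2 sqrCi.
have iJ : 'i * ('i)^* = 1 :> C by rewrite conjCi mulrN i2 opprK.
have [ss _] := sz.
(* Square roots of χ(u, a), which depends on s; their signs are chosen to satisfy the condition on
   the amplitudes. *)
pose tau (u : V4) : C := nth 0 (if s == 1 then [:: 1; 'i; 'i; -1] else [:: 1; 'i; 1; - 'i])
  (index u [:: 0; Va; Vb; Vc]).
have N1 : (-1 == 1 :> C) = false by rewrite -subr_eq0 -opprD oppr_eq0 -[1 + 1]/(2%:R) pnatr_eq0.
apply: (@gh_realized_translation _ _ _ tau V4_solution_data).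
- by rewrite /tau; case: ifP.
- by move=> u; move: ss; rewrite !inE => /orP[]/eqP sE; rewrite /tau sE ?eqxx ?N1;
    elim/V4_ind: u => /=; rewrite ?rmorphN ?mulrNN ?iJ ?rmorph1 ?mulr1.
- by move=> u; move: ss; rewrite !inE => /orP[]/eqP sE; rewrite /tau sE ?eqxx ?N1;
    elim/V4_ind: u; rewrite /= /chi /table /= ?expr1n ?sqrrN ?expr1n ?expr2 ?i2 ?opprK.
move=> u y w; rewrite /= /V4_amp.
by move: ss; rewrite !inE => /orP[]/eqP sE; rewrite /tau sE ?eqxx ?N1;
  elim/V4_ind: y; elim/V4_ind: u; elim/V4_ind: w;
  rewrite ?V4_addE ?addr0 ?add0r ?V4_addE ?addr0 /chi /table /=; ring: i2.
Qed.

End Generators.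

(** * Parity and the generation of the even permutations *)

Section Parity.
Implicit Types (p q : {perm V4}) (g h t : V4).

Lemma V4_translationE t g : V4_translation t g = g + t.
Proof. by rewrite permE. Qed.

Lemma odd_V4_translation t : odd_perm (V4_translation t) = false.
Proof.
have [t0|t0] := eqVneq t 0.
  have -> : V4_translation t = 1%g by apply/permP => g; rewrite V4_translationE perm1 t0 addr0.
  by rewrite odd_perm1.
have [u [u0 ut]] : exists u : V4, u != 0 /\ u != t by elim/V4_ind: t t0 => // _; [exists Vb|exists Va|exists Va].
have -> : V4_translation t = (tperm 0 t * tperm u (u + t))%g.
  apply/permP => g; rewrite V4_translationE permM.
  elim/V4_ind: t t0 ut; elim/V4_ind: u u0 => // _ _ _; rewrite !V4_addE;
    elim/V4_ind: g; by rewrite ?add0r ?V4_addE !permE /= ?permE.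
rewrite odd_permM !odd_tperm eq_sym t0 -[X in X != _]addr0 (inj_eq (addrI u)) eq_sym t0.
by [].
Qed.

Lemma odd_V4_rotation : odd_perm V4_rotation = false.
Proof.
have -> : V4_rotation = (tperm Va Vb * tperm Va Vc)%g.
  by apply/permP => g; rewrite permM; elim/V4_ind: g; rewrite V4_rotationE !permE /= ?permE.
by rewrite odd_permM !odd_tperm.
Qed.

Lemma V4_perm_fix2 p : p 0 = 0 -> p Va = Va -> p = 1%g \/ p = tperm Vb Vc.
Proof.
move=> p0 pa; have n g h : g != h -> p g != p h by rewrite (inj_eq perm_inj).
have : (p Vb = Vb /\ p Vc = Vc) \/ (p Vb = Vc /\ p Vc = Vb).
  move: (n Vb 0 isT) (n Vb Va isT) (n Vc 0 isT) (n Vc Va isT) (n Vb Vc isT).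
  rewrite p0 pa; elim/V4_ind: (p Vb) => //; elim/V4_ind: (p Vc) => // *; by [left|right].
case=> [] [pb pc]; [left|right]; apply/permP => g; rewrite ?perm1.
  by elim/V4_ind: g.
by elim/V4_ind: g; rewrite ?p0 ?pa ?pb ?pc ?tpermL ?tpermR ?tpermD.
Qed.

Lemma V4_rotation3 : (V4_rotation * (V4_rotation * V4_rotation))%g = 1%g.
Proof.
by apply/permP => g; rewrite !permM perm1; elim/V4_ind: g; rewrite !V4_rotationE.
Qed.

End Parity.

Section EvenPermutations.
Variables (R : realType) (s z : R[i]).
Hypothesis sz : V4_parameters s z.
Local Notation realized := (gh_realized (V4_data s z)).
Implicit Types (p q : {perm V4}) (g h t : V4).

Let rot := gh_realized_rotation s z.
Let rot2 := gh_realizedM rot rot.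

(** Conjugation by the rotation carries the translation by a to those by b and c. *)
Lemma gh_realized_translations t : realized (V4_translation t).
Proof.
have next u : realized (V4_translation u) -> realized (V4_translation (V4_rotation u)).
  move=> ru; have -> : V4_translation (V4_rotation u) =
      (V4_rotation * V4_rotation * (V4_translation u * V4_rotation))%g.
    apply/permP => g; rewrite !permM !V4_translationE.
    by elim/V4_ind: u {ru}; elim/V4_ind: g; rewrite ?V4_rotationE ?addr0 ?add0r ?V4_addE ?V4_rotationE.
  exact: (gh_realizedM rot2 (gh_realizedM ru rot)).
have ra := gh_realized_translation_a sz.
have := next _ ra; have := next _ (next _ ra); rewrite !V4_rotationE => rc rb.
elim/V4_ind: t => //.
have -> : V4_translation 0 = 1%g by apply/permP => g; rewrite V4_translationE perm1 addr0.
exact: gh_realized1.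
Qed.

(** A translation makes p fix 0, and a power of the rotation makes it fix a as well. What is left is
    the identity or the transposition of b and c, and parity excludes the latter. *)
Lemma even_gh_realized p : odd_perm p = false -> realized p.
Proof.
move=> ev; set t := p 0.
have -> : p = (p * V4_translation t * V4_translation t)%g.
  by apply/permP => g; rewrite !permM !V4_translationE V4_addK.
apply: gh_realizedM (gh_realized_translations t).
have p0 : (p * V4_translation t)%g 0 = 0 by rewrite permM V4_translationE V4_addxx.
have {ev} : odd_perm (p * V4_translation t) = false by rewrite odd_permM ev odd_V4_translation.
move: (p * _)%g p0 => {t}{}p p0 ev.
have key q r : realized r -> (q * r)%g = 1%g -> odd_perm q = false -> (p * q)%g Va = Va ->
    q 0 = 0 -> realized p.
  move=> rr qr qev pa q0.
  have -> : p = r; last by [].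
  have pq0 : (p * q)%g 0 = 0 by rewrite permM p0 q0.
  have [e|e] := V4_perm_fix2 pq0 pa.
    by rewrite -[LHS]mulg1 -qr mulgA e mul1g.
  by have := odd_permM p q; rewrite e odd_tperm ev qev.
have : p Va != 0 by rewrite -p0 (inj_eq perm_inj).
have r3 := V4_rotation3; have r3' : (V4_rotation * V4_rotation * V4_rotation)%g = 1%g by rewrite -mulgA.
have odd2 : odd_perm (V4_rotation * V4_rotation) = false by rewrite odd_permM odd_V4_rotation.
move: (erefl (p Va)); elim/V4_ind: {2 3}(p Va) => // pa _.
- by apply: (key 1%g 1%g); rewrite ?permM ?pa ?perm1 ?mulg1 ?odd_perm1 //; exact: gh_realized1.
- by apply: (key (V4_rotation * V4_rotation)%g V4_rotation);
    rewrite ?permM ?pa ?V4_rotationE //; exact: rot.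
- by apply: (key V4_rotation (V4_rotation * V4_rotation)%g);
    rewrite ?permM ?pa ?V4_rotationE ?odd_V4_rotation //; exact: rot2.
Qed.

End EvenPermutations.

(** * Normal form of a symmetry up to coboundaries *)

Section NormalForm.
Variables (R : realType) (x : gh_data R V4).
Hypothesis Hx : gh_solution x.
Local Notation C := R[i].
Local Notation E := (eps x).
Local Notation A := (amp x).
Implicit Types (p q : {perm V4}) (g h l u y w : V4) (c : V4 * bool -> V4 * bool -> V4 * bool -> C).

Definition gh_nonvanishing c : Prop := forall i j k, gh_fusion i j k -> c i j k != 0.

Definition gh_gauge (mu : V4 * bool -> C) c i j k : C := c i j k * mu i * mu j / mu k.

Lemma gh_symmetric_gauge p c mu : (forall i, mu i != 0) ->
  gh_symmetric x p c -> gh_symmetric x p (gh_gauge mu c).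
Proof.
move=> mu0 H i j l m k q nk nklm nq nm; have := H i j l m k q nk nklm nq nm.
rewrite /gh_gauge.
set f := gh_coef x (gh_lift p i) _ _ _ _ _; set f' := gh_coef x i _ _ _ _ _.
move: f f' (c i j k) (c k l m) (c j l q) (c i q m) => f f' c1 c2 c3 c4 e.
have := mu0 k; have := mu0 q; have := mu0 m.
move: (mu i) (mu j) (mu l) (mu m) (mu k) (mu q) => mi mj ml mm mk mq m0 q0 k0.
transitivity (c1 * c2 * f * (mi * mj * ml / mm)); first by field; rewrite m0 k0.
by rewrite e; field; rewrite m0 q0.
Qed.

Lemma gh_nonvanishing_gauge c mu : (forall i, mu i != 0) ->
  gh_nonvanishing c -> gh_nonvanishing (gh_gauge mu c).
Proof. by move=> mu0 H i j k /H c0; rewrite /gh_gauge !mulf_neq0 ?invr_eq0. Qed.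

Lemma gh_gauge_normal c : gh_nonvanishing c -> exists2 mu, (forall i, mu i != 0) &
  forall g, sym01 (gh_gauge mu c) g 0 = 1.
Proof.
move=> c0; have a0 g : sym01 c g 0 != 0 by apply: c0; rewrite /gh_fusion /= eqxx.
exists (fun i => if i.2 then sym01 c i.1 0 else (sym01 c 0 0)^-1).
  by move=> [g []] /=; rewrite ?invr_eq0.
move=> g; have := a0 g; have := a0 0; rewrite /gh_gauge /sym01 /= !addr0 => b0 b1.
by rewrite mulfVK ?divff.
Qed.

Section Normal.
Variables (p : {perm V4}) (c : V4 * bool -> V4 * bool -> V4 * bool -> C).
Hypotheses (H : gh_equations x p c) (c0 : gh_nonvanishing c) (p0 : p 0 = 0).
Hypothesis c1 : forall g, sym01 c g 0 = 1.
Local Notation om := (sym00 c).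
Local Notation tau := (symT c 0 0).

(** Measures how far p is from preserving ε; by [om_twist] it is the commutator of the cocycle
    [om]. *)
Definition twist p g y : C := E (p g) (p y) * E g y.

Lemma E0 g : E 0 g = 1. Proof. exact: sol_eps0. Qed.
Lemma Er0 g : E g 0 = 1. Proof. exact: (gh_P1_0 Hx). Qed.
Lemma EE g h : E g h * E g h = 1. Proof. exact: sol_eps2. Qed.

Lemma om_neq0 g h : om g h != 0.
Proof. by apply: c0; rewrite /gh_fusion /= eqxx. Qed.

Lemma symT_neq0 g h y : symT c g h y != 0.
Proof. exact: c0. Qed.

Lemma normal01 g h : sym01 c g h = om g h.
Proof. by have := eq001 H g h 0; rewrite !c1 !addr0 mulr1 mul1r. Qed.

Lemma om0l g : om 0 g = 1.
Proof.
have := eq000 H 0 0 g; rewrite !add0r => e; apply: (mulIf (om_neq0 0 g)).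
by rewrite -e mul1r -normal01 c1 mul1r.
Qed.

Lemma om0r g : om g 0 = 1.
Proof. by rewrite -normal01 c1. Qed.

Lemma normal10 g l : sym10 c g l = sym10 c 0 l * om g l.
Proof. by have := eq010 H g 0 l; rewrite !addr0 !add0r c1 mul1r normal01. Qed.

(** Together with [normal01], [normal10], [normal_beta] and [normalS], this expresses all of c by
    the cocycle [om], the values [tau] and the scalar [symS c 0 0], which is tied to [tau] by
    [normal_tau_sqr]. *)
Lemma normalT g l y : symT c g l y = tau y * om g y * twist p g y * om (g + y) l.
Proof.
have b0 : sym10 c 0 l != 0 by apply: c0; rewrite /gh_fusion /= eqxx.
have := eq110T H g 0 l y; rewrite !addr0 !add0r normal10 mulrCA => /(mulfI b0) <-.
congr (_ * _); have := eq011T H g 0 0 y; rewrite !addr0 !add0r p0 !addr0 c1 mul1r normal01 => e.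
rewrite /twist -[LHS]mulr1 -(EE (p g) (p y)) mulrA e; ring.
Qed.

Lemma twist0 g : twist p g 0 = 1.
Proof. by rewrite /twist p0 !Er0 mulr1. Qed.

Lemma normal_twist0 g : twist p 0 g = 1.
Proof. by rewrite /twist p0 !E0 mulr1. Qed.

Lemma normal_beta h : sym10 c 0 h = 1.
Proof.
have := eq101T H 0 h 0 0; rewrite !addr0 !add0r c1 mul1r (normalT h 0) (normalT 0 h).
rewrite !addr0 !om0r !om0l !twist0 !mulr1 => /(canRL (mulfK (symT_neq0 0 0 0))) ->.
by rewrite divff ?symT_neq0.
Qed.

(** Inserting α_h between two copies of ρ equates the T channels of (h,0) and (0,h); [normalT]
    evaluates them with h to the left or to the right of y in [om]. *)
Lemma om_twist y h : om y h = twist p h y * om h y.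
Proof.
have := eq101T H 0 h 0 y; rewrite !addr0 !add0r c1 mul1r normal_beta (normalT h 0) (normalT 0 h).
rewrite om0r om0l normal_twist0 add0r !mulr1 mul1r -[X in X = _]mulrA => /(mulfI (symT_neq0 0 0 y)) <-.
by rewrite mulrC.
Qed.

Lemma twist_diag u : twist p u u = 1.
Proof. by apply: (mulIf (om_neq0 u u)); rewrite -om_twist mul1r. Qed.

Lemma normal_tau_sqr u : tau u ^+ 2 * om u u = symS c 0 0.
Proof.
have := eq111TS H u 0 0 u; rewrite !addr0 V4_addxx normal10 normal_beta (normalT u 0) !om0r.
rewrite twist_diag !mulr1 => <-; ring.
Qed.

Lemma normalS g l : symS c g l = symS c 0 0 * om g l.
Proof.
have S0 h : symS c 0 h = symS c 0 0.
  by have := eq110S H 0 0 h; rewrite !addr0 !add0r om0l normal_beta mulr1 mul1r.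
by have := eq011S H g 0 l; rewrite !addr0 !add0r c1 mul1r S0.
Qed.

Lemma normal_amp u w : tau u * om u u * tau (u + w) * A 0 (p u) (p w) =
  tau 0 * tau w * om u w * twist p u w * A 0 u w.
Proof.
have := eq111TTT H u 0 0 u 0 w.
rewrite !addr0 !add0r p0 !add0r !Er0 V4_addxx !(normalT u 0) twist_diag ?om0l ?om0r !mulr1 !mul1r.
by rewrite !mulrA.
Qed.

End Normal.

(** Symmetric cocycles correspond to abelian extensions, which split because the nonzero complex
    numbers are divisible: square roots chosen at a and b determine the cochain at c. *)
Lemma symmetric_cocycle (om : V4 -> V4 -> C) :
  (forall g h l, om g h * om (g + h) l = om h l * om g (h + l)) ->
  (forall g h, om g h = om h g) -> (forall g, om 0 g = 1) -> (forall g h, om g h != 0) ->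
  exists2 la : V4 -> C, (forall g, la g != 0) & forall g h, om g h * la g * la h = la (g + h).
Proof.
move=> co sym om0 n0.
pose la := table [:: [:: 1; (sqrtC (om Va Va))^-1; (sqrtC (om Vb Vb))^-1;
  om Va Vb / sqrtC (om Va Va) / sqrtC (om Vb Vb)]] 0.
have [l0 la_a lb lc] : [/\ la 0 = 1, la Va = (sqrtC (om Va Va))^-1, la Vb = (sqrtC (om Vb Vb))^-1 &
  la Vc = om Va Vb / sqrtC (om Va Va) / sqrtC (om Vb Vb)] by [].
have qa : la Va ^+ 2 * om Va Va = 1 by rewrite la_a exprVn sqrtCK mulVf.
have qb : la Vb ^+ 2 * om Vb Vb = 1 by rewrite lb exprVn sqrtCK mulVf.
have {}lc : la Vc = om Va Vb * la Va * la Vb by rewrite lc la_a lb.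
have na : la Va != 0 by rewrite la_a invr_eq0 sqrtC_eq0.
have nb : la Vb != 0 by rewrite lb invr_eq0 sqrtC_eq0.
have := co Va Va Vb; have := co Vb Vb Va; have := co Vc Vc Va.
rewrite !V4_addE !om0 !mulr1 (sym Vb Va) (sym Vc Va) (sym Vc Vb) => ecc ebb eaa.
have om0' g : om g 0 = 1 by rewrite sym.
exists la.
  by elim/V4_ind; rewrite ?l0 ?lc ?oner_neq0 // !mulf_neq0.
move: qa qb; rewrite eaa ebb => qa qb.
move=> g h; elim/V4_ind: g; elim/V4_ind: h;
  rewrite ?V4_addE ?addr0 ?add0r ?l0 ?om0 ?om0' ?mul1r ?mulr1 ?lc ?eaa ?ebb ?ecc
    ?(sym Vb Va) ?(sym Vc Va) ?(sym Vc Vb) //.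
all: move: qa qb; move: (la Va) (la Vb) (om Va Vb) (om Va Vc) (om Vb Vc) => a b o1 o2 o3 qa qb.
all: first [by ring: qa | by ring: qb | idtac].
transitivity (a ^+ 2 * (o1 * o2) * (b ^+ 2 * (o1 * o3))); first by ring.
by rewrite qa qb mulr1.
Qed.

(* A symmetry over the identity is, up to coboundaries, a character of [V4] on the channels [T]. *)
Lemma gh_symmetric1 c : gh_symmetric x 1 c -> gh_nonvanishing c ->
  exists mu : V4 * bool -> C, exists kap : V4 -> C, [/\ forall i, mu i != 0,
    forall g, kap g != 0, forall g h, kap (g + h) = kap g * kap h &
    forall i j k, gh_fusion i j k ->
      c i j k * mu i * mu j = (if [&& i.2, j.2 & k.2] then kap (k.1 + i.1 + j.1) else 1) * mu k].
Proof.
move=> Hc c0; have [mu1 mu10 n1] := gh_gauge_normal c0.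
set c' := gh_gauge mu1 c in n1.
have H := gh_symmetricP (gh_symmetric_gauge mu10 Hc).
have c0' := gh_nonvanishing_gauge mu10 c0; rewrite -/c' in H c0'.
have p0 : (1%g : {perm V4}) 0 = 0 by rewrite perm1.
pose om := sym00 c'; pose tau := symT c' 0 0.
have tw g y : twist 1 g y = 1 by rewrite /twist !perm1 EE.
have om0 g : om 0 g = 1 := om0l H c0' n1 g.
have omn g h : om g h != 0 := om_neq0 c0' g h.
have taun y : tau y != 0 := symT_neq0 c0' 0 0 y.
have cT g l y : symT c' g l y = tau y * om g y * om (g + y) l.
  by rewrite (normalT H c0' p0 n1) tw mulr1.
have [la la0 laE] : exists2 la : V4 -> C, (forall g, la g != 0) & forall g h, om g h * la g * la h = la (g + h).
  apply: symmetric_cocycle => //; first exact: eq000 H.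
  by move=> g h; rewrite /om (om_twist H c0' p0 n1) tw mul1r.
have s0 : symS c' 0 0 = tau 0 ^+ 2 by rewrite -(normal_tau_sqr H c0' p0 n1 0) -/om om0 mulr1.
pose mu2 (i : V4 * bool) := if i.2 then la i.1 / tau 0 else la i.1.
exists (fun i => mu1 i * mu2 i), (fun y => tau y / (la y * tau 0)); split.
- by move=> [g []]; rewrite /mu2 /= !mulf_neq0 ?invr_eq0.
- by move=> g; rewrite mulf_neq0 // invr_eq0 mulf_neq0.
(* Over the identity the same nonzero amplitude stands on both sides and cancels; what remains says
   that [tau] is multiplicative up to [om]. *)
- move=> u w; have := eq111TTT H 0 0 0 0 u w.
  rewrite !perm1 !add0r !addr0 [in LHS]mulrA [in RHS]mulrA.
  have Eu : E u u != 0 by apply: contra_eq_neq (EE u u) => ->; rewrite mulr0 eq_sym oner_eq0.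
  move=> /(mulIf (sol_amp_neq0 Hx _ _ _))/(mulIf Eu); rewrite (cT 0 u w) om0 add0r mulr1 -/tau => e.
  have := laE w u; rewrite addrC => <-.
  have -> : tau (u + w) = tau u * (tau w * om w u) / tau 0 by rewrite -e mulrAC divff ?mul1r.
  have := la0 u; have := la0 w; have := taun 0; have := omn w u.
  by move: (la u) (la w) (tau 0) (om w u) => a b t o o0 t0 b0 a0; field; rewrite a0 b0 t0 o0.
move=> i j k nk.
suff e : c' i j k * mu2 i * mu2 j =
    (if [&& i.2, j.2 & k.2] then tau (k.1 + i.1 + j.1) / (la (k.1 + i.1 + j.1) * tau 0) else 1) * mu2 k.
  rewrite [RHS]mulrCA -e /c' /gh_gauge.
  by have := mu10 k; move: (mu1 i) (mu1 j) (mu1 k) (mu2 i) (mu2 j) (c i j k) => a b d e1 f k' d0; field.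
have t00 := taun 0.
case: i j k nk => [g []] [h []] k.
- move=> /gh_fusion_channel[->|[y ->]]; rewrite /mu2 /=; last first.
    rewrite V4_add3 -/(symT c' g h y) cT (addrAC g h) -!laE.
    move: (la0 y) t00; move: (la g) (la h) (la y) (tau 0) (tau y) (om g y) (om (g + y) h).
    by move=> u v w r r' o o' w0 r0; field; rewrite w0 r0.
  rewrite -/(symS c' g h) (normalS H c0' p0 n1) s0 -laE -/om.
  by move: t00; move: (la g) (la h) (om g h) (tau 0) => u v o r r0; field.
- rewrite /gh_fusion /= => /eqP ->; rewrite /mu2 /= -/(sym10 c' g h) mul1r.
  by rewrite (normal10 H n1) (normal_beta H c0' p0 n1) mul1r -laE -/om; ring.
- rewrite /gh_fusion /= => /eqP ->; rewrite /mu2 /= -/(sym01 c' g h) mul1r.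
  by rewrite (normal01 H n1) -laE -/om; ring.
- by rewrite /gh_fusion /= => /eqP ->; rewrite /mu2 /= -/(sym00 c' g h) mul1r laE.
Qed.

End NormalForm.

(** * No odd permutation is realized; characters of G *)

Section OddPermutations.
Variables (R : realType) (s z : R[i]).
Hypothesis sz : V4_parameters s z.
Local Notation C := R[i].
Local Notation x := (V4_data s z).
Implicit Types (p q : {perm V4}) (g h : V4) (c : V4 * bool -> V4 * bool -> V4 * bool -> C).

Let Hx : gh_solution x := V4_solution_data sz.

(* A symmetry over the transposition [(b c)] would make its cocycle both symmetric and
   antisymmetric at [(b, c)]. *)
Lemma transposition_not_symmetric c : gh_nonvanishing c -> ~ gh_symmetric x (tperm Vb Vc) c.
Proof.
move=> c0 Hc; have [mu mu0 n1] := gh_gauge_normal c0.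
have c0' := gh_nonvanishing_gauge mu0 c0.
have H := gh_symmetricP (gh_symmetric_gauge mu0 Hc).
set c' := gh_gauge mu c in n1 c0' H.
have p0 : tperm Vb Vc 0 = 0 by rewrite tpermD.
have pa : tperm Vb Vc Va = Va by rewrite tpermD.
have pb : tperm Vb Vc Vb = Vc by rewrite tpermL.
have pc : tperm Vb Vc Vc = Vb by rewrite tpermR.
have [e /[dup] /sign_parameters_neq0 z0 [ss _ zJ]] := sign_parametersP sz.
have s2 : s * s = 1 by case: ss => ->; rewrite ?mulrNN mulr1.
have zz : z^* * z^* = z * z by rewrite zJ mulrACA -signr_addb addbb mul1r.
set om := sym00 c'; pose tau := symT c' 0 0.
have omn g h : om g h != 0 := om_neq0 c0' g h.
have taun g : tau g != 0 := symT_neq0 c0' 0 0 g.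
have twE g h : twist x (tperm Vb Vc) g h = chi s (tperm Vb Vc g) (tperm Vb Vc h) * chi s g h by [].
have tab : twist x (tperm Vb Vc) Va Vb = -1.
  by rewrite twE pa pb /chi /table /= mulNr s2.
have tac : twist x (tperm Vb Vc) Va Vc = -1.
  by rewrite twE pa pc /chi /table /= mulrN s2.
have tcb : twist x (tperm Vb Vc) Vc Vb = -1.
  by rewrite twE pb pc /chi /table /= mulrN s2.
have ebc : om Vb Vc = - om Vc Vb.
  by rewrite /om (om_twist Hx H c0' p0 n1) tcb mulN1r.
have D0 : (dimC - 1)^-1 != 0 :> C by rewrite invr_eq0 dimC_sub1_neq0.
have e1 := normal_amp Hx H c0' p0 n1 Va Vb; have e2 := normal_amp Hx H c0' p0 n1 Va Vc.
move: e1 e2; rewrite pa pb pc !V4_addE tab tac -/om -/(tau _) -/(tau _) -/(tau _) -/(tau 0).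
rewrite /= /V4_amp -/(@dimC R) /table /= => e1 e2.
have qb := normal_tau_sqr Hx H c0' p0 n1 Vb; have qc := normal_tau_sqr Hx H c0' p0 n1 Vc.
have cb := eq000 H Va Vb Vb; have cc := eq000 H Va Vc Vc.
rewrite -/om !V4_addE /om (om0r H n1) mulr1 -/om in cb; rewrite -/om !V4_addE /om (om0r H n1) mulr1 -/om in cc.
rewrite -/om -/(tau _) in qb qc; rewrite -/(tau _) in e1 e2.
(* The amplitude equations at (a,b) and (a,c) exchange z with its conjugate; both have the same
   square, so the product of the equations gives this relation. *)
have tbc : tau Vc ^+ 2 * om Va Vc = tau Vb ^+ 2 * om Va Vb.
  have P0 : tau Va * om Va Va * tau 0 * ((dimC - 1)^-1) ^+ 2 * (z * z) != 0.
    by do ?[exact: taun | exact: omn | exact: D0 | exact: z0 | apply: mulf_neq0 | apply: expf_neq0].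
  apply: (mulIf P0); rewrite -[in LHS]zz.
  transitivity (- ((tau Va * om Va Va * tau Vc * ((dimC - 1)^-1 * z^*)) *
    (tau 0 * tau Vc * om Va Vc * -1 * ((dimC - 1)^-1 * z^*)))); first by ring.
  by rewrite e1 -e2; ring.
(* Both sides equal the scalar [symS c' 0 0], computed once through b and once through c; the sign
   is that of om(b,c) = -om(c,b). *)
have : tau Vb ^+ 2 * om Va Vb * om Vc Vb = - (tau Vb ^+ 2 * om Va Vb * om Vc Vb).
  transitivity (symS c' 0 0); first by rewrite -qb -cb mulrA.
  by rewrite -qc -cc mulrA tbc ebc mulrN.
move/eqP; rewrite -subr_eq0 opprK -mulr2n mulrn_eq0 /= => /eqP.
by apply/eqP; do ?[exact: taun | exact: omn | apply: mulf_neq0 | apply: expf_neq0].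
Qed.

(** Composing an odd p with a suitable even permutation, which is realized, gives the transposition
    of b and c. *)
Lemma symmetric_even p c : gh_nonvanishing c -> gh_symmetric x p c -> odd_perm p = false.
Proof.
move=> c0 Hc; case podd : (odd_perm p) => //; exfalso.
have qev : odd_perm (p^-1 * tperm Vb Vc) = false by rewrite odd_permM odd_permV podd odd_tperm.
have [c' Hc'] := even_gh_realized sz qev.
have := gh_symmetricM Hc (associator_symmetric Hc'); rewrite mulKVg.
apply/transposition_not_symmetric => i j k nk; apply: mulf_neq0; first exact: c0.
have := sy_unit Hc' (gh_lift p i) (gh_lift p j) (gh_lift p k).
by apply: contra_eq_neq => ->; rewrite mul0r eq_sym oner_eq0.
Qed.

(** The pairing χ is nondegenerate: its four rows are the four characters of G, which are determined
    by their signs at a and b. *)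
Lemma V4_characters (kap : V4 -> C) : (forall g, kap g != 0) ->
  (forall g h, kap (g + h) = kap g * kap h) -> exists h, forall g, chi s h g = kap g.
Proof.
move=> k0 kD; have [e _] := sign_parametersP sz.
have kk g : kap g = 1 \/ kap g = -1.
  have : kap g ^+ 2 == 1.
    rewrite expr2 -kD V4_addxx; apply/eqP/(mulfI (k0 0)).
    by rewrite -kD addr0 mulr1.
  by rewrite sqrf_eq1 => /orP[]/eqP; [left|right].
have kz : kap 0 = 1 by apply: (mulfI (k0 0)); rewrite -kD addr0 mulr1.
have kc : kap Vc = kap Va * kap Vb by rewrite -kD V4_addE.
have [ss _] := sz; move: ss; rewrite !inE => ss.
have : exists h, chi s h Va = kap Va /\ chi s h Vb = kap Vb.
  by case/orP: ss => /eqP->; case: (kk Va) => ->; case: (kk Vb) => ->;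
    first [by exists 0|by exists Va; rewrite /chi /table /= ?opprK
      |by exists Vb; rewrite /chi /table /= ?opprK|by exists Vc; rewrite /chi /table /= ?opprK].
case=> h [ha hb]; exists h; elim/V4_ind => //.
- by rewrite kz; exact: (gh_P1_0 Hx).
- by have := sol_eps_bichar Hx h Va Vb; rewrite V4_addE kc -ha -hb.
Qed.

End OddPermutations.

(** * Outer automorphisms *)

Section TransportPerm.
Variables (T T' : finType) (e : T -> T') (e' : T' -> T).
Hypotheses (eK : cancel e e') (e'K : cancel e' e).
Implicit Types p q : {perm T}.

Lemma transport_perm_inj p : injective (fun i => e (p (e' i))).
Proof. by move=> i j /(can_inj eK)/perm_inj/(can_inj e'K). Qed.

Definition transport_perm p : {perm T'} := perm (@transport_perm_inj p).

Lemma transport_permE p i : transport_perm p (e i) = e (p i).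
Proof. by rewrite permE eK. Qed.

Lemma transport_permM p q : transport_perm (p * q) = (transport_perm p * transport_perm q)%g.
Proof. by apply/permP => j; rewrite -[j]e'K permM !transport_permE permM. Qed.

Lemma transport_perm_injective : injective transport_perm.
Proof.
move=> p q pq; apply/permP => i; apply: (can_inj eK).
by rewrite -!transport_permE pq.
Qed.

Lemma transport_permV p : transport_perm p^-1%g = (transport_perm p)^-1%g.
Proof.
apply: (mulgI (transport_perm p)); rewrite -transport_permM !mulgV.
by apply/permP => j; rewrite -[j]e'K transport_permE !perm1.
Qed.

Lemma odd_transport_perm p : odd_perm (transport_perm p) = odd_perm p.
Proof.
have [ts -> dts] := prod_tpermP p.
elim: ts dts => [_|t ts IH /= /andP[dt dts]].
  rewrite big_nil odd_perm1 (_ : transport_perm 1 = 1%g) ?odd_perm1 //.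
  by apply/permP => j; rewrite -[j]e'K transport_permE !perm1.
rewrite big_cons transport_permM !odd_permM IH //; congr (_ (+) _).
have -> : transport_perm (tperm t.1 t.2) = tperm (e t.1) (e t.2).
  apply/permP => j; rewrite -[j]e'K transport_permE.
  by case: tpermP => [->|->|/eqP n1 /eqP n2]; rewrite ?tpermL ?tpermR // tpermD // (can_eq eK) eq_sym.
by rewrite !odd_tperm (can_eq eK).
Qed.

End TransportPerm.

(** The square of α_gρ has more than one channel, whereas a product with an invertible object has
    only one, so pi preserves the two types of simple objects. Its effect on α_g then follows from
    α_g ρ = α_gρ. *)
Lemma gh_lift_exists (pi : {perm V4 * bool}) : pi (0, false) = (0, false) ->
  (forall i j k, gh_fusion i j k -> gh_fusion (pi i) (pi j) (pi k)) ->
  exists p : {perm V4}, pi = gh_lift p.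
Proof.
move=> pi1 piN.
have pt g : (pi (g, true)).2.
  case E : (pi (g, true)).2 => //.
  have h1 : gh_fusion (g, true) (g, true) (0, false) by rewrite /gh_fusion /= V4_addxx.
  have h2 : gh_fusion (g, true) (g, true) (0, true) by [].
  have := piN _ _ _ h1; have := piN _ _ _ h2; rewrite /gh_fusion E /= => /eqP e2 /eqP e1.
  by have := perm_inj (etrans e1 (esym e2)).
pose P g := (pi (g, true)).1.
have piE g : pi (g, true) = (P g, true) by rewrite [LHS]surjective_pairing pt.
have Pinj : injective P.
  move=> g h e; have : pi (g, true) = pi (h, true) by rewrite !piE e.
  by move/perm_inj/(congr1 fst).
exists (perm Pinj); apply/permP => -[g []]; first by rewrite gh_lift_true permE piE.
rewrite gh_lift_false !permE.
have pf : (pi (g, false)).2 = false.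
  case E : (pi (g, false)).2 => //.
  pose h := (perm Pinj)^-1%g (pi (g, false)).1.
  have : pi (h, true) = pi (g, false).
    rewrite piE [RHS]surjective_pairing E; congr (_, _).
    by rewrite -[LHS](permE Pinj) permKV.
  by move/perm_inj.
have h : gh_fusion (g, false) (0, true) (g, true) by rewrite /gh_fusion /= addr0.
have := piN _ _ _ h; rewrite !piE /gh_fusion pf /= => /eqP/(congr1 fst)/= e.
by rewrite [LHS]surjective_pairing pf e V4_addK.
Qed.

(** * Isomorphism classes of objects and invertible objects *)

Section ObjectIso.
Variables (R : realType) (M : algType R[i]) (star : M -> M).
Hypothesis sa : star_algebra star.
Local Notation Hom := (@intertwiner R M).
Implicit Types (s t k : M -> M).

Definition object_iso s t : Prop := exists v w, [/\ Hom s t v, v * w = 1 & w * v = 1].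

Lemma object_iso_refl s : object_iso s s.
Proof. by exists 1, 1; split; rewrite ?mulr1 //; exact: hom1. Qed.

Lemma object_iso_sym s t : object_iso s t -> object_iso t s.
Proof. by case=> v [w [hv vw wv]]; exists w, v; split=> //; exact: (hom_inv hv wv vw). Qed.

Lemma object_iso_trans s t k : object_iso s t -> object_iso t k -> object_iso s k.
Proof.
case=> v [w [hv vw wv]] [v' [w' [hv' vw' wv']]]; exists (v' * v), (w * w'); split.
- exact: (homM hv' hv).
- by rewrite -mulrA (mulrA v) vw mul1r.
- by rewrite -mulrA (mulrA w') wv' mul1r.
Qed.

Lemma object_iso_comp s s' t t' : star_endo star s -> object_iso s s' -> object_iso t t' ->
  object_iso (s \o t) (s' \o t').
Proof.
move=> hs [v [w [hv vw wv]]] [v' [w' [hv' vw' wv']]]; exists (v * s v'), (s w' * w); split.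
- exact: (hom_ten hs hv hv').
- by rewrite -mulrA (mulrA (s v')) -(endo_mul hs) vw' (endo_1 hs) mul1r.
- by rewrite -mulrA (mulrA w) wv mul1r -(endo_mul hs) wv' (endo_1 hs).
Qed.

Lemma object_iso_unitary s t v : Hom s t v -> unitary star v -> object_iso s t.
Proof. by move=> hv [h1 h2]; exists v, (star v). Qed.

Lemma object_iso_functor (C : (M -> M) -> Prop) F s t : is_functor C F -> C s -> C t ->
  object_iso s t -> object_iso (F s) (F t).
Proof.
move=> hF hs ht [v [w [hv vw wv]]]; have hw := hom_inv hv wv vw.
exists (fhom F s t v), (fhom F t s w); split; first exact: (fun_hom hF).
  by rewrite -(fun_comp hF) // vw (fun_id hF).
by rewrite -(fun_comp hF) // wv (fun_id hF).
Qed.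

Variables (I : finType) (C : (M -> M) -> Prop) (X : I -> M -> M) (one : I)
  (N : I -> I -> I -> bool) (V : I -> I -> I -> M) (Phi : I -> I -> I -> I -> I -> I -> R[i]).
Hypothesis fb : fusion_basis star C X one N V Phi.

Lemma object_iso_simple i j : object_iso (X i) (X j) -> i = j.
Proof.
case=> v [w [hv vw wv]]; apply/eqP/negPn/negP => ij.
have [a vE a0] := fb_schur fb hv; move: vw; rewrite vE a0 // scale0r mul0r => /eqP.
by rewrite eq_sym oner_eq0.
Qed.

Lemma object_iso_fusion i j l : object_iso (X i \o X j) (X one) -> N i j l -> l = one.
Proof.
case=> v [w [hv vw wv]] nl; apply/eqP/negPn/negP => l1.
have [a vE a0] := fb_schur fb (homM hv (fb_hom fb i j l)).
have e : V i j l = w * (v * V i j l) by rewrite mulrA wv mul1r.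
have := fb_iso fb nl; rewrite [X in _ * X]e vE a0 // scale0r !mulr0.
by move/eqP; rewrite eq_sym oner_eq0.
Qed.

Section Invertible.
Variables (X0 Y0 : M -> M) (ev cv : M).
Hypothesis iv : invertible_object star C X0 Y0 ev cv.

Lemma hom_id_scalar T : Hom id id T -> exists a : R[i], T = a *: 1.
Proof.
rewrite -(fb_one fb) => /(fb_schur fb)[a -> _]; by exists a.
Qed.

(** An endomorphism of X0 is also one of X0 Y0, which [cv] identifies with the identity, so it is a
    scalar; [ev] does the same for Y0. Hence both are irreducible and isomorphic to simple
    objects. *)
Lemma invertible_simple : exists i j, [/\ object_iso (X i) X0, object_iso (X j) Y0 &
  object_iso (X i \o X j) (X one)].
Proof.
case: iv => CX CY uev hev ucv hcv _ _; have eX := obj_endo fb CX; have eY := obj_endo fb CY.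
have hcv' := homV sa (endo_id star) (endo_comp eX eY) hcv.
have hev' := homV sa (endo_comp eY eX) (endo_id star) hev.
have irrX T : Hom X0 X0 T -> exists a : R[i], T = a *: 1.
  move=> hT; have hT' : Hom (X0 \o Y0) (X0 \o Y0) T by move=> y; exact: hT.
  have [a aE] := hom_id_scalar (homM hcv' (homM hT' hcv)); exists a.
  case: ucv => u1 u2; rewrite -[T]mul1r -u2 -[X in X = _]mulr1 -u2 -!mulrA.
  by rewrite (mulrA T) (mulrA (star cv)) aE -scalerAl mul1r -scalerAr u2.
have irrY T : Hom Y0 Y0 T -> exists a : R[i], T = a *: 1.
  move=> hT; have hT' : Hom (Y0 \o X0) (Y0 \o X0) T by move=> y; exact: hT.
  have [a aE] := hom_id_scalar (homM hev (homM hT' hev')); exists a.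
  case: uev => u1 u2; rewrite -[T]mul1r -u1 -[X in X = _]mulr1 -u1 -!mulrA.
  by rewrite (mulrA T) (mulrA ev) aE -scalerAl mul1r -scalerAr u1.
have [i [v hv uv]] := irreducible_simple fb CX irrX.
have [j [w hw uw]] := irreducible_simple fb CY irrY.
have iX := object_iso_unitary hv uv; have iY := object_iso_unitary hw uw.
exists i, j; split=> //; rewrite (fb_one fb).
apply: (object_iso_trans (object_iso_comp (fb_endo fb i) iX iY)).
exact/object_iso_sym/(object_iso_unitary hcv ucv).
Qed.

End Invertible.
End ObjectIso.

(** * The outer class of an auto-equivalence is its permutation *)

Section Outer.
Variables (R : realType) (s z : R[i]) (M : algType R[i]) (star : M -> M)
  (alpha : V4 -> M -> M) (rho : M -> M) (S : M) (T : V4 -> M).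
Local Notation x := (V4_data s z).
Hypothesis sz : V4_parameters s z.
Hypothesis sa : star_algebra star.
Hypothesis factor : is_factor M.
Hypothesis rz : realization x star alpha rho S T.
Local Notation Hom := (@intertwiner R M).
Local Notation CC := (generated_object star rho).
Local Notation X := (gh_simple alpha rho).
Local Notation V := (gh_isometry S T).
Local Notation one := ((0, false) : V4 * bool).
Local Notation Aut := (star_monoidal_autoequivalence star CC).
Implicit Types (p q : {perm V4}) (g h : V4) (y : M) (F : monoidal_data M)
  (c : V4 * bool -> V4 * bool -> V4 * bool -> R[i]).

Let Hx : gh_solution x := V4_solution_data sz.
Let fb := gh_fusion_basis Hx sa factor rz.
Let act := rz_action rz.
Let ae g := act_endo act g.
Let CX := simple_obj fb.

Local Notation skeletal := (skeleton star X one gh_fusion V).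

(** Unlike a skeleton, this involves no chosen unitaries or scalars and depends only on isomorphism
    classes of objects. *)
Definition induces F p : Prop := forall g, object_iso (X (p g, true)) (F (X (g, true))).

Lemma induces_unique F p q : induces F p -> induces F q -> p = q.
Proof.
move=> hp hq; apply/permP => g.
have := object_iso_trans (hp g) (object_iso_sym (hq g)).
by move/(object_iso_simple fb)/(congr1 fst).
Qed.

Lemma induces_comp F F' p q : is_functor CC F -> is_functor CC F' -> induces F p -> induces F' q ->
  induces (comp_monoidal F F') (q * p).
Proof.
move=> hF hF' hp hq g; rewrite permM; apply: object_iso_trans (hp (q g)) _.
exact: (object_iso_functor hF (CX _) (fun_obj hF' (CX _)) (hq g)).
Qed.

Lemma skeleton_symmetric F p v c : star_monoidal_functor star CC F ->
  skeletal F (gh_lift p) v c -> gh_nonvanishing c /\ gh_symmetric x p c.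
Proof.
move=> hF sk; split; first exact: (sk_c0 sk).
move=> i j l m k q nk nklm nq nm; have := skeleton_symmetry fb hF sk nk nklm nq nm.
by rewrite /gh_associator !gh_fusion_lift nq nm !mul1r.
Qed.

Lemma skeleton_induces F p v c : skeletal F (gh_lift p) v c -> induces F p.
Proof.
move=> sk g; have := object_iso_unitary (sk_hom sk (g, true)) (sk_unitary sk (g, true)).
by rewrite gh_lift_true.
Qed.

Lemma autoequivalence_skeleton F : Aut F -> exists p v c, skeletal F (gh_lift p) v c.
Proof.
move=> /(skeleton_exists fb)[pi [v [c sk]]].
have [p e] := gh_lift_exists (sk_pi_one sk) (sk_N sk).
by exists p, v, c; rewrite -e.
Qed.

Lemma autoequivalence_even F : Aut F -> exists2 p, induces F p & odd_perm p = false.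
Proof.
move=> hF; have [p [v [c sk]]] := autoequivalence_skeleton hF; exists p.
  exact: (skeleton_induces sk).
have [c0 Hc] := skeleton_symmetric (proj1 hF) sk.
exact: (symmetric_even sz c0 Hc).
Qed.

Lemma even_autoequivalence p : odd_perm p = false -> exists2 F, Aut F & induces F p.
Proof.
move=> /(even_gh_realized sz)[c sy]; exists (symmetry_functor star X V (gh_lift p) c).
  exact: (symmetry_functor_autoequivalence fb sy).
move=> g; rewrite /= (transport_simple fb) gh_lift_true.
exact: object_iso_refl.
Qed.

Definition alpha_conjugation h := conjugation (alpha h) (alpha h) 1 1.

Lemma alpha_invertible h : invertible_object star CC (alpha h) (alpha h) 1 1.
Proof.
have aa y : alpha h (alpha h y) = y by rewrite (alphaK rz).
split; try exact: (CX (h, false)); try exact: unitary1; try by rewrite (endo_1 (ae h)) mulr1.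
- by move=> y /=; rewrite aa mul1r mulr1.
- by move=> y /=; rewrite aa mul1r mulr1.
Qed.

Lemma alpha_simple h i y : alpha h (X i (alpha h y)) = X i y.
Proof.
have e g y' : alpha h (alpha g (alpha h y')) = alpha g y'.
  by rewrite -!(act_D act); congr (alpha _ y'); V4_arith.
by case: i => g []; rewrite /gh_simple /= -?(alpha_rho rz) e.
Qed.

Lemma alpha_gh_isometry h i j k : alpha h (V i j k) =
  (if [&& i.2, j.2 & k.2] then eps x h (k.1 + i.1 + j.1) else 1) *: V i j k.
Proof.
rewrite /gh_isometry; case: i j k => [g []] [g' []] [k []] /=; rewrite ?scale1r.
- exact: (alpha_T rz).
- by case: ifP => _; [exact: (rz_alpha_S rz)|exact: (endo0 (ae h))].
all: by case: (_ == _); rewrite ?(endo_1 (ae h)) ?(endo0 (ae h)).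
Qed.

Lemma alpha_conjugation_monoidal h F : star_monoidal_functor star CC F ->
  star_monoidal_functor star CC (comp_monoidal (alpha_conjugation h) F).
Proof.
move=> hF; have fF := mon_functor hF; have eh := ae h.
have aa y : alpha h (alpha h y) = y by rewrite (alphaK rz).
have Ca := CX (h, false).
have FC t : CC t -> star_endo star (F t) by move=> ht; exact: (obj_endo fb (fun_obj fF ht)).
have hom t t' W : CC t -> CC t' -> Hom t t' W ->
    Hom (alpha h \o F t \o alpha h) (alpha h \o F t' \o alpha h) (alpha h (fhom F t t' W)).
  move=> ht ht' hW y /=; have := fun_hom fF ht ht' hW (alpha h y) => e.
  by rewrite -!(endo_mul eh) e.
split => /=.
- split => /=.
  + move=> t ht; apply: gen_comp (Ca); apply: gen_comp (Ca) _; exact: (fun_obj fF ht).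
  + exact: hom.
  + by move=> t ht; rewrite (fun_id fF ht) (endo_1 eh).
  + move=> t t' k W W' ht ht' hk hW hW'.
    by rewrite (fun_comp fF ht ht' hk hW hW') (endo_mul eh).
- move=> t t' a W W' ht ht' hW hW'.
  by rewrite (mon_linear hF a ht ht' hW hW') (endoD eh) (endoZ eh).
- by move=> t t' W ht ht' hW; rewrite (mon_star hF ht ht' hW) (endo_star eh).
- move=> t t' ht ht'; apply: unitaryM => //; apply: endo_unitary => //.
    exact: (mon_ten_unitary hF).
  by apply: endo_unitary; [exact: FC|exact: unitary1].
- move=> t t' ht ht' y /=; rewrite aa (endo_1 (FC t ht)) (endo_1 eh) mulr1 -!(endo_mul eh).
  by have /= -> := mon_ten_hom hF ht ht' (alpha h y).
- move=> t t1 t' t1' W W' ht ht1 ht' ht1' hW hW' /=.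
  rewrite aa (endo_1 (FC t ht)) (endo_1 (FC t1 ht1)) (endo_1 eh) !mulr1 -!(endo_mul eh).
  by rewrite (mon_ten_natural hF ht ht1 ht' ht1' hW hW').
- move=> t t' k ht ht' hk /=; have htt := gen_comp ht ht'.
  rewrite (endo_1 (FC _ htt)) (endo_1 (FC t ht)) (endo_1 (FC t' ht')) (endo_1 eh) !mulr1 aa.
  by rewrite -!(endo_mul eh) (mon_assoc hF ht ht' hk).
- apply: unitaryM => //; last exact: unitary1.
  by apply: endo_unitary => //; exact: (mon_unit_unitary hF).
- move=> y; rewrite mulr1 -[X in _ * X](aa y) -(endo_mul eh).
  by have -> := mon_unit_hom hF (alpha h y); rewrite (endo_mul eh).
- move=> t ht /=; rewrite (endo_1 (FC id (unit_obj fb))) (endo_1 eh) !mulr1 -(endo_mul eh).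
  by rewrite (mon_unit_l hF ht) (endo_1 eh).
- move=> t ht /=; rewrite (endo_1 (FC t ht)) (endo_1 eh) !mulr1 aa -(endo_mul eh).
  by rewrite (mon_unit_r hF ht) (endo_1 eh).
Qed.

Definition T_channel (kap : V4 -> R[i]) (i j k : V4 * bool) : R[i] :=
  if [&& i.2, j.2 & k.2] then kap (k.1 + i.1 + j.1) else 1.

(** Since α_h X_i α_h = X_i, the permutation is unchanged. As α_h fixes S and maps T_y to ε_h(y)
    T_y, only the T channels acquire signs. *)
Lemma alpha_conjugation_skeleton h F p v c : star_monoidal_functor star CC F ->
  skeletal F (gh_lift p) v c ->
  skeletal (comp_monoidal (alpha_conjugation h) F) (gh_lift p) (fun i => alpha h (v i))
    (fun i j k => c i j k * T_channel (fun y : V4 => eps x h (p y)) i j k).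
Proof.
move=> hF sk; have fF := mon_functor hF; have eh := ae h.
have aa y : alpha h (alpha h y) = y by rewrite (alphaK rz).
have FX i : star_endo star (F (X i)) by exact: (obj_endo fb (fun_obj fF (CX i))).
pose e i j k := T_channel (fun y : V4 => eps x h (p y)) i j k.
have ee i j k : e i j k * e i j k = 1.
  by rewrite /e /T_channel; case: ifP => _; rewrite ?mulr1 ?(sol_eps2 Hx).
have e0 i j k : e i j k != 0.
  by apply: contra_eq_neq (ee i j k) => ->; rewrite mul0r eq_sym oner_eq0.
have eV i j k : (e i j k)^-1 = e i j k by apply: (mulfI (e0 i j k)); rewrite mulfV // ee.
have lift2 i : (gh_lift p i).2 = i.2 by case: i => g []; rewrite ?gh_lift_true ?gh_lift_false.
have eE i j k : alpha h (V (gh_lift p i) (gh_lift p j) (gh_lift p k)) =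
    e i j k *: V (gh_lift p i) (gh_lift p j) (gh_lift p k).
  rewrite alpha_gh_isometry !lift2 /e /T_channel; case: ifP => // /and3P[].
  case: i j k => [g []] [g' []] [k []] // _ _ _; rewrite !gh_lift_true /=.
  by rewrite -(V4_perm3 p g g' (k + g + g')) (_ : g + g' + (k + g + g') = k) //; V4_arith.
split.
- by move=> i y /=; rewrite -(alpha_simple h) -!(endo_mul eh) (sk_hom sk).
- by move=> i; apply: (endo_unitary eh); exact: (sk_unitary sk).
- exact: (sk_pi_one sk).
- by rewrite (sk_one sk) /= mulr1.
- exact: (sk_N sk).
- by move=> i j k nk; rewrite mulf_neq0 ?(sk_c0 sk).
move=> i j k nk /=; rewrite -(endo_mul eh) (sk_V sk nk).
rewrite (endo_1 (FX i)) (endo_1 eh) mulr1 !(endo_mul eh) (endoZ eh) eE -/(e i j k) invfM eV scalerA.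
by rewrite -[X (gh_lift p i) (alpha h (v j))](alpha_simple h) aa.
Qed.

(** The quotient of the two systems of scalars is a symmetry over the identity, hence by
    [gh_symmetric1] a character on the T channels up to coboundary. Conjugating F by a suitable α_h
    accounts for this character. *)
Lemma induces_out_equiv F F' p : Aut F -> Aut F' -> induces F p -> induces F' p ->
  out_equiv star CC F F'.
Proof.
move=> [hF eF] [hF' eF'] hp hp'.
have [q [v [c sk]]] := autoequivalence_skeleton (conj hF eF).
have [q' [v' [c' sk']]] := autoequivalence_skeleton (conj hF' eF').
have e := induces_unique (skeleton_induces sk) hp; have e' := induces_unique (skeleton_induces sk') hp'.
subst q q'.
have [c0 Hc] := skeleton_symmetric hF sk; have [c0' Hc'] := skeleton_symmetric hF' sk'.
pose r i j k := c' i j k / c i j k.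
have Hr : gh_symmetric x 1 r.
  move=> i j l m k q nk nklm nq nm; rewrite !gh_lift1 /r.
  have := Hc i j l m k q nk nklm nq nm; have := Hc' i j l m k q nk nklm nq nm.
  have := c0 _ _ _ nk; have := c0 _ _ _ nklm; have := c0 _ _ _ nq; have := c0 _ _ _ nm.
  move: (gh_coef x (gh_lift p i) _ _ _ _ _) (gh_coef x i _ _ _ _ _) => f' f.
  move: (c i j k) (c k l m) (c j l q) (c i q m) (c' i j k) (c' k l m) (c' j l q) (c' i q m).
  move=> a1 a2 b1 b2 a1' a2' b1' b2' n4 n3 n2 n1 e' e.
  have a0 : a1 * a2 * (b1 * b2) != 0 by rewrite !mulf_neq0.
  apply: (mulIf a0); transitivity (a1' * a2' * (b1 * b2 * f)).
    by field; rewrite n1 n2.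
  rewrite -e; transitivity (a1 * a2 * (a1' * a2' * f')); first by ring.
  by rewrite e'; field; rewrite n3 n4.
have r0 : gh_nonvanishing r by move=> i j k nk; rewrite mulf_neq0 ?invr_eq0 ?c0 ?c0'.
have [mu [kap [mu0 kap0 kapD rE]]] := gh_symmetric1 Hx Hr r0.
(* The linear part of p. The character kap composed with its inverse is χ_h for some h; the sign t =
   ε_h(p(0)) left over by the translation part is a coboundary and goes into [mu]. *)
pose th := (p * V4_translation (p 0))%g.
have thE u : th u = p u + p 0 by rewrite permM V4_translationE.
have thD u w : th (u + w) = th u + th w by rewrite !thE V4_perm_affine; V4_arith.
have thV u w : th^-1%g (u + w) = th^-1%g u + th^-1%g w.
  by apply: (@perm_inj _ th); rewrite thD !permKV.
have [h hE] : exists h, forall u, chi s h u = kap (th^-1%g u).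
  by apply: (V4_characters sz) => [u|u w]; rewrite ?thV.
have hpE u : eps x h (p u) = kap u * eps x h (p 0).
  have -> : kap u = eps x h (p u + p 0) by rewrite -thE [RHS]hE permK.
  by rewrite (sol_eps_bichar Hx) -mulrA (sol_eps2 Hx) mulr1.
pose t := eps x h (p 0); have tt : t * t = 1 by exact: (sol_eps2 Hx).
have t0 : t != 0 by apply: contra_eq_neq tt => ->; rewrite mul0r eq_sym oner_eq0.
exists (alpha h), (alpha h), 1, 1; split; first exact: alpha_invertible.
apply: (skeleton_isomorphic fb (alpha_conjugation_monoidal h hF) hF'
  (alpha_conjugation_skeleton h hF sk) sk' (mu := fun i => (if i.2 then t else 1) * mu i)) => [i|i j k nk].
  by case: i => g []; rewrite mulf_neq0 ?oner_neq0.
have rE' : c' i j k * mu i * mu j = c i j k * (T_channel kap i j k * mu k).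
  by rewrite -rE // /r; have := c0 i j k nk; move: (c i j k) => d d0; field.
transitivity (c' i j k * mu i * mu j * ((if i.2 then t else 1) * (if j.2 then t else 1))); first by ring.
rewrite rE' /T_channel; have {}hpE u : chi s h (p u) = kap u * t := hpE u.
case: i j k nk {rE rE'} => [g []] [g' []] [k []] nk; try (by move/eqP: nk => /(congr1 snd));
  rewrite /= ?mul1r ?mulr1 ?tt ?mulr1 ?hpE //; by ring: tt.
Qed.

(** By [object_iso_fusion] the product of an invertible simple object with its inverse has the unit
    as its only channel, so neither factor is of the form α_gρ, and both are the same α_h.
    Conjugation by α_h fixes every α_gρ. *)
Lemma out_equiv_induces F F' p : Aut F -> induces F p -> out_equiv star CC F F' -> induces F' p.
Proof.
move=> [hF _] hp [X0 [Y0 [ev [cv [iv [u [nu _ _]]]]]]] g; have fF := mon_functor hF.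
have [i [j [iX iY iXY]]] := invertible_simple sa fb iv.
have Ci := CX (g, true).
have iF : object_iso (X0 \o F (X (g, true)) \o Y0) (F' (X (g, true))).
  have [w [wu uw]] := nat_inv nu Ci.
  by exists (u (X (g, true))), w; split=> //; exact: (nat_hom nu Ci).
apply: object_iso_trans iF.
have ig : object_iso (X i \o X (p g, true) \o X j) (X0 \o F (X (g, true)) \o Y0).
  have ei := fb_endo fb i.
  exact: (object_iso_comp (endo_comp ei (fb_endo fb (p g, true))) (object_iso_comp ei iX (hp g)) iY).
have {iX iY} := object_iso_fusion fb (l := (i.1 + j.1, i.2 || j.2)) iXY.
have := object_iso_fusion fb (l := (0, true)) iXY.
case: i j ig {iXY} => [h b] [h' b'] ig; rewrite /gh_fusion /=; case: ifP => [bb /(_ isT)//|_ _].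
rewrite eqxx => /(_ isT) e; move: ig.
have [eb e1] : (b || b') = false /\ h + h' = 0.
  by have /= e1 := congr1 fst e; have /= e2 := congr1 snd e.
have -> : h' = h by apply/eqP; rewrite V4_eq_add addrC e1.
move/norP: (negbT eb) => [/negPf-> /negPf->]; apply: object_iso_trans.
rewrite (_ : X (h, false) \o X (p g, true) \o X (h, false) = X (p g, true)); first exact: object_iso_refl.
by apply/funext => y; exact: (alpha_simple h (p g, true)).
Qed.

Lemma Out_isomorphic_Alt : Out_isomorphic_to star CC 'Alt_('I_4).
Proof.
have cV : #|{: V4}| = 4 by rewrite card_prod !card_ord.
pose e (g : V4) : 'I_4 := cast_ord cV (enum_rank g).
pose e' (n : 'I_4) : V4 := enum_val (cast_ord (esym cV) n).
have eK : cancel e e' by move=> g; rewrite /e /e' cast_ordK enum_rankK.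
have e'K : cancel e' e by move=> n; rewrite /e /e' enum_valK cast_ordKV.
pose tr := transport_perm eK e'K.
have trM p q : tr (p * q)%g = (tr p * tr q)%g := transport_permM eK e'K p q.
have trV p : tr p^-1%g = (tr p)^-1%g := transport_permV eK e'K p.
pose pF F : {perm V4} := if pselect (exists p, induces F p) is left h then sval (cid h) else 1%g.
have pFP F p : induces F p -> pF F = p.
  move=> hp; rewrite /pF; case: pselect => [h|[]]; last by exists p.
  by case: (cid h) => q /= hq; exact: (induces_unique hq hp).
have pFA F : Aut F -> induces F (pF F) /\ odd_perm (pF F) = false.
  by move=> /autoequivalence_even[p hp ev]; rewrite (pFP F p hp).
(* A product of permutations applies its left factor first, opposite to composition of functors; the
   inverse turns the anti-homomorphism into a homomorphism. *)
exists (fun F => (tr (pF F))^-1%g); split.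
- by move=> F /pFA[_ ev]; rewrite Alt_even odd_permV odd_transport_perm ev.
- move=> F F' hF hF'; have [iF _] := pFA F hF; have [iF' _] := pFA F' hF'; split.
    move/invg_inj/(@transport_perm_injective _ _ _ _ eK e'K) => e1.
    by apply: (induces_out_equiv hF hF' iF); rewrite e1.
  by move/(out_equiv_induces hF iF)/pFP->.
- move=> a; rewrite Alt_even => ea.
  pose tr' := transport_perm e'K eK.
  have trK b : tr (tr' b) = b.
    by apply/permP => n; rewrite -[n]e'K transport_permE -[in LHS](eK (e' n)) !e'K transport_permE.
  have [|F hF iF] := even_autoequivalence (p := tr' a^-1%g).
    by rewrite odd_transport_perm odd_permV (negbTE ea).
  by exists F; rewrite ?(pFP F _ iF) // trK invgK.
move=> F F' hF hF'; have [iF _] := pFA F hF; have [iF' _] := pFA F' hF'.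
rewrite (pFP _ _ (induces_comp (mon_functor (proj1 hF)) (mon_functor (proj1 hF')) iF iF')).
by rewrite trM invMg.
Qed.

End Outer.

Theorem theorem9p4 (R : realType) :
  [/\ gh_dim R V4 = 2 + Num.sqrt 5,
      forall x : gh_data R V4,
        gh_solution x <->
        exists s z : R[i], V4_parameters s z /\ x = V4_data s z,
      (forall s z s' z' : R[i], V4_parameters s z -> V4_parameters s' z' ->
         z \is Num.real -> z' \is Num.real ->
         gauge_aut_equiv (V4_data s z) (V4_data s' z')) /\
      (forall s z s' z' : R[i], V4_parameters s z -> V4_parameters s' z' ->
         (exists2 t : R[i], t \is Num.real & z = 'i * t) ->
         (exists2 t : R[i], t \is Num.real & z' = 'i * t) ->
         gauge_aut_equiv (V4_data s z) (V4_data s' z')),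
      (exists x : gh_data R V4, gh_solution x) /\
      (forall x y : gh_data R V4,
         gh_solution x -> gh_solution y -> gauge_aut_H2_equiv x y) &
      forall (x : gh_data R V4) (M : algType R[i]) (star : M -> M)
             (alpha : V4 -> M -> M) (rho : M -> M) (S : M) (T : V4 -> M),
        gh_solution x -> type_III_factor star ->
        realization x star alpha rho S T ->
        Out_isomorphic_to star (generated_object star rho) 'Alt_('I_4)].
Proof.
split.
- exact: gh_dim_V4.
- exact: V4_solutions.
- split=> s z s' z' sz sz' zr zr'; have [e h] := sign_parametersP sz; have [e' h'] := sign_parametersP sz'.
    by apply: (V4_data_equiv h); rewrite (sign_parameters_real h zr) -(sign_parameters_real h' zr').
  by apply: (V4_data_equiv h); rewrite (sign_parameters_imaginary h zr) -(sign_parameters_imaginary h' zr').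
- split; first exact: V4_solution_exists.
  move=> x y /V4_solutions[s [z [sz ->]]] /V4_solutions[s' [z' [sz' ->]]].
  have [e h] := sign_parametersP sz; have [e' h'] := sign_parametersP sz'.
  exact: (V4_data_H2_equiv h h').
move=> x M star alpha rho S T /V4_solutions[s [z [sz ->]]] [vn factor _] rz.
exact: (Out_isomorphic_Alt sz (von_neumann_star_algebra vn) factor rz).
Qed.
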